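(* Let $u$ be a minimizer of $J$. Then: (1) If $x_0\in\partial\{u>0\}$ and \[ \liminf_{\rho\to0}\frac{|B_\rho(x_0)\cap\{u>0\}|}{|B_\rho|}\ge\theta_* \] for some $\theta_*>0$, then $\sup_{B_r(x_0)}|u|\ge\bar c\,r^2$ as long as $B_r(x_0)\subset\subset\Omega$, for some $\bar c>0$ depending on $\theta_*$, $n$, ${\rm dist}(B_r(x_0),\partial\Omega)$ and $\|u_0\|_{W^{2,2}(\Omega)}$. (2) If $x_0\in\{u>0\}$ and $r:={\rm dist}(x_0,\partial\{u>0\})$, then $\sup_{B_r(x_0)}u^+\ge\bar c\,r^2$, as long as $B_r(x_0)\subset\subset\Omega$, for some $\bar c>0$ depending on $n$, ${\rm dist}(B_r(x_0),\partial\Omega)$ and $\|u_0\|_{W^{2,2}(\Omega)}$.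
   Context: $\Omega\subset\mathbb R^n$ is a smooth bounded domain and $u_0\in W^{2,2}(\Omega)$ is given. $J[u]:=\int_\Omega\big(|\Delta u|^2+\chi_{\{u>0\}}\big)$ and $\mathcal A:=\{u\in W^{2,2}(\Omega): u-u_0\in W^{1,2}_0(\Omega)\}$. A minimizer of $J$ is $u\in\mathcal A$ with $J[u]\le J[v]$ for all $v\in\mathcal A$. Minimizers are (represented by) $C^{1,\alpha}_{\rm loc}(\Omega)$ functions for every $\alpha\in(0,1)$. The free boundary is $\partial\{u>0\}$ (in $\Omega$), $u^+(x):=\max\{u(x),0\}$, and $|E|$ denotes Lebesgue measure. *)

(* Defs.v *)
From HB Require Import structures.
From mathcomp Require Import all_boot all_order all_algebra.
From mathcomp Require Import all_classical all_reals all_analysis.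
Set Implicit Arguments.
Unset Strict Implicit.
Unset Printing Implicit Defensive.
Import Order.TTheory GRing.Theory Num.Theory.
Import numFieldNormedType.Exports.
Local Open Scope classical_set_scope.
Local Open Scope ring_scope.

Section measurable_row.
Context {R : realType} (n : nat).

Definition row_coord (i : 'I_n) (x : 'rV[R]_n) : measurableTypeR R := x ord0 i.

Let row_set0 : g_sigma_preimage row_coord set0.
Proof. exact: sigma_algebra0. Qed.

Let row_setC A : g_sigma_preimage row_coord A ->
  g_sigma_preimage row_coord (~` A).
Proof. exact: sigma_algebraC. Qed.

Let row_bigcup (F : _^nat) : (forall i, g_sigma_preimage row_coord (F i)) ->
  g_sigma_preimage row_coord (\bigcup_i (F i)).
Proof. exact: sigma_algebra_bigcup. Qed.

(* The product of the Borel sigma-algebras of the coordinates, which is the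
   Borel sigma-algebra of R^n. *)
HB.instance Definition _ := @isMeasurable.Build default_measure_display
  'rV[R]_n (g_sigma_preimage row_coord) row_set0 row_setC row_bigcup.

Lemma measurable_row_coord i : measurable_fun [set: 'rV[R]_n] (row_coord i).
Proof.
move=> _ Y mY; rewrite setTI; apply: sub_sigma_algebra => /=.
rewrite -bigcup_seq/=; exists i => /=; first by rewrite mem_index_enum.
by exists Y => //; rewrite setTI.
Qed.

Lemma measurable_fun_rowP d (T : measurableType d) (f : T -> 'rV[R]_n) :
  (forall i, measurable_fun [set: T] (row_coord i \o f)) ->
  measurable_fun [set: T] f.
Proof.
move=> mf _ A mA; rewrite setTI.
have : <<s preimage_set_system setT f
    (\big[setU/set0]_(i < n)
      preimage_set_system setT (row_coord i) measurable) >> (f @^-1` A).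
  by rewrite g_sigma_preimageE; exists A => //; rewrite setTI.
apply: smallest_sub; first exact: sigma_algebra_measurable.
move=> _ [B + <-]; rewrite -bigcup_seq/= => -[i _ [C mC <-]].
by rewrite !setTI; have := mf i measurableT C mC; rewrite setTI.
Qed.

End measurable_row.

Section row_cons_measure.
Context {R : realType} (n : nat).
Variable mu : {sigma_finite_measure set 'rV[R]_n -> \bar R}.
Local Open Scope ereal_scope.

Definition row_cons (p : measurableTypeR R * 'rV[R]_n) : 'rV[R]_n.+1 :=
  (\row_i oapp (p.2 ord0) p.1 (unlift ord0 i))%R.

Definition row_uncons (x : 'rV[R]_n.+1) : measurableTypeR R * 'rV[R]_n :=
  (x ord0 ord0, (\row_i x ord0 (lift ord0 i))%R).

Lemma row_consK : cancel row_cons row_uncons.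
Proof.
move=> [a v]; rewrite /row_uncons/row_cons !mxE unlift_none/=; congr pair.
by apply/rowP => i; rewrite !mxE liftK.
Qed.

Lemma measurable_row_cons : measurable_fun setT row_cons.
Proof.
apply: measurable_fun_rowP => i.
case: (unliftP ord0 i) => [j ->|->].
- rewrite (_ : _ \o _ = row_coord j \o snd).
    exact: measurableT_comp (@measurable_row_coord R n j) measurable_snd.
  by apply/funext => p; rewrite /row_coord/= mxE liftK.
- rewrite (_ : _ \o _ = fst); first exact: measurable_fst.
  by apply/funext => p; rewrite /row_coord/= mxE unlift_none.
Qed.

Lemma measurable_row_uncons : measurable_fun setT row_uncons.
Proof.
apply/measurable_fun_pairP; split.
  exact: (@measurable_row_coord R n.+1 ord0).
apply: measurable_fun_rowP => i.
rewrite (_ : _ \o _ = row_coord (lift ord0 i)).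
  exact: measurable_row_coord.
by apply/funext => x; rewrite /row_coord/= mxE.
Qed.

Definition row_cons_measure : set 'rV[R]_n.+1 -> \bar R :=
  pushforward (lebesgue_measure \x mu) row_cons.

Let row_cons_measure0 : row_cons_measure set0 = 0.
Proof. by rewrite /row_cons_measure /pushforward preimage_set0 measure0. Qed.

Let row_cons_measure_ge0 A : 0 <= row_cons_measure A.
Proof. by rewrite /row_cons_measure /pushforward measure_ge0. Qed.

Let row_cons_measure_sigma_additive : semi_sigma_additive row_cons_measure.
Proof.
move=> F mF tF mUF; rewrite /row_cons_measure /pushforward preimage_bigcup.
have mf := measurable_row_cons.
apply: measure_semi_sigma_additive.
- by move=> k; rewrite -[X in measurable X]setTI; exact: mf.
- apply/trivIsetP => /= i j _ _ ij; rewrite -preimage_setI.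
  by move/trivIsetP : tF => /(_ _ _ _ _ ij) ->//; rewrite preimage_set0.
- by rewrite -preimage_bigcup -[X in measurable X]setTI; exact: mf.
Qed.

HB.instance Definition _ := isMeasure.Build _ _ _ row_cons_measure
  row_cons_measure0 row_cons_measure_ge0 row_cons_measure_sigma_additive.

Let row_cons_measure_sigma_finite : sigma_finite setT row_cons_measure.
Proof.
have /sigma_finiteP[F [FT ndF Foo]] := sigma_finiteT (@lebesgue_measure R).
have /sigma_finiteP[G [GT ndG Goo]] := sigma_finiteT mu.
exists (fun k => row_uncons @^-1` (F k `*` G k)).
  rewrite -preimage_bigcup; apply/esym/seteqP; split => // x _.
  have : (\bigcup_k F k) (row_uncons x).1 by rewrite -FT.
  have : (\bigcup_k G k) (row_uncons x).2 by rewrite -GT.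
  move=> [j _ Gj] [i _ Fi]; exists (maxn i j) => //; split.
    by move: Fi; exact/subsetPset/ndF/leq_maxl.
  by move: Gj; exact/subsetPset/ndG/leq_maxr.
move=> k; have [mF Fk] := Foo k; have [mG Gk] := Goo k; split.
  rewrite -[X in measurable X]setTI; apply: measurable_row_uncons => //.
  exact: measurableX.
rewrite /row_cons_measure /pushforward.
rewrite (_ : row_cons @^-1` _ = F k `*` G k); last first.
  by apply/funext => x; rewrite /preimage /mkset row_consK.
by rewrite product_measure1E// lte_mul_pinfty// ge0_fin_numE.
Qed.

HB.instance Definition _ := Measure_isSigmaFinite.Build _ _ _ row_cons_measure
  row_cons_measure_sigma_finite.

End row_cons_measure.

(* Lebesgue measure on R^n (on Borel sets): the n-fold product of the Lebesgue
   measure on R. *)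
Fixpoint lebesgue_row {R : realType} (n : nat) :
    {sigma_finite_measure set 'rV[R]_n -> \bar R} :=
  match n with
  | 0 => \d_(0 : 'rV[R]_0)
  | m.+1 => row_cons_measure (lebesgue_row m)
  end.

Lemma lebesgue_row_box (R : realType) (n : nat) (A : 'I_n -> set R) :
  (forall i, measurable (A i : set (measurableTypeR R))) ->
  (lebesgue_row n [set x : 'rV[R]_n | forall i, A i (x ord0 i)] =
   \prod_(i < n) lebesgue_measure (A i))%E.
Proof.
elim: n A => [|n IH] A mA.
  rewrite big_ord0 /= diracE mem_set//= => i; by case: i.
rewrite big_ord_recl/= /row_cons_measure /pushforward.
rewrite (_ : _ @^-1` _ = A ord0 `*`
    [set x : 'rV[R]_n | forall i, A (lift ord0 i) (x ord0 i)]); last first.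
  apply/seteqP; split => [[a v]/= H|[a v]/= [Ha Hv] i].
    split; first by have := H ord0; rewrite mxE unlift_none.
    by move=> i; have := H (lift ord0 i); rewrite mxE liftK.
  by case: (unliftP ord0 i) => [j ->|->]; rewrite mxE ?liftK ?unlift_none.
have mB : measurable [set x : 'rV[R]_n | forall i, A (lift ord0 i) (x ord0 i)].
  rewrite (_ : [set x | _] = \bigcap_(i in [set: 'I_n])
     (row_coord i @^-1` A (lift ord0 i))); last first.
    by apply/seteqP; split => x /= H i; [move=> _|]; exact: H.
  apply: fin_bigcap_measurable => [|i _]; first exact: finite_finset.
  by rewrite -[X in measurable X]setTI; exact: measurable_row_coord.
rewrite product_measure1E//; congr (_ * _)%E.
by apply: (IH (fun i => A (lift ord0 i))) => i; exact: mA.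
Qed.

Section euclidean.
Context {R : realType} {n : nat}.
Implicit Types (x y : 'rV[R]_n) (A B : set 'rV[R]_n).

(* The library norm `|x| on row vectors is the sup norm; it induces the same
   topology, but balls and distances below are Euclidean. *)
Definition enorm x : R := Num.sqrt (\sum_i x ord0 i ^+ 2).

Definition eball x (r : R) : set 'rV[R]_n := [set y | enorm (y - x) < r].

(* Equal to +oo if A or B is empty. *)
Definition set_dist A B : \bar R :=
  ereal_inf [set (enorm (x - y))%:E | x in A & y in B].

Definition boundary A : set 'rV[R]_n := closure A `\` A°.

End euclidean.

Section smooth.
Context {R : realType} {n : nat}.
Implicit Types (f g phi : 'rV[R]_n -> R) (s : seq 'I_n) (Omega : set 'rV[R]_n).

Definition partial (i : 'I_n) f : 'rV[R]_n -> R :=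
  fun x => 'D_(delta_mx ord0 i) f x.

Definition pderiv s f : 'rV[R]_n -> R := foldr partial f s.

Definition smooth f : Prop :=
  forall s, continuous (pderiv s f) /\
    forall i x, derivable (pderiv s f) x (delta_mx ord0 i).

(* The derivative of multi-index a, that is, of order a i in direction i. *)
Definition mderiv (a : 'I_n -> nat) f : 'rV[R]_n -> R :=
  pderiv (flatten [seq nseq (a i) i | i <- enum 'I_n]) f.

Definition test_function Omega phi : Prop :=
  smooth phi /\
  exists K, [/\ compact K, K `<=` Omega & forall x, ~ K x -> phi x = 0].

(* Near each boundary point, and up to relabelling and reorienting the
   coordinate axes, Omega is the strict epigraph of a smooth function gamma of
   the coordinates other than the i-th one. *)
Definition smooth_boundary Omega : Prop :=
  forall p, boundary Omega p ->
    exists (i : 'I_n) (b : bool) (gamma : 'rV[R]_n -> R) (r : R),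
      [/\ 0 < r, smooth gamma,
          (forall x y : 'rV[R]_n, (forall j, j != i -> x ord0 j = y ord0 j) ->
             gamma x = gamma y) &
          Omega `&` eball p r =
            [set x | eball p r x /\ gamma x < (-1) ^+ b * x ord0 i]].

Definition smooth_bounded_domain Omega : Prop :=
  [/\ Omega !=set0, open Omega, connected Omega, bounded_set Omega &
      smooth_boundary Omega].

End smooth.

Section sobolev.
Context {R : realType} {n : nat}.
Implicit Types (f g u v w phi : 'rV[R]_n -> R) (a : 'I_n -> nat) (k : nat).
Variable Omega : set 'rV[R]_n.
Local Notation leb := (lebesgue_row n).

(* Functions on Omega are represented by functions on R^n, whose values outside
   Omega are irrelevant. *)

Definition locally_integrable_on f : Prop :=
  forall K, compact K -> K `<=` Omega -> leb.-integrable K (EFin \o f).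

Definition is_weak_deriv a f g : Prop :=
  [/\ locally_integrable_on f, locally_integrable_on g &
      forall phi, test_function Omega phi ->
        \int[leb]_(x in Omega) (f x * mderiv a phi x) =
        (-1) ^+ (\sum_i a i)%N * \int[leb]_(x in Omega) (g x * phi x)].

(* A choice of the weak derivative, which is unique up to a null set. *)
Definition weak_deriv a f : 'rV[R]_n -> R :=
  xget (fun=> 0) [set g | is_weak_deriv a f g].

Definition L2 f : Prop :=
  measurable_fun Omega f /\
  (\int[leb]_(x in Omega) ((`|f x| ^+ 2)%R)%:E < +oo)%E.

(* The space W^{k,2}(Omega). *)
Definition sobolev k f : Prop :=
  L2 f /\ forall a, (\sum_i a i <= k)%N -> exists2 g, L2 g & is_weak_deriv a f g.

(* The multi-indices of order at most k have entries at most k, hence the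
   finite type indexing the sum. *)
Definition sobolev_norm k f : R :=
  Num.sqrt (\sum_(a : {ffun 'I_n -> 'I_k.+1} | (\sum_i a i <= k)%N)
    \int[leb]_(x in Omega) (`|weak_deriv (fun i => a i : nat) f x| ^+ 2)).

(* The space W^{1,2}_0(Omega), the closure of the test functions in
   W^{1,2}(Omega). *)
Definition sobolev0 f : Prop :=
  sobolev 1 f /\
  forall e, 0 < e -> exists2 phi, test_function Omega phi &
    sobolev_norm 1 (fun x => f x - phi x) < e.

Definition laplacian f : 'rV[R]_n -> R :=
  fun x => \sum_i weak_deriv (fun j => if j == i then 2%N else 0%N) f x.

(* {u > 0}. *)
Definition positivity_set u : set 'rV[R]_n := [set x | Omega x /\ 0 < u x].

Definition free_boundary u : set 'rV[R]_n :=
  Omega `&` boundary (positivity_set u).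

Definition functional_J u : \bar R :=
  (\int[leb]_(x in Omega)
     ((`|laplacian u x| ^+ 2 + \1_(positivity_set u) x)%R)%:E)%E.

Definition admissible u0 u : Prop :=
  sobolev 2 u /\ sobolev0 (fun x => u x - u0 x).

Definition minimizer u0 u : Prop :=
  admissible u0 u /\
  forall v, admissible u0 v -> (functional_J u <= functional_J v)%E.

End sobolev.

(* The Lebesgue measure of a bounded Borel set, as a real number. *)
Definition volume {R : realType} {n : nat} (A : set 'rV[R]_n) : R :=
  fine (lebesgue_row n A).

(* Main.v *)
(* Write D for the Laplacian of u and e(rho)^2 for rho^(-n-4) times the integral
   of u^2 over B_rho(x0). Comparing u with u - t u eta, with u - t phi (phi >= 0)
   and with u - u eta gives that D integrates to 0 against the Laplacian of u eta,
   that D is weakly superharmonic, and that {u > 0} meets {eta = 1} in a set of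
   measure at most the integral of the square of the Laplacian of u eta. With
   eta = zeta^4 the first fact is a Caccioppoli inequality, so that {u > 0} fills
   at most C rho^n e(rho)^2 of B_(rho/2): a ball contained in {u > 0} has e(rho),
   hence sup u / rho^2, bounded below, which is (2).

   For (1), u(x0) = 0 and the superharmonicity of D bound suitable means of u over
   B_rho from below by - C e(r) rho^2, for rho <= r. Since the positive part of u
   lives on a small set, the mean of |u| over B_(rho/4) is at most
   C rho^2 (e(r) + e(rho)^2), and Nash's inequality combined with Caccioppoli's
   yields, for all delta > 0,
     e(rho/8)^2 <= C (delta^2 e(rho)^2 + delta^(-n) (e(r) + e(rho)^2)^2).
   If e(r) is small this iterates to e(r/8^k) <= C e(r) for all k, and {u > 0} has
   density at most C e(r)^2 at x0. Hence e(r), and so sup |u| / r^2, is bounded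
   below. All constants depend on n and theta only. *)
Require Import Defs.
From HB Require Import structures.
From mathcomp Require Import all_boot all_order all_algebra.
From mathcomp Require Import all_classical all_reals all_analysis.
From mathcomp Require Import ring lra.
From mathcomp Require Import measurable_realfun.
Set Implicit Arguments.
Unset Strict Implicit.
Unset Printing Implicit Defensive.
Import Order.TTheory GRing.Theory Num.Theory.
Import numFieldNormedType.Exports.
Local Open Scope classical_set_scope.
Local Open Scope ring_scope.

(** * Lebesgue measure on row vectors *)

(** Replacing u(x) by u(rho x) / rho^2 multiplies both terms of the functional by the same power of
    rho. Hence every estimate can be put in scale-invariant form, and no constant sees the domain or
    u0. The obstacle in (1) is to carry smallness of e from the scale r down to all smaller scales:
    bounds that are merely linear in e(rho), with a constant above 1, are useless under iteration.
    Two facts help. First, a suitable weighted mean of D over B_rho does not increase with rho, so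
    at every scale it is bounded below by its value at the top scale r, that is by - C e(r); and the
    rho-derivative of a weighted mean of u is rho times such a mean of D. Second, a lower bound for
    the mean of u is enough, because |u| = 2 u^+ - u and the mean of u^+ is quadratic in e(rho): by
    Cauchy-Schwarz it costs the L^2 norm of u times the square root of the measure of {u > 0}, each
    of order e(rho). Nash's inequality then turns the L^1 bound back into an L^2 bound; its free
    parameter delta absorbs the linear term, and what remains is quadratic. *)

Section row_measure.
Context {R : realType} {n : nat}.
Local Notation leb := (@lebesgue_row R n).
Local Notation V := 'rV[R]_n.

Definition row_box (A : 'I_n -> set R) : set V :=
  [set x | forall i, A i (x ord0 i)].

Definition row_cube (k : R) : set V := row_box (fun=> `[- k, k]%classic).

Lemma measurable_row_box (A : 'I_n -> set R) :
  (forall i, measurable (A i : set (measurableTypeR R))) ->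
  measurable (row_box A).
Proof.
move=> mA; rewrite (_ : row_box A = \bigcap_(i in [set: 'I_n])
    (row_coord i @^-1` A i)); last first.
  by apply/seteqP; split => x /= H i; [move=> _|]; exact: H.
apply: fin_bigcap_measurable => [|i _]; first exact: finite_finset.
by rewrite -[X in measurable X]setTI; exact: measurable_row_coord.
Qed.

(** An open set is a countable union of cubes with rational centre and rational half-width. *)
Lemma open_measurable_row (A : set V) : open A -> measurable A.
Proof.
move=> oA.
pose B (p : 'rV[rat]_n * rat) := row_box (fun i =>
  `](ratr (p.1 ord0 i) - ratr p.2 : R), (ratr (p.1 ord0 i) + ratr p.2)[%classic).
have mB p : measurable (B p) by apply: measurable_row_box => i; exact: measurable_itv.
rewrite (_ : A = \bigcup_(p in [set p | B p `<=` A]) B p).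
  rewrite bigcup_mkcond; apply: countable_bigcupT_measurable => [|p]; first exact: countableP.
  by case: ifP.
apply/seteqP; split => [x Ax|x [p /= pA]]; last exact: pA.
have /nbhs_ballP[e /= e0 eA] : nbhs x A by apply: open_nbhs_nbhs.
(* The half-width q is below e / 2 and the centre is within q of x, so the points of the cube are
   within 2 q < e of x in the sup norm. *)
have : e / 4 < e / 2 by rewrite ltr_pM2l// ltf_pV2 ?posrE// ltr_nat.
move=> /rat_in_itvoo[q]; rewrite in_itv/= => /andP[q1 q2].
have q0 : 0 < (ratr q : R) by apply: lt_trans q1; rewrite divr_gt0.
have /choice[c cP] : forall i : 'I_n, exists c : rat,
    x ord0 i - ratr q < (ratr c : R) < x ord0 i + ratr q.
  move=> i; have : x ord0 i - ratr q < x ord0 i + ratr q :> R by lra.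
  by move=> /rat_in_itvoo[c]; rewrite in_itv/= => cP; exists c.
exists (\row_i c i, q) => /= [y By|i]; last first.
  by rewrite /= in_itv/= mxE; move: (cP i) => /andP[? ?]; apply/andP; split; lra.
apply: eA; split => // i j; rewrite ord1 -ball_normE/=.
have := By j; rewrite /= in_itv/= mxE => /andP[? ?].
move: (cP j) => /andP[? ?]; rewrite ltr_norml; apply/andP; split; lra.
Qed.

Lemma closed_measurable_row (A : set V) : closed A -> measurable A.
Proof.
by move/closed_openC/open_measurable_row/measurableC; rewrite setCK.
Qed.

Lemma compact_measurable_row (A : set V) : compact A -> measurable A.
Proof. by move=> cA; apply: closed_measurable_row; apply: compact_closed cA; exact: norm_hausdorff. Qed.

Lemma continuous_measurable_row (f : V -> R) :
  continuous f -> measurable_fun setT f.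
Proof.
move=> /continuousP cf.

apply: (measurability _ (RGenOpens.measurableE R)) => //.
move=> _ [_ [a [b ->] <-]]; rewrite setTI.
apply: open_measurable_row; apply: cf.
exact: interval_open.
Qed.

Lemma row_box_generates :
  @measurable _ V = <<s [set row_box A | A in
     [set A | forall i, measurable (A i : set (measurableTypeR R))]] >>.
Proof.
apply/seteqP; split; last first.
  apply: smallest_sub; first exact: sigma_algebra_measurable.
  by move=> _ [A mA <-]; exact: measurable_row_box.
apply: smallest_sub; first exact: smallest_sigma_algebra.
move=> X; rewrite -bigcup_seq/= => -[i _ [C mC <-]].
apply: sub_sigma_algebra; rewrite setTI.
exists (fun j => if j == i then C else setT).
  by move=> j; case: ifP.
apply/seteqP; split => x /=; first by move=> /(_ i); rewrite eqxx.
by move=> Cx j; case: eqP => // ->.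
Qed.

(** Boxes form a pi-system generating the sigma-algebra, and the cubes [row_cube k] exhaust the
    space with finite measure. *)
Lemma row_measure_unique (m1 m2 : {measure set V -> \bar R}) :
  (forall A, (forall i, measurable (A i : set (measurableTypeR R))) ->
    m1 (row_box A) = m2 (row_box A)) ->
  (forall k : nat, m1 (row_cube k%:R) < +oo)%E ->
  forall A, measurable A -> m1 A = m2 A.
Proof.
move=> m12 m1oo; apply: (measure_unique _ (fun k => row_cube k%:R) row_box_generates).
- move=> _ _ [A mA <-] [B mB <-].
  exists (fun i => A i `&` B i); first by move=> i; exact: measurableI.
  apply/seteqP; split => x /=; first by move=> h; split => i; have [] := h i.
  by move=> [h1 h2] i; split.
- by move=> k; exists (fun=> `[- k%:R, k%:R : R]%classic).
- apply/seteqP; split => // x _.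
  exists (\sum_i Num.truncn `|x ord0 i|).+1 => //= i; rewrite /= in_itv/= -ler_norml.
  apply: (@le_trans _ _ (Num.truncn `|x ord0 i|).+1%:R); first exact/ltW/Num.Theory.truncnS_gt.
  by rewrite ler_nat ltnS (bigD1 i)//= leq_addr.
- by move=> _ [A mA <-]; exact: m12.
- exact: m1oo.
Qed.

Lemma lebesgue_row_boundedE (k : R) :
  (leb (row_cube k) < +oo)%E.
Proof.
rewrite [X in (X < _)%E](lebesgue_row_box (A := fun=> `[- k, k]%classic)); last by move=> _; exact: measurable_itv.
rewrite ltey_eq; apply/orP; left.
elim/big_ind: _ => [//|a b|i _]; first exact: fin_numM.
by rewrite lebesgue_measure_itv/=; case: ifP.
Qed.

End row_measure.

(** * Translation invariance, and finiteness on bounded sets *)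

Section row_shift.
Context {R : realType} {n : nat}.
Local Notation leb := (@lebesgue_row R n).
Local Notation V := 'rV[R]_n.
Implicit Types (A : set V) (h : V).

(** The translated measure agrees with the Lebesgue measure on half-open intervals, which determine
    it. *)
Lemma lebesgue_measure_shift (c : R) (B : set (measurableTypeR R)) :
  measurable B ->
  lebesgue_measure ((fun x => x + c) @^-1` B : set (measurableTypeR R)) =
  lebesgue_measure B.
Proof.
move=> mB.
have mphi : measurable_fun setT ((fun x => x + c) : measurableTypeR R -> measurableTypeR R).
  exact: measurable_funD.
pose phi : {mfun measurableTypeR R >-> measurableTypeR R} :=
  HB.pack ((fun x => x + c) : measurableTypeR R -> measurableTypeR R)
    (isMeasurableFun.Build _ _ _ _ _ mphi).
apply/esym; rewrite -[RHS]/(pushforward lebesgue_measure phi B).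
apply: lebesgue_measure_unique => //= _ [[a b]] _ <-.
rewrite /pushforward/=.
rewrite (_ : _ @^-1` _ = `]a - c, b - c]%classic); last first.
  by apply/seteqP; split => x /=; rewrite !in_itv/= ltrBlDr lerBrDr.
rewrite !lebesgue_measure_itv/= !lte_fin ltrD2r; case: ifP => // _.
by rewrite -!EFinD; congr EFin; ring.
Qed.

Lemma measurable_row_shift h : measurable_fun [set: V] (fun x : V => x + h).
Proof.
apply: measurable_fun_rowP => i.
rewrite (_ : _ \o _ = fun x => row_coord i x + h ord0 i).
  by apply: measurable_funD => //; exact: measurable_row_coord.
by apply/funext => x; rewrite /row_coord/= mxE.
Qed.

Lemma lebesgue_row_shift h A : measurable A ->
  pushforward leb (fun x => x + h) A = leb A.
Proof.
move=> mA.
pose phi : {mfun V >-> V} := HB.pack (fun x : V => x + h)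
    (isMeasurableFun.Build _ _ _ _ _ (measurable_row_shift h)).
apply/esym; rewrite -[RHS]/(pushforward leb phi A).
apply: row_measure_unique mA => [B mB|k]; last exact: lebesgue_row_boundedE.
rewrite [LHS](lebesgue_row_box mB).
transitivity (leb ((fun x => x + h) @^-1` row_box B)); last by [].
rewrite (_ : (fun x => x + h) @^-1` _ = row_box (fun i => (fun x => x + h ord0 i) @^-1` B i)).
  rewrite [RHS](lebesgue_row_box (A := fun i => (fun x => x + h ord0 i) @^-1` B i)).
    by apply: eq_bigr => i _; rewrite lebesgue_measure_shift.
  move=> i; have mf : measurable_fun setT
      ((fun x => x + h ord0 i) : measurableTypeR R -> measurableTypeR R).
    exact: measurable_funD.
  by have := mf measurableT _ (mB i); rewrite setTI.
by apply/seteqP; split => x /= Bx i; have := Bx i; rewrite /= mxE.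
Qed.

Local Open Scope ereal_scope.

Lemma ge0_integral_shift h (f : V -> \bar R) : measurable_fun [set: V] f ->
  (forall x, 0 <= f x) -> \int[leb]_x f (x + h)%R = \int[leb]_x f x.
Proof.
move=> mf f0; have := @ge0_integral_pushforward _ _ V V R _ (measurable_row_shift h)
  leb setT f measurableT mf (fun x _ => f0 x).
rewrite preimage_setT => <-.
by apply: eq_measure_integral => [|mphi A mA _]; [exact: measurable_row_shift|exact: lebesgue_row_shift].
Qed.

Lemma integrable_shift h (f : V -> \bar R) :
  leb.-integrable setT f -> leb.-integrable setT (fun x => f (x + h)%R).
Proof.
move=> /integrableP[mf fi]; apply/integrableP; split.
  exact: (measurableT_comp mf (measurable_row_shift h)).
rewrite (ge0_integral_shift h (f := abse \o f))//; last by move=> x /=.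
exact: (measurableT_comp (@abse_measurable R _) mf).
Qed.

Lemma integral_shift h (f : V -> \bar R) : measurable_fun [set: V] f ->
  \int[leb]_x f (x + h)%R = \int[leb]_x f x.
Proof.
move=> mf; rewrite [LHS]integralE [RHS]integralE; congr (_ - _).
  have mp : measurable_fun [set: V] f^\+ by exact: measurable_funepos.
  rewrite -[RHS](ge0_integral_shift h mp)//.
  by apply: eq_integral => x _; rewrite !funeposE.
have mp : measurable_fun [set: V] f^\- by exact: measurable_funeneg.
rewrite -[RHS](ge0_integral_shift h mp)//.
by apply: eq_integral => x _; rewrite !funenegE.
Qed.

Lemma Rintegral_shift h (f : V -> R) : measurable_fun [set: V] f ->
  (\int[leb]_x f (x + h) = \int[leb]_x f x)%R.
Proof.
by move=> mf; rewrite /Rintegral (integral_shift h (f := EFin \o f))//;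
  exact/measurable_EFinP.
Qed.

Lemma bounded_row_cube A : bounded_set A -> exists k, A `<=` row_cube k.
Proof.
move=> [M [_ /(_ (M + 1)%R)]]; rewrite ltrDl ltr01 => /(_ isT) AM.
exists (M + 1)%R => x /AM/=.
rewrite [(`|x|)%R]mx_normrE => h i /=; rewrite in_itv/= -ler_norml.
by apply: le_trans h; apply: (le_bigmax _ _ (ord0, i)).
Qed.

Lemma lebesgue_row_bounded A : measurable A -> bounded_set A -> leb A < +oo.
Proof.
move=> mA /bounded_row_cube[k Ak].
apply: le_lt_trans (@lebesgue_row_boundedE R n k).
rewrite le_measure ?inE//; apply: measurable_row_box => i; exact: measurable_itv.
Qed.

Lemma lebesgue_row_compact A : compact A -> leb A < +oo.
Proof.
move=> cA; apply: lebesgue_row_bounded; first exact: compact_measurable_row.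
exact: compact_bounded.
Qed.

End row_shift.

(** * Smooth functions and cutoffs *)

Section directional_smoothness.
Context {R : realType} {V : normedModType R} {I : Type}.
Context (e : I -> V).
Implicit Types (f g : V -> R) (k : nat).

(** The index type of the directions is arbitrary, so that functions of one real variable and
    functions of a row vector share the closure lemmas. The derivatives are existentially quantified
    functions: a closure lemma then only has to exhibit their formulas. *)
Fixpoint Ck k f : Prop :=
  if k is k'.+1 then continuous f /\
    exists df : I -> V -> R,
      forall i, (forall x, is_derive x (e i) f (df i x)) /\ Ck k' (df i)
  else continuous f.

Definition Cinf f := forall k, Ck k f.

Lemma CkW k f : Ck k.+1 f -> Ck k f.
Proof.
elim: k f => [|k IH] f; first by move=> [].
move=> [cf [df H]]; split => //; exists df => i; have [? ?] := H i.
by split => //; exact: IH.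
Qed.

Lemma Cinf_derivable f i : Cinf f -> forall x, derivable f x (e i).
Proof. by move=> /(_ 1)[_ [df /(_ i)[dfP _]]] x; have [] := dfP x. Qed.

Lemma Cinf_derive f i : Cinf f -> Cinf (fun x => 'D_(e i) f x).
Proof.
move=> sf k; have [_ [df /(_ i)[dfP]]] := sf k.+1; congr (Ck k _).
by apply/funext => x; have [_ <-] := dfP x.
Qed.

Lemma Cinf_continuous f : Cinf f -> continuous f.
Proof. by move=> /(_ 0). Qed.

Lemma Ck_cst k (c : R) : Ck k (cst c).
Proof.
elim: k c => [|k IH] c /=; first exact: cst_continuous.
split; first exact: cst_continuous.
exists (fun _ => cst 0) => i; split => [x|]; last exact: IH.
exact: is_derive_cst.
Qed.

Lemma CkD k f g : Ck k f -> Ck k g -> Ck k (f \+ g).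
Proof.
elim: k f g => [|k IH] f g; first by move=> cf cg x; exact: (continuousD (cf x) (cg x)).
move=> [cf [df dfP]] [cg [dg dgP]]; split.
  by move=> x; exact: (continuousD (cf x) (cg x)).
exists (fun i => df i \+ dg i) => i; have [? ?] := dfP i; have [? ?] := dgP i.
by split => [x|]; [exact: is_deriveD|exact: IH].
Qed.

Lemma CkM k f g : Ck k f -> Ck k g -> Ck k (f \* g).
Proof.
elim: k f g => [|k IH] f g; first by move=> cf cg x; exact: (continuousM (cf x) (cg x)).
move=> cf cg; have [cf0 [df dfP]] := cf; have [cg0 [dg dgP]] := cg; split.
  by move=> x; exact: (continuousM (cf0 x) (cg0 x)).
exists (fun i => (f \* dg i) \+ (g \* df i)) => i.
have [? ?] := dfP i; have [? ?] := dgP i.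
split => [x|]; first exact: is_deriveM.
by apply: CkD; apply: IH => //; exact: CkW.
Qed.

Lemma CkV k f : (forall x, f x != 0) -> Ck k f -> Ck k (fun x => (f x)^-1).
Proof.
move=> f0; elim: k => [|k IH]; first by move=> cf x; apply: continuousV; [|exact: cf].
move=> Hf; have [cf [df dfP]] := Hf; split; first by move=> x; apply: continuousV; [|exact: cf].
(* The derivative - f' / f^2 is written with products of inverses, so that [CkM] and the induction
   hypothesis apply. *)
exists (fun i x => - 1 * ((f x)^-1 * (f x)^-1) * df i x) => i.
have [d1 d2] := dfP i; split => [x|].
  have [d3 d4] := d1 x; apply: DeriveDef; first exact: derivableV.
  rewrite deriveV// d4 (_ : - f x ^- 2 *: df i x = - f x ^- 2 * df i x)//.
  by rewrite expr2 invfM; ring.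
apply: CkM => //; apply: CkM; first exact: Ck_cst.
by apply: CkM; apply: IH; exact: CkW.
Qed.

Lemma Cinf_cst c : Cinf (cst c).
Proof. by move=> k; exact: Ck_cst. Qed.

Lemma CinfD f g : Cinf f -> Cinf g -> Cinf (f \+ g).
Proof. by move=> hf hg k; exact: CkD. Qed.

Lemma CinfM f g : Cinf f -> Cinf g -> Cinf (f \* g).
Proof. by move=> hf hg k; exact: CkM. Qed.

Lemma CinfZ c f : Cinf f -> Cinf (fun x => c * f x).
Proof. by move=> hf; apply: CinfM => //; exact: Cinf_cst. Qed.

Lemma CinfB f g : Cinf f -> Cinf g -> Cinf (fun x => f x - g x).
Proof.
move=> hf hg; rewrite (_ : (fun x => _) = f \+ (fun x => -1 * g x)).
  by apply: CinfD => //; exact: CinfZ.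
by apply/funext => x /=; rewrite mulN1r.
Qed.

Lemma Cinf_sum (J : Type) (s : seq J) (F : J -> V -> R) :
  (forall j, Cinf (F j)) -> Cinf (fun x => \sum_(j <- s) F j x).
Proof.
move=> hF; elim: s => [|j s IH].
  by under eq_fun do rewrite big_nil; exact: Cinf_cst.
by under eq_fun do rewrite big_cons; exact: CinfD.
Qed.

Lemma Cinf_prod (J : Type) (s : seq J) (F : J -> V -> R) :
  (forall j, Cinf (F j)) -> Cinf (fun x => \prod_(j <- s) F j x).
Proof.
move=> hF; elim: s => [|j s IH].
  by under eq_fun do rewrite big_nil; exact: Cinf_cst.
by under eq_fun do rewrite big_cons; exact: CinfM.
Qed.

Lemma CinfX m f : Cinf f -> Cinf (fun x => f x ^+ m).
Proof.
move=> hf; elim: m => [|m IH]; first by under eq_fun do rewrite expr0; exact: Cinf_cst.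
by under eq_fun do rewrite exprS; exact: CinfM.
Qed.

End directional_smoothness.

Section one_dimensional_smoothness.
Context {R : realType}.

Definition smooth1 (S : R -> R) := Cinf (fun _ : unit => 1 : R) S.

Lemma smooth1_derive (S : R -> R) : smooth1 S -> smooth1 (derive1 S).
Proof.
move=> /(Cinf_derive tt) h; rewrite (_ : (derive1 S) = (fun x => 'D_1 S x))//.
by apply/funext => x; rewrite derive1E.
Qed.

Lemma smooth1_is_derive (S : R -> R) (t : R) : smooth1 S -> is_derive t 1 S ((derive1 S) t).
Proof.
move=> hS; apply: DeriveDef; first exact: (@Cinf_derivable _ _ _ _ S tt hS).
by rewrite derive1E.
Qed.

Lemma derive_line {V : normedModType R} (f : V -> R) x v :
  'D_v f x = 'D_1 (fun h : R => f (h *: v + x)) 0.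
Proof.
rewrite /derive; set g1 := fun h => h^-1 *: _; set g2 := fun h => h^-1 *: _.
suff -> : g1 = g2 by [].
by rewrite funeqE /g1 /g2 => h /=; rewrite addr0 scale0r add0r [_%:A]mulr1.
Qed.

(** On the line through x in direction v this is the chain rule in one variable. *)
Lemma is_derive_dir_comp {V : normedModType R} (S : R -> R) (q : V -> R) x v a b :
  is_derive (q x) 1 S a -> is_derive x v q b -> is_derive x v (S \o q) (a * b).
Proof.
move=> dS [dq <-].
have dq1 : is_derive (0 : R) 1 (fun h => q (h *: v + x)) ('D_v q x).
  apply: DeriveDef; first exact: (derivable1P _ _ _).1 dq.
  by rewrite -derive_line.
have dS0 : is_derive ((fun h => q (h *: v + x)) 0) 1 S a by rewrite scale0r add0r.
have [h1 h2] := is_derive1_comp dS0 dq1.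
apply: DeriveDef; first by apply/derivable1P; exact: h1.
by rewrite -h2 derive_line.
Qed.

Lemma Ck_comp {V : normedModType R} {I : Type} (e : I -> V) k S q :
  Ck (fun _ : unit => 1 : R) k S -> Ck e k q -> Ck e k (S \o q).
Proof.
elim: k S q => [|k IH] S q.
  by move=> cS cq x; apply: continuous_comp; [exact: cq|exact: cS].
move=> [cS [dS /(_ tt)[dSP1 dSP2]]] hq; have [cq [dq dqP]] := hq; split.
  by move=> x; apply: continuous_comp; [exact: cq|exact: cS].
exists (fun i => (dS tt \o q) \* dq i) => i; have [? ?] := dqP i.
split => [x|]; first exact: is_derive_dir_comp.
by apply: CkM => //; apply: IH => //; exact: CkW.
Qed.

Lemma Cinf_comp {V : normedModType R} {I : Type} (e : I -> V) S q :
  smooth1 S -> Cinf e q -> Cinf e (S \o q).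
Proof. by move=> hS hq k; exact: Ck_comp. Qed.

Lemma smooth1_id : smooth1 id.
Proof.
case=> [|k]; first by move=> x; exact: cvg_id.
split; first by move=> x; exact: cvg_id.
by exists (fun _ => cst 1) => i; split => [x|]; [exact: is_derive_id|exact: Ck_cst].
Qed.

Lemma smooth1_affine a b : smooth1 (fun t => a + b * t).
Proof.
apply: CinfD; first exact: Cinf_cst.
by apply: CinfZ; exact: smooth1_id.
Qed.

End one_dimensional_smoothness.

(** * The functions exp(-1/t) / t^m and a smooth step *)

Section flat_exponential.
Context {R : realType}.

(** The whole family in m is treated at once, because the derivative of a member is a combination of
    the next two. Smoothness of all of them then follows by one induction on the order. *)
Definition flat (m : nat) (t : R) : R :=
  if t <= 0 then 0 else t^-1 ^+ m * expR (- t^-1).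

Lemma flat_ge0 m t : 0 <= flat m t.
Proof.
rewrite /flat; case: ifPn => //; rewrite -ltNge => t0.
by rewrite mulr_ge0 ?expR_ge0// exprn_ge0// invr_ge0 ltW.
Qed.

Lemma flat_gt0 m t : 0 < t -> 0 < flat m t.
Proof.
by move=> t0; rewrite /flat leNgt t0/= mulr_gt0 ?expR_gt0// exprn_gt0// invr_gt0.
Qed.

Lemma flat_eq0 m t : t <= 0 -> flat m t = 0.
Proof. by rewrite /flat => ->. Qed.

(** The exponential dominates one term of its series: x^(m+2) / (m+2)! <= exp x at x = 1/t. The
    square leaves a factor |h| in the difference quotient at 0. *)
Lemma flat_le_sqr m t : flat m t <= (m.+2)`!%:R * t ^+ 2.
Proof.
rewrite /flat; case: ifPn => [_|]; first by rewrite mulr_ge0 ?sqr_ge0.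
rewrite -ltNge => t0.
have F0 : (0 : R) < (m.+2)`!%:R by rewrite ltr0n fact_gt0.
have ti0 : 0 <= t^-1 by rewrite invr_ge0 ltW.
have h1 : t^-1 ^+ m.+2 <= (m.+2)`!%:R * expR t^-1.
  rewrite -ler_pdivrMl// mulrC; apply: le_trans (expR_ge1Dxn m.+1 ti0).
  by rewrite lerDr.
rewrite expRN ler_pdivrMr ?expR_gt0// mulrAC.
apply: le_trans (ler_wpM2r (sqr_ge0 t) h1).
rewrite -addn2 exprD -mulrA -exprMn mulVf ?gt_eqF// expr1n mulr1//.
Qed.

Lemma is_derive_flat m (t : R) :
  is_derive t 1 (flat m) (- m%:R * flat m.+1 t + flat m.+2 t).
Proof.
have [t0|t0|->] := ltgtP t 0.
- rewrite !flat_eq0 ?(ltW t0)// mulr0 addr0.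
  apply: (@near_eq_is_derive _ _ _ (cst 0)).
  near=> s; rewrite /= flat_eq0//; apply: ltW; near: s. exact: lt_nbhsl.
- apply: (@near_eq_is_derive R R R (fun s : R => s^-1 ^+ m * expR (- s^-1))).
    near=> s; rewrite /flat leNgt.
    suff -> : 0 < s by [].
    by near: s; exact: lt_nbhsr.
  have tn0 : t != 0 by rewrite gt_eqF.
  have dV : is_derive (t : R) 1 (fun x : R => x^-1) (- t ^- 2).
    apply: DeriveDef; first exact: derivableV.
    by rewrite deriveV// derive_id scaler1.
  have dE : is_derive (t : R) 1 (fun x : R => expR (- x^-1)) (expR (- t^-1) * t ^- 2).
    have dN : is_derive (t : R) 1 (fun x : R => - x^-1) (t ^- 2).
      by rewrite -[t ^- 2]opprK; exact: is_deriveN.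
    exact: (@is_derive_dir_comp _ R expR (fun x : R => - x^-1) t 1 _ _ (is_derive_expR (- t^-1)) dN).
  have dX := is_deriveX m dV.
  have dXE := is_deriveM dX dE.
  rewrite (_ : (fun s : R => s^-1 ^+ m * expR (- s^-1)) =
      [eta GRing.inv] ^+ m * (fun x : R => expR (- x^-1))); last first.
    by apply/funext => s; rewrite /GRing.mul /= exprfctE.
  apply: is_derive_eq; rewrite exprfctE.
  rewrite /flat leNgt t0/=.
  rewrite -[LHS]/(t^-1 ^+ m * (expR (- t^-1) * t ^- 2) +
    expR (- t^-1) * (m%:R * t^-1 ^+ m.-1 * - t ^- 2)).
  rewrite -[t ^- 2]exprVn; case: m {dX dXE} => [|m] /=; last by rewrite !exprS; ring.
  by rewrite !exprS; ring.
- rewrite !flat_eq0// mulr0 addr0.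
  (* At 0 the derivative is a limit of difference quotients, which are at most (m+2)! |h| by
     [flat_le_sqr]. *)
  suff cv : h^-1 *: (flat m (h *: 1 + 0) - flat m 0) @[h --> (0 : R)^'] --> (0 : R).
    by apply: DeriveDef; [apply/cvg_ex; exists 0|exact: cvg_lim].
  rewrite flat_eq0//; apply/cvgrPdist_le => eps eps0.
  have F0 : (0 : R) < (m.+2)`!%:R by rewrite ltr0n fact_gt0.
  near=> h.
  have h0 : h != 0 by near: h; exact: nbhs_dnbhs_neq.
  have hb : `|h| <= eps / (m.+2)`!%:R.
    by near: h; apply: dnbhs0_le; exact: divr_gt0.
  rewrite sub0r normrN subr0 addr0 [_ *: 1]mulr1 normrM normfV.
  rewrite ger0_norm ?flat_ge0// ler_pdivrMl ?normr_gt0//.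
  apply: le_trans (flat_le_sqr _ _) _.
  rewrite -[h ^+ 2]real_normK ?num_real// expr2 mulrA mulrC ler_wpM2l//.
  by rewrite mulrC -ler_pdivlMr.
Unshelve. all: end_near. Qed.

Lemma smooth1_flat m : smooth1 (flat m).
Proof.
have cf m' : continuous (flat m').
  move=> t; apply: differentiable_continuous; apply/derivable1_diffP.
  by have [] := is_derive_flat m' t.
move=> k; elim: k m => [|k IH] m; first exact: cf.
split; first exact: cf.
exists (fun _ t => - m%:R * flat m.+1 t + flat m.+2 t) => -[].
split; first exact: is_derive_flat.
apply: CkD; last exact: IH.
by apply: CkM; [exact: Ck_cst|exact: IH].
Qed.

(** Rises smoothly from 0 for t <= 0 to 1 for t >= 1. The denominator is positive because t and 1 -
    t are never both nonpositive. *)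
Definition step (t : R) : R := flat 0 t / (flat 0 t + flat 0 (1 - t)).

Lemma step_den_gt0 t : 0 < flat 0 t + flat 0 (1 - t).
Proof.
have [t0|t0] := ltP 0 t; first by rewrite ltr_wpDr ?flat_ge0 ?flat_gt0.
by rewrite ltr_wpDl ?flat_ge0// flat_gt0// subr_gt0 (le_lt_trans t0).
Qed.

Lemma smooth1_step : smooth1 step.
Proof.
apply: CinfM; first exact: smooth1_flat.
move=> k; apply: CkV; first by move=> t; rewrite gt_eqF// step_den_gt0.
apply: CkD; first exact: smooth1_flat.
apply: (@Ck_comp _ _ _ _ _ (flat 0) (fun t : R => 1 - t)); first exact: smooth1_flat.
rewrite (_ : (fun t => _) = (fun t => 1 + -1 * t)); first exact: smooth1_affine.
by apply/funext => t; rewrite mulN1r.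
Qed.

Lemma step_ge0 t : 0 <= step t.
Proof. by rewrite divr_ge0 ?flat_ge0// ltW// step_den_gt0. Qed.

Lemma step_le1 t : step t <= 1.
Proof. by rewrite ler_pdivrMr ?step_den_gt0// mul1r lerDl flat_ge0. Qed.

Lemma step_eq0 t : t <= 0 -> step t = 0.
Proof. by move=> t0; rewrite /step flat_eq0// mul0r. Qed.

Lemma step_eq1 t : 1 <= t -> step t = 1.
Proof.
move=> t1; rewrite /step (@flat_eq0 0 (1 - t)) ?subr_le0// addr0 divff//.
by rewrite gt_eqF// flat_gt0// (lt_le_trans ltr01).
Qed.

End flat_exponential.

(** * Partial derivatives of smooth and of radial functions *)

Section smooth_functions.
Context {R : realType} {n : nat}.
Local Notation V := 'rV[R]_n.
Implicit Types (f g phi : V -> R) (Omega : set V) (i j : 'I_n).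
Local Notation e := (fun i : 'I_n => delta_mx ord0 i : V).

(** [pderiv] folds from the right, so the derivative taken first is the last of the list: both
    directions peel the list off at that end, with [rcons]. *)
Lemma smoothE f : smooth f <-> Cinf e f.
Proof.
split.
- move=> sf k; elim: k f sf => [|k IH] f sf; first by have [] := sf [::].
  split; first by have [] := sf [::].
  exists (fun i => partial i f) => i; split.
    by move=> x; apply: DeriveDef => //; have [_] := sf [::]; exact.
  apply: IH => s; have := sf (rcons s i).
  by rewrite /pderiv foldr_rcons.
- move=> sf s; elim/last_ind: s f sf => [|s i IH] f sf.
    split; first exact: Cinf_continuous sf.
    by move=> i x; exact: (Cinf_derivable sf).
  rewrite /pderiv foldr_rcons; apply: IH.
  exact: (Cinf_derive i sf).
Qed.

Lemma smooth_cst c : smooth (cst c : V -> R).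
Proof. by apply/smoothE; exact: Cinf_cst. Qed.

Lemma smoothB f g : smooth f -> smooth g -> smooth (fun x => f x - g x).
Proof. by move=> /smoothE ? /smoothE ?; apply/smoothE; exact: CinfB. Qed.

Lemma smoothM f g : smooth f -> smooth g -> smooth (fun x => f x * g x).
Proof. by move=> /smoothE ? /smoothE ?; apply/smoothE; exact: CinfM. Qed.

Lemma smoothZ c f : smooth f -> smooth (fun x => c * f x).
Proof. by move=> /smoothE ?; apply/smoothE; exact: CinfZ. Qed.

Lemma smoothX m f : smooth f -> smooth (fun x => f x ^+ m).
Proof. by move=> /smoothE ?; apply/smoothE; exact: CinfX. Qed.

Lemma smooth_comp S f : smooth1 S -> smooth f -> smooth (S \o f).
Proof. by move=> ? /smoothE ?; apply/smoothE; exact: Cinf_comp. Qed.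

Lemma smooth_partial i f : smooth f -> smooth (partial i f).
Proof. by move=> /smoothE sf; apply/smoothE; exact: (Cinf_derive i sf). Qed.

Lemma smooth_continuous f : smooth f -> continuous f.
Proof. by move=> sf; have [] := sf [::]. Qed.

Lemma smooth_is_derive f i x : smooth f -> is_derive x (e i) f (partial i f x).
Proof. by move=> sf; apply: DeriveDef => //; have [_] := sf [::]; exact. Qed.

Lemma smooth_measurable f : smooth f -> measurable_fun [set: V] f.
Proof. by move=> sf; apply: continuous_measurable_row; exact: smooth_continuous. Qed.

Lemma is_derive_partial f i (df : V -> R) :
  (forall x, is_derive x (e i) f (df x)) -> partial i f = df.
Proof. by move=> h; apply/funext => x; have [_ <-] := h x. Qed.

Lemma partialB f g i : smooth f -> smooth g ->
  partial i (fun x => f x - g x) = (fun x => partial i f x - partial i g x).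
Proof.
move=> sf sg; apply: is_derive_partial => x.
exact: (is_deriveB (smooth_is_derive i x sf) (smooth_is_derive i x sg)).
Qed.

Lemma partialM f g i : smooth f -> smooth g ->
  partial i (fun x => f x * g x) =
  (fun x => f x * partial i g x + g x * partial i f x).
Proof.
move=> sf sg; apply: is_derive_partial => x.
exact: (is_deriveM (smooth_is_derive i x sf) (smooth_is_derive i x sg)).
Qed.

Lemma partialZ c f i : smooth f ->
  partial i (fun x => c * f x) = (fun x => c * partial i f x).
Proof.
move=> sf; rewrite (partialM i (smooth_cst c) sf); apply/funext => x.
by rewrite /partial derive_cst mulr0 addr0.
Qed.

Lemma partial_comp S f i : smooth1 S -> smooth f ->
  partial i (S \o f) = (fun x => derive1 S (f x) * partial i f x).
Proof.
move=> sS sf; apply: is_derive_partial => x.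
exact: (is_derive_dir_comp (smooth1_is_derive (f x) sS) (smooth_is_derive i x sf)).
Qed.

Lemma is_derive_coord i j (x : V) :
  is_derive x (e i) (fun x : V => x ord0 j) (i == j)%:R.
Proof.
suff cv : h^-1 *: (((fun x : V => x ord0 j) \o shift x) (h *: e i) - x ord0 j)
    @[h --> (0 : R)^'] --> ((i == j)%:R : R).
  by apply: DeriveDef; [apply/cvg_ex; eexists; exact: cv|exact: cvg_lim].
apply: cvg_near_cst; near=> h; rewrite /= !mxE addrK eqxx/= eq_sym.
rewrite [_ *: _]mulrA mulVf ?mul1r//.
by near: h; exact: nbhs_dnbhs_neq.
Unshelve. all: end_near. Qed.

Lemma smooth_coord j : smooth (fun x : V => x ord0 j).
Proof.
apply/smoothE => k; case: k => [|k]; first exact: coord_continuous.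
split; first exact: coord_continuous.
exists (fun i => cst (i == j)%:R) => i; split; last exact: Ck_cst.
by move=> x; exact: is_derive_coord.
Qed.

(** Radial functions are written through the squared distance, which unlike the distance is smooth
    at the centre. *)
Definition dist2 (x0 x : V) : R := \sum_i (x ord0 i - x0 ord0 i) ^+ 2.

Lemma smooth_dist2 x0 : smooth (dist2 x0).
Proof.
apply/smoothE; apply: Cinf_sum => i; apply: CinfX; apply: CinfB.
  by apply/smoothE; exact: smooth_coord.
exact: Cinf_cst.
Qed.

Lemma partial_dist2 x0 i : partial i (dist2 x0) = (fun x => 2 * (x ord0 i - x0 ord0 i)).
Proof.
apply: is_derive_partial => x.
have d1 j : is_derive x (e i) ((fun x : V => (x ord0 j - x0 ord0 j) ^+ 2) : V -> R)
    (2 * (x ord0 j - x0 ord0 j) * (i == j)%:R).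
  have dj : is_derive x (e i) (fun x : V => x ord0 j - x0 ord0 j) (i == j)%:R.
    have := is_deriveB (is_derive_coord i j x) (is_derive_cst (x0 ord0 j) x (e i)).
    by rewrite subr0.
  have := is_deriveM dj dj; rewrite -[_ *: _ + _]/(_ * _ + _ * _).
  have -> : (fun x : V => x ord0 j - x0 ord0 j) * (fun x : V => x ord0 j - x0 ord0 j) =
    (fun x : V => (x ord0 j - x0 ord0 j) ^+ 2) by apply/funext => y; rewrite expr2.
  by move=> dM; apply: is_derive_eq; ring.
have := is_derive_sum (fun j => d1 j).
rewrite (_ : \sum_(j < n) _ = dist2 x0); last by apply/funext => y; rewrite fct_sumE.
move=> dsum; apply: is_derive_eq; rewrite (bigD1 i)//= eqxx mulr1 big1 ?addr0// => j ji.
by rewrite eq_sym (negbTE ji) mulr0.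
Qed.

Definition radial (S : R -> R) (x0 : V) (a : R) (x : V) : R := S (a * dist2 x0 x).

Lemma smooth_radial S x0 a : smooth1 S -> smooth (radial S x0 a).
Proof.
move=> sS; apply: (smooth_comp (f := fun x => a * dist2 x0 x)) => //.
by apply: smoothZ; exact: smooth_dist2.
Qed.

Lemma partial_radial S x0 a i : smooth1 S ->
  partial i (radial S x0 a) =
  (fun x => radial (derive1 S) x0 a x * (2 * a * (x ord0 i - x0 ord0 i))).
Proof.
move=> sS; have sd := smooth_dist2 x0.
rewrite (partial_comp (f := fun x => a * dist2 x0 x) i sS (smoothZ a sd)).
rewrite (partialZ a i sd) partial_dist2.
by apply/funext => x; rewrite /radial; congr (_ * _); ring.
Qed.

Lemma partial2_radial S x0 a i : smooth1 S ->
  partial i (partial i (radial S x0 a)) =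
  (fun x => radial (derive1 (derive1 S)) x0 a x * (2 * a * (x ord0 i - x0 ord0 i)) ^+ 2
    + 2 * a * radial (derive1 S) x0 a x).
Proof.
move=> sS; rewrite (partial_radial x0 a i sS).
have sS' := smooth1_derive sS.
have sl : smooth (fun x : V => 2 * a * (x ord0 i - x0 ord0 i)).
  by apply: smoothZ; apply: smoothB; [exact: smooth_coord|exact: smooth_cst].
rewrite (partialM i (smooth_radial x0 a sS') sl) (partial_radial x0 a i sS').
rewrite partialZ; last by apply: smoothB; [exact: smooth_coord|exact: smooth_cst].
rewrite partialB; [|exact: smooth_coord|exact: smooth_cst].
apply/funext => x; rewrite [in X in _ - X]/partial derive_cst subr0.
have [_ dc] := is_derive_coord i i x; rewrite [partial i _ x]dc.
by rewrite eqxx !mulr1; ring.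
Qed.

(** Apart from the factor a, the right-hand side depends on x only through t = a * [dist2 x0 x]: the
    bracket is 4 t S''(t) + 2 n S'(t). This is what makes the later bounds uniform in a and x0. *)
Lemma laplacian_radial S x0 a x : smooth1 S ->
  \sum_i partial i (partial i (radial S x0 a)) x =
  a * (4 * (a * dist2 x0 x) * radial (derive1 (derive1 S)) x0 a x +
       2 * n%:R * radial (derive1 S) x0 a x).
Proof.
move=> sS; under eq_bigr do rewrite partial2_radial//.
rewrite big_split/= sumr_const card_ord.
under eq_bigr do rewrite exprMn.
rewrite -mulr_sumr -mulr_sumr -/(dist2 x0 x) -[_ *+ n]mulr_natr; ring.
Qed.

End smooth_functions.

(** * Stability of test functions *)

Section test_functions.
Context {R : realType} {n : nat}.
Local Notation V := 'rV[R]_n.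
Local Notation leb := (@lebesgue_row R n).
Implicit Types (f g phi : V -> R) (Omega : set V) (i j : 'I_n).

Lemma test_functionS Omega Omega' phi : Omega `<=` Omega' ->
  test_function Omega phi -> test_function Omega' phi.
Proof.
move=> OO' [sphi [K [cK KO phi0]]]; split => //.
by exists K; split => //; exact: subset_trans KO OO'.
Qed.

Lemma test_functionMl Omega f phi : smooth f -> test_function Omega phi ->
  test_function Omega (fun x => f x * phi x).
Proof.
move=> sf [sphi [K [cK KO phi0]]]; split; first exact: smoothM.
by exists K; split => // x Kx; rewrite phi0// mulr0.
Qed.

Lemma test_functionMr Omega f phi : smooth f -> test_function Omega phi ->
  test_function Omega (fun x => phi x * f x).
Proof.
by move=> sf tphi; under eq_fun do rewrite mulrC; exact: test_functionMl.
Qed.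

Lemma test_functionZ Omega c phi : test_function Omega phi ->
  test_function Omega (fun x => c * phi x).
Proof. by apply: test_functionMl; exact: smooth_cst. Qed.

Lemma test_functionX Omega m phi : test_function Omega phi ->
  test_function Omega (fun x => phi x ^+ m.+1).
Proof.
move=> tphi; under eq_fun do rewrite exprS.
by apply: test_functionMr => //; apply: smoothX; have [] := tphi.
Qed.

Lemma test_functionB Omega f g : test_function Omega f -> test_function Omega g ->
  test_function Omega (fun x => f x - g x).
Proof.
move=> [sf [K [cK KO f0]]] [sg [L [cL LO g0]]]; split; first exact: smoothB.
exists (K `|` L); split; first exact: compactU.
  by move=> x [/KO|/LO].
by move=> x /not_orP[Kx Lx]; rewrite f0// g0// subr0.
Qed.

Lemma partial_eq0 (K : set V) i phi : closed K -> (forall x, ~ K x -> phi x = 0) ->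
  forall x, ~ K x -> partial i phi x = 0.
Proof.
move=> cK phi0 x Kx; rewrite /partial (@near_eq_derive _ _ _ phi (cst 0)).
  exact: derive_cst.
have oK : open (~` K) by exact: closed_openC.
have : nbhs x (~` K) by exact: open_nbhs_nbhs.
by apply: filterS => y Ky; rewrite phi0.
Qed.

Lemma compact_closed_row (K : set V) : compact K -> closed K.
Proof. by apply: compact_closed; exact: norm_hausdorff. Qed.

Lemma test_function_partial Omega i phi : test_function Omega phi ->
  test_function Omega (partial i phi).
Proof.
move=> [sphi [K [cK KO phi0]]]; split; first exact: smooth_partial.
exists K; split => //; apply: partial_eq0 => //; exact: compact_closed_row.
Qed.

Lemma test_function_measurable Omega phi : test_function Omega phi ->
  measurable_fun [set: V] phi.
Proof. by case=> sphi _; exact: smooth_measurable. Qed.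

Lemma compact_support_bounded (K : set V) f : continuous f -> compact K ->
  (forall x, ~ K x -> f x = 0) -> exists2 M, 0 < M & forall x, `|f x| <= M.
Proof.
move=> cf cK f0.
have : compact (f @` K).
  by apply: continuous_compact => //; exact: continuous_subspaceT.
move=> /compact_bounded[M [_ /(_ (`|M| + 1))]].
rewrite (le_lt_trans (ler_norm M)) ?ltrDl// => /(_ isT) h.
exists (`|M| + 1); first by rewrite ltr_wpDl.
move=> x; have [Kx|Kx] := pselect (K x); first by apply: h; exists x.
by rewrite f0// normr0 addr_ge0.
Qed.

Lemma test_function_bounded Omega phi : test_function Omega phi ->
  exists2 M, 0 < M & forall x, `|phi x| <= M.
Proof.
move=> [sphi [K [cK KO phi0]]]; apply: compact_support_bounded phi0 => //.
exact: smooth_continuous.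
Qed.

Lemma partial_shift (h : V) i phi :
  partial i (fun x => phi (x + h)) = (fun x => partial i phi (x + h)).
Proof.
apply/funext => x; rewrite /partial /derive.
set g1 := fun t => t^-1 *: _; set g2 := fun t => t^-1 *: _.
suff -> : g1 = g2 by [].
by apply/funext => t; rewrite /g1 /g2 /= addrA.
Qed.

Lemma pderiv_shift (h : V) s phi :
  pderiv s (fun x => phi (x + h)) = (fun x => pderiv s phi (x + h)).
Proof. by elim: s => [//|i s IH]; rewrite /= -/(pderiv _ _) IH partial_shift. Qed.

Lemma continuous_shift (h : V) : continuous (fun x : V => x + h).
Proof. move=> x; apply: (@cvgD _ _ _ _ _ (fun y : V => y) (fun=> h)).
  exact: (nbhs_filter x).
  exact: cvg_id.
apply: cvg_cst; exact: (nbhs_filter x). Qed.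

Lemma smooth_shift (h : V) phi : smooth phi -> smooth (fun x => phi (x + h)).
Proof.
move=> sphi s; rewrite pderiv_shift; have [c d] := sphi s; split.
  move=> x; apply: (@continuous_comp _ _ _ (fun x : V => x + h)); last exact: c.
  exact: continuous_shift.
move=> i x; have := d i (x + h); rewrite /derivable.
by under eq_fun do rewrite /= addrA.
Qed.

Lemma test_function_shift (h : V) phi : test_function setT phi ->
  test_function setT (fun x => phi (x + h)).
Proof.
move=> [sphi [K [cK _ phi0]]]; split; first exact: smooth_shift.
exists ((fun x => x - h) @` K); split => //.
  apply: continuous_compact => //; apply: continuous_subspaceT.
  exact: continuous_shift.
move=> x Kx; apply: phi0; apply: contra_not Kx => Kx.
by exists (x + h) => //; rewrite addrK.
Qed.

End test_functions.

(** * The fundamental lemma of the calculus of variations *)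

Section fundamental_lemma.
Context {R : realType} {n : nat}.
Local Notation V := 'rV[R]_n.
Local Notation leb := (@lebesgue_row R n).
Implicit Types (a b x : V) (f g phi : V -> R) (Omega : set V) (i j : 'I_n).

Definition open_box a b : set V := row_box (fun i => `]a ord0 i, b ord0 i[%classic).
Definition closed_box a b : set V := row_box (fun i => `[a ord0 i, b ord0 i]%classic).

Lemma open_boxP a b x : open_box a b x <-> forall i, a ord0 i < x ord0 i < b ord0 i.
Proof. by split => h i; have := h i; rewrite /= in_itv. Qed.

Lemma closed_boxP a b x : closed_box a b x <-> forall i, a ord0 i <= x ord0 i <= b ord0 i.
Proof. by split => h i; have := h i; rewrite /= in_itv. Qed.

Lemma measurable_open_box a b : measurable (open_box a b).
Proof. by apply: measurable_row_box => i; exact: measurable_itv. Qed.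

Lemma measurable_closed_box a b : measurable (closed_box a b).
Proof. by apply: measurable_row_box => i; exact: measurable_itv. Qed.

Lemma open_box_closed a b : open_box a b `<=` closed_box a b.
Proof. by move=> x /open_boxP h; apply/closed_boxP => i; have /andP[/ltW-> /ltW->] := h i. Qed.

Lemma compact_closed_box a b : compact (closed_box a b).
Proof.
apply: bounded_closed_compact.
  exists (\sum_i (`|a ord0 i| + `|b ord0 i|)); split; first exact: num_real.
  move=> M hM x /= /closed_boxP hx; rewrite [`|x|]mx_normrE; apply/bigmax_leP; split.
    by apply/ltW/(le_lt_trans _ hM)/sumr_ge0 => i _; rewrite addr_ge0.
  move=> [i0 i] _ /=; rewrite ord1; apply: le_trans (ltW hM).
  rewrite (bigD1 i)//=; apply: ler_wpDr; first by apply: sumr_ge0 => j _; rewrite addr_ge0.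
  have /andP[h1 h2] := hx i; rewrite ler_norml; apply/andP; split.
    by have := ler_norm (- a ord0 i); have := normr_ge0 (b ord0 i); rewrite normrN; lra.
  by have := ler_norm (b ord0 i); have := normr_ge0 (a ord0 i); lra.
rewrite (_ : closed_box a b = \bigcap_(i in [set: 'I_n])
   ((fun x : V => x ord0 i) @^-1` `[a ord0 i, b ord0 i]%classic)); last first.
  by apply/seteqP; split => x h i; [move=> _|]; exact: h.
apply: closed_bigI => i _; apply: preimage_closed; last exact: interval_closed.
by move=> x _; exact: coord_continuous.
Qed.

Lemma open_boxI a b c d : open_box a b `&` open_box c d =
  open_box (\row_i Num.max (a ord0 i) (c ord0 i)) (\row_i Num.min (b ord0 i) (d ord0 i)).
Proof.
apply/seteqP; split => x.
  move=> [/open_boxP h1 /open_boxP h2]; apply/open_boxP => i; rewrite !mxE gt_max lt_min.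
  by have /andP[-> ->] := h1 i; have /andP[-> ->] := h2 i.
by move=> /open_boxP h; split; apply/open_boxP => i; have := h i; rewrite !mxE gt_max lt_min;
  move=> /andP[/andP[? ?] /andP[? ?]]; apply/andP; split.
Qed.

(** Open boxes are the generators used in the fundamental lemma, because the test functions
    [box_bump] increase to their indicators. *)
Lemma open_box_generates :
  @measurable _ V = <<s [set open_box p.1 p.2 | p in [set: V * V]] >>.
Proof.
set G := [set _ | _ in _].
apply/seteqP; split; last first.
  apply: smallest_sub; first exact: sigma_algebra_measurable.
  by move=> _ [p _ <-]; exact: measurable_open_box.
apply: smallest_sub; first exact: smallest_sigma_algebra.
move=> X; rewrite -bigcup_seq/= => -[i _ [C mC <-]].
suff : measurable_fun setT (row_coord i : g_sigma_algebraType G -> measurableTypeR R).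
  by move=> /(_ measurableT C mC).
apply: (measurability _ (RGenOpens.measurableE R)).
move=> _ [_ [c [d ->] <-]]; rewrite setTI.
rewrite (_ : _ @^-1` _ = \bigcup_k open_box
   (\row_j if j == i then c else - k%:R) (\row_j if j == i then d else k%:R)).
  by apply: bigcupT_measurable => k; apply: sub_sigma_algebra; eexists (_, _).
apply/seteqP; split => [x|x [k _ /open_boxP/(_ i)]]; last first.
  by rewrite !mxE eqxx /= /row_coord in_itv.
rewrite /= /row_coord in_itv/= => xi.
exists (\sum_i Num.truncn `|x ord0 i|).+1 => //; apply/open_boxP => j; rewrite !mxE.
case: eqP => [->//|_]; rewrite -ltr_norml.
apply: (@lt_le_trans _ _ (Num.truncn `|x ord0 j|).+1%:R); first exact/Num.Theory.truncnS_gt.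
by rewrite ler_nat ltnS (bigD1 j)//= leq_addr.
Qed.

(** Rational corners make the cover countable, so that almost-everywhere and measurability
    statements pass from boxes to all of [Omega]. *)
Lemma open_box_cover Omega x : open Omega -> Omega x ->
  exists p : 'rV[rat]_n * 'rV[rat]_n,
    open_box (map_mx ratr p.1) (map_mx ratr p.2) x /\
    closed_box (map_mx ratr p.1) (map_mx ratr p.2) `<=` Omega.
Proof.
move=> oO Ox; have /nbhs_ballP[e /= e0 eO] : nbhs x Omega by exact: open_nbhs_nbhs.
have /choice[c cP] : forall i : 'I_n, exists c : rat,
    x ord0 i - e < (ratr c : R) < x ord0 i.
  move=> i; have : x ord0 i - e < x ord0 i :> R by lra.
  by move=> /rat_in_itvoo[c]; rewrite in_itv/= => cP; exists c.
have /choice[d dP] : forall i : 'I_n, exists c : rat,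
    x ord0 i < (ratr c : R) < x ord0 i + e.
  move=> i; have : x ord0 i < x ord0 i + e :> R by lra.
  by move=> /rat_in_itvoo[d]; rewrite in_itv/= => dP; exists d.
exists (\row_i c i, \row_i d i) => /=; split.
  apply/open_boxP => i; rewrite !mxE.
  by have /andP[_ ->] := cP i; have /andP[-> _] := dP i.
move=> y /closed_boxP hy; apply: eO; split => // i j; rewrite ord1 -ball_normE/=.
have := hy j; rewrite !mxE; have /andP[] := cP j; have /andP[] := dP j.
by rewrite ltr_norml => ? ? ? ? /andP[? ?]; apply/andP; split; lra.
Qed.

(* Increases to the indicator of the open box as k tends to infinity. *)
Definition box_bump a b (k : nat) x : R :=
  1 - (1 - \prod_i (flat 0 (x ord0 i - a ord0 i) * flat 0 (b ord0 i - x ord0 i))) ^+ k.+1.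

Lemma flat0_le1 (t : R) : flat 0 t <= 1.
Proof.
rewrite /flat; case: ifPn => // t0; rewrite expr0 mul1r.
by rewrite -expR0 ler_expR oppr_le0 invr_ge0 ltW// ltNge.
Qed.

Let prod_flat_itv a b x :
  0 <= \prod_i (flat 0 (x ord0 i - a ord0 i) * flat 0 (b ord0 i - x ord0 i)) <= 1.
Proof.
apply/andP; split; first by apply: prodr_ge0 => i _; rewrite mulr_ge0 ?flat_ge0.
by apply: prodr_ile1 => i _; rewrite mulr_ge0 ?flat_ge0//= mulr_ile1 ?flat_ge0 ?flat0_le1.
Qed.

Lemma smooth_box_bump a b k : smooth (box_bump a b k).
Proof.
apply: smoothB; first exact: smooth_cst.
apply: smoothX; apply: smoothB; first exact: smooth_cst.
apply/smoothE; apply: Cinf_prod => i; apply/smoothE; apply: smoothM.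
- apply: (smooth_comp (S := flat 0) (f := fun x : V => x ord0 i - a ord0 i)).
    exact: smooth1_flat.
  by apply: smoothB; [exact: smooth_coord|exact: smooth_cst].
- apply: (smooth_comp (S := flat 0) (f := fun x : V => b ord0 i - x ord0 i)).
    exact: smooth1_flat.
  by apply: smoothB; [exact: smooth_cst|exact: smooth_coord].
Qed.

Lemma box_bump_out a b k x : ~ open_box a b x -> box_bump a b k x = 0.
Proof.
move=> /open_boxP/existsNP[i /negP]; rewrite negb_and -!leNgt => h.
rewrite /box_bump (bigD1 i)//=; suff -> : flat 0 (x ord0 i - a ord0 i) *
    flat 0 (b ord0 i - x ord0 i) = 0 by rewrite mul0r subr0 expr1n subrr.
by case/orP : h => h; [rewrite [X in X * _]flat_eq0 ?mul0r//|rewrite [X in _ * X]flat_eq0 ?mulr0//];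
  rewrite subr_le0.
Qed.

Lemma box_bump_itv a b k x : 0 <= box_bump a b k x <= 1.
Proof.
have /andP[h0 h1] := prod_flat_itv a b x.
rewrite /box_bump subr_ge0 gerBl; apply/andP; split.
  by apply: exprn_ile1; rewrite ?subr_ge0// gerBl.
by apply: exprn_ge0; rewrite subr_ge0.
Qed.

Lemma cvg_box_bump a b x : open_box a b x -> box_bump a b k x @[k --> \oo] --> (1 : R).
Proof.
move=> /open_boxP hx; rewrite -[X in _ --> X]subr0; apply: cvgB; first exact: cvg_cst.
set p := \prod_i _; have /andP[h0 h1] := prod_flat_itv a b x.
have p0 : 0 < p.
  apply: prodr_gt0 => i _; have /andP[? ?] := hx i.
  by rewrite mulr_gt0// flat_gt0// subr_gt0.
rewrite (cvg_shiftS (fun k => (1 - p) ^+ k)); apply: cvg_expr.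
by rewrite ger0_norm ?subr_ge0// gtrBl.
Qed.

Lemma test_function_box_bump Omega a b k : closed_box a b `<=` Omega ->
  test_function Omega (box_bump a b k).
Proof.
move=> abO; split; first exact: smooth_box_bump.
exists (closed_box a b); split => //; first exact: compact_closed_box.
by move=> x xab; apply: box_bump_out; apply: contra_not xab; exact: open_box_closed.
Qed.

(** Dominated convergence along the bumps of the box, which are test functions because the closed
    box lies in [Omega]. *)
Lemma integral_box_eq0 Omega f a b :
  locally_integrable_on Omega f ->
  (forall phi, test_function Omega phi -> \int[leb]_(x in Omega) (f x * phi x) = 0) ->
  closed_box a b `<=` Omega -> (\int[leb]_(x in open_box a b) (f x)%:E = 0)%E.
Proof.
move=> lf f0 abO.
have fi : leb.-integrable (open_box a b) (EFin \o f).
  apply: (integrableS _ _ (@open_box_closed a b)).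
  - exact: measurable_closed_box.
  - exact: measurable_open_box.
  - exact: lf (@compact_closed_box a b) abO.
have mf := measurable_int _ fi.
have mb := measurable_open_box a b.
have fbi k : leb.-integrable (open_box a b) (EFin \o (fun x => f x * box_bump a b k x)).
  apply: (integrableMl mb fi).
    exact: (measurable_funS measurableT _ (smooth_measurable (smooth_box_bump a b k))).
  exists 1; split; first exact: num_real.
  move=> M M1 x _ /=; have /andP[h0 h1] := box_bump_itv a b k x.
  by rewrite ger0_norm// (le_trans h1)// ltW.
have int0 k : (\int[leb]_(x in open_box a b) (f x * box_bump a b k x)%:E = 0)%E.
  have := f0 _ (test_function_box_bump k abO); rewrite /Rintegral.
  rewrite integral_mkcond (_ : _ \_ _ = (fun x => (f x * box_bump a b k x)%:E) \_ (open_box a b)).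
    rewrite -integral_mkcond => h.
    have fin := integrable_fin_num mb (fbi k).
    by rewrite -(fineK fin) h.
  apply/funext => x; rewrite !patchE; have [xab|xab] := pselect (open_box a b x).
    by rewrite !mem_set//; apply: abO; exact: open_box_closed.
  by rewrite (memNset xab) box_bump_out// mulr0; case: ifP.
have cv := @dominated_cvg _ _ _ leb _ mb
  (fun k x => (f x * box_bump a b k x)%:E) (EFin \o f) (fun x => `|f x|%:E).
have : (\int[leb]_(x in open_box a b) (f x * box_bump a b k x)%:E)%E @[k --> \oo] -->
    (\int[leb]_(x in open_box a b) (f x)%:E)%E.
  apply: cv.
  - by move=> k; exact: measurable_int (fbi k).
  - move=> x xab; apply: cvg_EFin; first exact: nearW.
    rewrite -[X in _ --> X]mulr1; apply: cvgM; first exact: cvg_cst.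
    exact: cvg_box_bump.
  - by [].
  - exact: integrable_norm.
  - move=> k x _; rewrite /= lee_fin normrM ler_piMr//.
    by have /andP[h0 h1] := box_bump_itv a b k x; rewrite ger0_norm.
under eq_fun do rewrite int0.
by move=> /cvg_lim <-//; exact: lim_cst.
Qed.

(** Inside a fixed box, the sets over which f integrates to 0 form a Dynkin system containing the
    open boxes. *)
Lemma integral_subset_box_eq0 Omega f a b (A : set V) :
  locally_integrable_on Omega f ->
  (forall phi, test_function Omega phi -> \int[leb]_(x in Omega) (f x * phi x) = 0) ->
  closed_box a b `<=` Omega -> measurable A ->
  (\int[leb]_(x in A `&` open_box a b) (f x)%:E = 0)%E.
Proof.
move=> lf f0 abO mA.
have mb := measurable_open_box a b.
have fi : leb.-integrable (open_box a b) (EFin \o f).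
  apply: (integrableS _ _ (@open_box_closed a b)) => //.
  - exact: measurable_closed_box.
  - exact: lf (@compact_closed_box a b) abO.
have fiS (B : set V) : measurable B -> leb.-integrable (B `&` open_box a b) (EFin \o f).
  by move=> mB; apply: (integrableS mb) => //; exact: measurableI.
apply: (@dynkin_induction _ V _
    (fun A => (\int[leb]_(x in A `&` open_box a b) (f x)%:E = 0)%E)
    open_box_generates) => //; last by rewrite -open_box_generates.
- move=> _ _ [p _ <-] [q _ <-].
  by rewrite open_boxI; eexists (_, _).
- by rewrite setTI; exact: integral_box_eq0 lf f0 abO.
- move=> _ [p _ <-].
  rewrite open_boxI.
  apply: (integral_box_eq0 lf f0) => x /closed_boxP h; apply: abO; apply/closed_boxP => i.
  by have := h i; rewrite !mxE ge_max le_min => /andP[/andP[_ ->] /andP[_ ->]].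
- move=> S mS S0.
  have : (\int[leb]_(x in (S `&` open_box a b) `|` (~` S `&` open_box a b)) (f x)%:E = 0)%E.
    by rewrite -setIUl setUv setTI; exact: integral_box_eq0 lf f0 abO.
  rewrite integral_setU//=.
  + by rewrite S0 add0e.
  + exact: measurableI.
  + by apply: measurableI => //; exact: measurableC.
  + rewrite -setIUl setUv setTI; exact: measurable_int fi.
  + by apply/disj_setPS => x [[? _] []].
- move=> F mF tF F0.
  rewrite setI_bigcupl integral_bigcup.
  + by apply: eseries0 => k _ _; exact: F0.
  + apply/trivIsetP => k l _ _ kl; rewrite setIACA setIid.
    by move/trivIsetP : tF => /(_ k l Logic.I Logic.I kl) ->; rewrite set0I.
  + by move=> k; exact: measurableI.
  + by rewrite -setI_bigcupl; apply: fiS; exact: bigcupT_measurable.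
Qed.

Lemma ae_countable {T : countType} (P : T -> V -> Prop) :
  (forall t, {ae leb, forall x, P t x}) -> {ae leb, forall x, forall t, P t x}.
Proof.
move=> h.
have : {ae leb, forall x, forall k, if unpickle k is Some t then P t x else True}.
  apply: ae_foralln => k; case: (unpickle k) => [t|]; first exact: h.
  by apply: aeW.
by apply: filterS => x hx t; have := hx (pickle t); rewrite pickleK.
Qed.

(** On each rational box f integrates to 0 over every measurable subset, hence vanishes almost
    everywhere there; countably many such boxes cover [Omega]. *)
Lemma fundamental_lemma Omega f : open Omega -> locally_integrable_on Omega f ->
  (forall phi, test_function Omega phi -> \int[leb]_(x in Omega) (f x * phi x) = 0) ->
  {ae leb, forall x, Omega x -> f x = 0}.
Proof.
move=> oO lf f0.
pose bx (p : 'rV[rat]_n * 'rV[rat]_n) := open_box (map_mx ratr p.1) (map_mx ratr p.2).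
have : {ae leb, forall x, forall p : 'rV[rat]_n * 'rV[rat]_n,
    closed_box (map_mx ratr p.1) (map_mx ratr p.2) `<=` Omega -> bx p x -> f x = 0}.
  apply: ae_countable => p.
  have [pO|pO] := pselect (closed_box (map_mx ratr p.1) (map_mx ratr p.2) `<=` Omega);
    last by apply: aeW.
  have mb : measurable (bx p) := measurable_open_box _ _.
  have fi : leb.-integrable (bx p) (EFin \o f).
    apply: (integrableS _ _ (@open_box_closed _ _)) => //.
    - exact: measurable_closed_box.
    - exact: lf (@compact_closed_box _ _) pO.
  have : ae_eq leb (bx p) (EFin \o f) (cst 0%E).
    apply: integral_ae_eq => // E EQ mE.
    rewrite integral0 -(integral_subset_box_eq0 lf f0 pO mE).
    by rewrite (setIidl EQ).
  by apply: filterS => x /= hx _ /hx [].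
apply: filterS => x hx Ox; have [p [xp pO]] := open_box_cover oO Ox.
exact: (hx p).
Qed.

End fundamental_lemma.

(** * Square-integrable functions *)

Section square_integrable.
Context d (T : measurableType d) (R : realType) (mu : {measure set T -> \bar R}).
Implicit Types (D : set T) (f g : T -> R).

Lemma eq_integrable_fun D f g : measurable D -> (forall x, D x -> f x = g x) ->
  mu.-integrable D (EFin \o f) -> mu.-integrable D (EFin \o g).
Proof. by move=> mD fg; apply: eq_integrable => // x /set_mem /fg /= ->. Qed.

Lemma integrable_add D f g : measurable D -> mu.-integrable D (EFin \o f) ->
  mu.-integrable D (EFin \o g) -> mu.-integrable D (EFin \o (fun x => f x + g x)).
Proof. by move=> mD fi gi; exact: (integrableD mD fi gi). Qed.

Lemma integrable_sub D f g : measurable D -> mu.-integrable D (EFin \o f) ->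
  mu.-integrable D (EFin \o g) -> mu.-integrable D (EFin \o (fun x => f x - g x)).
Proof. by move=> mD fi gi; exact: (integrableB mD fi gi). Qed.

Lemma integrable_scale D c f : measurable D -> mu.-integrable D (EFin \o f) ->
  mu.-integrable D (EFin \o (fun x => c * f x)).
Proof. by move=> mD fi; exact: (integrableZl mD c fi). Qed.

Lemma integrable_bounded_mul D f g M : measurable D -> measurable_fun D g ->
  (forall x, D x -> `|g x| <= M) -> mu.-integrable D (EFin \o f) ->
  mu.-integrable D (EFin \o (fun x => f x * g x)).
Proof.
move=> mD mg gM fi; apply: (le_integrable mD _ _ (integrable_scale M mD (integrable_norm fi))).
  apply/measurable_EFinP/measurable_funM => //.
  exact/measurable_EFinP/(measurable_int mu).
move=> x Dx; rewrite /= lee_fin !normrM normr_id mulrC.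
by apply: ler_wpM2r => //; apply: le_trans (gM x Dx) (ler_norm _).
Qed.

Lemma integrable_le D f g : measurable D -> measurable_fun D f ->
  (forall x, D x -> `|f x| <= g x) -> mu.-integrable D (EFin \o g) ->
  mu.-integrable D (EFin \o f).
Proof.
move=> mD mf fg gi; apply: (le_integrable mD _ _ gi); first exact/measurable_EFinP.
by move=> x Dx; rewrite /= lee_fin; apply: le_trans (fg x Dx) (ler_norm _).
Qed.

Lemma integrable_measurable D f : mu.-integrable D (EFin \o f) -> measurable_fun D f.
Proof. by move=> /measurable_int/measurable_EFinP. Qed.

(** The discriminant argument, shared by all versions of the Cauchy-Schwarz inequality below, for
    integrals and for finite sums. *)
Lemma quadratic_ge0_disc (A P B : R) : 0 <= B ->
  (forall c, 0 <= A - 2 * c * P + c ^+ 2 * B) -> P ^+ 2 <= A * B.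
Proof.
rewrite le_eqVlt => /orP[/eqP <-|B0] h.
  rewrite mulr0; have A0 : 0 <= A by have := h 0; rewrite !(mulr0, mul0r, subr0, addr0).
  have [->|P0] := eqVneq P 0; first by rewrite expr0n.
  (* When B = 0 the quadratic is affine; this c gives it the value -1 unless P = 0. *)
  have := h ((A + 1) / (2 * P)); rewrite mulr0 addr0.
  rewrite (_ : 2 * _ * P = A + 1); last by field.
  lra.
have := h (P / B); rewrite (_ : _ - _ + _ = A - P ^+ 2 / B); last by field; rewrite gt_eqF.
by rewrite subr_ge0 ler_pdivrMr.
Qed.

Lemma Rintegral_lin3 D (f g h : T -> R) (a b c : R) : measurable D ->
  mu.-integrable D (EFin \o f) -> mu.-integrable D (EFin \o g) ->
  mu.-integrable D (EFin \o h) ->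
  \int[mu]_(x in D) (a * f x + b * g x + c * h x) =
  a * \int[mu]_(x in D) f x + b * \int[mu]_(x in D) g x + c * \int[mu]_(x in D) h x.
Proof.
move=> mD fi gi hi; rewrite RintegralD//; last 2 first.
- by apply: integrable_add => //; exact: integrable_scale.
- exact: integrable_scale.
by rewrite RintegralD//; try exact: integrable_scale; rewrite !RintegralZl.
Qed.

(** Cauchy-Schwarz for the measure of density rho. Integrability is asked of the products with rho,
    since h need not be integrable outside the support of rho. *)
Lemma weighted_jensen D (rho h : T -> R) : measurable D ->
  (forall x, D x -> 0 <= rho x) -> mu.-integrable D (EFin \o rho) ->
  mu.-integrable D (EFin \o (fun x => rho x * h x)) ->
  mu.-integrable D (EFin \o (fun x => rho x * h x ^+ 2)) ->
  (\int[mu]_(x in D) (rho x * h x)) ^+ 2 <=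
  (\int[mu]_(x in D) (rho x * h x ^+ 2)) * \int[mu]_(x in D) rho x.
Proof.
move=> mD rho0 i0 i1 i2; apply: quadratic_ge0_disc; first exact: Rintegral_ge0.
move=> c; rewrite (_ : _ + _ = \int[mu]_(x in D) (rho x * (h x - c) ^+ 2)).
  by apply: Rintegral_ge0 => x Dx; rewrite mulr_ge0 ?sqr_ge0 ?rho0.
under [RHS]eq_Rintegral.
  move=> x _; rewrite (_ : _ * _ = 1 * (rho x * h x ^+ 2) + (- 2 * c) * (rho x * h x)
    + c ^+ 2 * rho x); last by ring.
  over.
by rewrite Rintegral_lin3// mul1r; ring.
Qed.

Definition sq_integrable D f :=
  measurable_fun D f /\ mu.-integrable D (EFin \o (fun x => f x ^+ 2)).

Lemma sq_integrableM D f g : measurable D -> sq_integrable D f -> sq_integrable D g ->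
  mu.-integrable D (EFin \o (fun x => f x * g x)).
Proof.
move=> mD [mf fi] [mg gi].
apply: (integrable_le mD _ _ (integrable_add mD fi gi)); first exact: measurable_funM.
move=> x _; rewrite normrM -[f x ^+ 2]real_normK ?num_real// -[g x ^+ 2]real_normK ?num_real//.
by have := sqr_ge0 (`|f x| - `|g x|); have := sqr_ge0 `|f x|; have := sqr_ge0 `|g x|; nra.
Qed.

Lemma cauchy_schwarz D f g : measurable D -> sq_integrable D f -> sq_integrable D g ->
  (\int[mu]_(x in D) (f x * g x)) ^+ 2 <=
  (\int[mu]_(x in D) (f x ^+ 2)) * \int[mu]_(x in D) (g x ^+ 2).
Proof.
move=> mD hf hg; apply: quadratic_ge0_disc.
  by apply: Rintegral_ge0 => x _; exact: sqr_ge0.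
move=> c; rewrite (_ : _ + _ = \int[mu]_(x in D) ((f x - c * g x) ^+ 2)).
  by apply: Rintegral_ge0 => x Dx; exact: sqr_ge0.
under [RHS]eq_Rintegral.
  move=> x _; rewrite (_ : _ ^+ 2 = 1 * (f x ^+ 2) + (- 2 * c) * (f x * g x)
    + c ^+ 2 * g x ^+ 2); last by ring.
  over.
rewrite Rintegral_lin3//; [|by case: hf|exact: sq_integrableM|by case: hg].
by rewrite mul1r; ring.
Qed.

Lemma sq_integrableD D f g : measurable D -> sq_integrable D f -> sq_integrable D g ->
  sq_integrable D (fun x => f x + g x).
Proof.
move=> mD hf hg; split; first by apply: measurable_funD; [case: hf|case: hg].
apply: (@eq_integrable_fun D (fun x => f x ^+ 2 + g x ^+ 2 + 2 * (f x * g x))) => //.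
  by move=> x _; ring.
apply: integrable_add => //; first by apply: integrable_add => //; [case: hf|case: hg].
by apply: integrable_scale => //; exact: sq_integrableM.
Qed.

Lemma sq_integrableZ D c f : measurable D -> sq_integrable D f ->
  sq_integrable D (fun x => c * f x).
Proof.
move=> mD [mf fi]; split; first exact: measurable_funM.
apply: (@eq_integrable_fun D (fun x => c ^+ 2 * f x ^+ 2)) => //; last exact: integrable_scale.
by move=> x _; rewrite exprMn.
Qed.

Lemma sq_integrableB D f g : measurable D -> sq_integrable D f -> sq_integrable D g ->
  sq_integrable D (fun x => f x - g x).
Proof.
move=> mD hf hg; under eq_fun do rewrite -mulN1r.
by apply: sq_integrableD => //; exact: sq_integrableZ.
Qed.

Lemma sq_integrable_bounded D f g M : measurable D -> measurable_fun D g ->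
  (forall x, D x -> `|g x| <= M) -> sq_integrable D f ->
  sq_integrable D (fun x => f x * g x).
Proof.
move=> mD mg gM [mf fi]; split; first exact: measurable_funM.
apply: (@eq_integrable_fun D (fun x => f x ^+ 2 * g x ^+ 2)) => //.
  by move=> x _; rewrite exprMn.
apply: (@integrable_bounded_mul D _ (fun x => g x ^+ 2) (M ^+ 2)) => //.
  exact: measurable_funX.
move=> x Dx; rewrite normrX lerXn2r ?nnegrE//; last exact: gM.
by apply: le_trans (gM x Dx).
Qed.

Lemma sq_integrableS D E f : measurable D -> measurable E -> E `<=` D ->
  sq_integrable D f -> sq_integrable E f.
Proof.
by move=> mD mE ED [mf fi]; split; [exact: measurable_funS mf|exact: integrableS fi].
Qed.

Lemma sq_integrable_sum (I : Type) (s : seq I) D (F : I -> T -> R) : measurable D ->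
  (forall i, sq_integrable D (F i)) -> sq_integrable D (fun x => \sum_(i <- s) F i x).
Proof.
move=> mD hF; elim: s => [|i s IH].
  under eq_fun do rewrite big_nil; split => //.
  by under eq_fun do rewrite expr0n/=; exact: integrable0.
by under eq_fun do rewrite big_cons; exact: sq_integrableD.
Qed.

Lemma finite_sq_integrable D f : measurable D -> (mu D < +oo)%E ->
  sq_integrable D f -> mu.-integrable D (EFin \o f).
Proof.
move=> mD Doo [mf fi].
have i1 : mu.-integrable D (EFin \o cst 1) by apply: measurable_bounded_integrable => //; exact: bounded_cst.
apply: (integrable_le mD mf _ (integrable_add mD i1 fi)) => x _ /=.
by rewrite -[f x ^+ 2]real_normK ?num_real//; have := sqr_ge0 (`|f x| - 1); nra.
Qed.

Lemma patch_support (U : pointedType) D (f : T -> U) :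
  (forall x, ~ D x -> f x = point) -> f \_ D = f.
Proof.
move=> f0; apply/funext => x; rewrite patchE; case: ifPn => // /negP xD.
by rewrite f0// => Dx; apply: xD; exact: mem_set.
Qed.

Lemma Rintegral_support D f : measurable D -> (forall x, ~ D x -> f x = 0) ->
  \int[mu]_x f x = \int[mu]_(x in D) f x.
Proof.
move=> mD f0; rewrite [RHS]Rintegral_mkcond; congr (Rintegral _ _ _).
by rewrite patch_support.
Qed.

Lemma integrable_support D f : measurable D -> (forall x, ~ D x -> f x = 0) ->
  mu.-integrable D (EFin \o f) -> mu.-integrable setT (EFin \o f).
Proof.
move=> mD f0; rewrite integrable_mkcond//; apply: eq_integrable => // x _.
by rewrite patch_support// => y Dy; rewrite /= f0.
Qed.

Lemma measurable_support D f : measurable D -> (forall x, ~ D x -> f x = 0) ->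
  measurable_fun D f -> measurable_fun setT f.
Proof.
move=> mD f0 /(measurable_restrictT _ mD); congr (measurable_fun _ _).
by rewrite patch_support.
Qed.

Lemma sq_integrable_support D f : measurable D -> (forall x, ~ D x -> f x = 0) ->
  sq_integrable D f -> sq_integrable setT f.
Proof.
move=> mD f0 [mf fi]; split; first exact: measurable_support mf.
by apply: integrable_support fi => // x /f0 ->; rewrite expr0n.
Qed.

Lemma Rintegral_le0_eq0 D f : measurable D -> (forall x, D x -> f x = 0) ->
  \int[mu]_(x in D) f x = 0.
Proof.
by move=> mD f0; rewrite /Rintegral integral0_eq// => x /f0 ->.
Qed.

End square_integrable.

(** * Fubini's theorem for real-valued integrals *)

Section real_fubini.
Context d1 d2 (T1 : measurableType d1) (T2 : measurableType d2) (R : realType).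
Context (m1 : {sigma_finite_measure set T1 -> \bar R}).
Context (m2 : {sigma_finite_measure set T2 -> \bar R}).
Implicit Types (h : T1 * T2 -> R) (p : T1 -> R).

Lemma Rintegral_ae_eq d (T : measurableType d) (m : {measure set T -> \bar R})
    (D : set T) (f g : T -> R) : measurable D -> measurable_fun D f -> measurable_fun D g ->
  {ae m, forall x, D x -> f x = g x} ->
  \int[m]_(x in D) f x = \int[m]_(x in D) g x.
Proof.
move=> mD mf mg fg; rewrite /Rintegral; congr fine.
apply: ae_eq_integral => //; [exact/measurable_EFinP|exact/measurable_EFinP|].
by apply: filterS fg => x h Dx; rewrite h.
Qed.

Lemma integrable_fineP d (T : measurableType d) (m : {measure set T -> \bar R})
    (F : T -> \bar R) : m.-integrable setT F -> m.-integrable setT (EFin \o (fine \o F)).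
Proof.
move=> Fi; have mF := measurable_int _ Fi.
apply: (le_integrable measurableT _ _ Fi).
  by apply/measurable_EFinP; apply: measurableT_comp => //; exact: fine_measurable.
by move=> x _ /=; case: (F x) => [r| |] //=; rewrite ?normr0 ?lee_fin ?leey.
Qed.

Section integrable_kernel.
Context (h : T1 * T2 -> R).
Context (hi : (m1 \x m2)%E.-integrable setT (EFin \o h)).

Lemma integrable_fubini_swap :
  m2.-integrable setT (fun y => \int[m1]_x (h (x, y))%:E)%E.
Proof.
have mh := measurable_int _ hi.
have hs : (m2 \x m1)%E.-integrable setT (fun z => (h (z.2, z.1))%:E).
  apply/integrable12ltyP.
    exact: (measurableT_comp mh (@measurable_swap _ _ T2 T1)).
  exact: (integrable21ltyP _ _ mh).1 hi.
exact: (integrable_fubini_F hs).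
Qed.

Lemma Rfubini_integrable1 : m1.-integrable setT (EFin \o (fun x => \int[m2]_y h (x, y))).
Proof. exact: (integrable_fineP (integrable_fubini_F hi)). Qed.

Lemma Rfubini_integrable2 : m2.-integrable setT (EFin \o (fun y => \int[m1]_x h (x, y))).
Proof. exact: (integrable_fineP (integrable_fubini_swap)). Qed.

(** A slice whose integral is infinite contributes the default value of [fine]; by integrability
    such slices form a null set. *)
Lemma Rfubini : \int[m1]_x \int[m2]_y h (x, y) = \int[m2]_y \int[m1]_x h (x, y).
Proof.
have fi := integrable_fubini_F hi; have gi := integrable_fubini_swap.
have := Fubini hi; rewrite /Rintegral => E.
transitivity (fine (\int[m1]_x \int[m2]_y (h (x, y))%:E)%E).
  congr fine; apply: ae_eq_integral => //.
  - exact: measurable_int Rfubini_integrable1.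
  - exact: measurable_int fi.
  - have := integrable_ae measurableT fi; apply: filterS => x /(_ Logic.I) fx _ /=.
    by rewrite fineK.
rewrite [in LHS]E.
congr fine; apply: ae_eq_integral => //.
- exact: measurable_int gi.
- exact: measurable_int Rfubini_integrable2.
- have := integrable_ae measurableT gi; apply: filterS => x /(_ Logic.I) fx _ /=.
  by rewrite fineK.
Qed.

End integrable_kernel.

Lemma Rfubini_weight h p M : (m1 \x m2)%E.-integrable setT (EFin \o h) ->
  measurable_fun setT p -> (forall x, `|p x| <= M) ->
  \int[m1]_x (\int[m2]_y h (x, y) * p x) = \int[m2]_y \int[m1]_x (h (x, y) * p x).
Proof.
move=> hi mp pM.
have hpi : (m1 \x m2)%E.-integrable setT (EFin \o (fun z => h z * p z.1)).
  apply: (@integrable_bounded_mul _ _ _ _ _ h (fun z => p z.1) M) => //.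
  exact: measurableT_comp.
rewrite -(Rfubini hpi); apply: Rintegral_ae_eq => //.
- apply: measurable_funM => //; exact: integrable_measurable (Rfubini_integrable1 hi).
- exact: integrable_measurable (Rfubini_integrable1 hpi).
- have := ae_integrable1 hi; apply: filterS => x hx _ /=.
  by rewrite RintegralZr.
Qed.

End real_fubini.

(** * Translations and Nash's inequality *)

Section translation.
Context {R : realType} {n : nat}.
Local Notation V := 'rV[R]_n.
Local Notation leb := (@lebesgue_row R n).
Local Notation mR := (measurableTypeR R).
Local Notation L := (@lebesgue_measure R).
Implicit Types (f g phi : V -> R) (i : 'I_n) (e x : V) (t : R).

Lemma measurable_line e : measurable_fun setT (fun p : V * mR => p.1 + p.2 *: e).
Proof.
apply: measurable_fun_rowP => i.
rewrite (_ : _ \o _ = (fun p : V * mR => row_coord i p.1 + p.2 * e ord0 i)).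
  apply: measurable_funD.
    exact: (measurableT_comp (@measurable_row_coord R n i) measurable_fst).
  by apply: measurable_funM => //; exact: measurable_snd.
by apply/funext => p; rewrite /row_coord/= !mxE.
Qed.

Lemma ereal_lebesgue_segment t : 0 <= t -> L `[0, t]%classic = t%:E.
Proof.
rewrite le_eqVlt => /orP[/eqP <-|t0]; first by rewrite lebesgue_measure_itv/= ltxx.
by rewrite lebesgue_measure_itv/= lte_fin t0 -EFinB subr0.
Qed.

Definition segment_indic t (s : mR) : R := \1_(`[0, t]%classic : set mR) s.

Lemma measurable_segment_indic t : measurable_fun setT (segment_indic t).
Proof. exact: measurable_indic. Qed.

Lemma segment_indic_ge0 t s : 0 <= segment_indic t s.
Proof. by rewrite /segment_indic indicE. Qed.

Lemma integrable_segment_indic t : L.-integrable setT (EFin \o segment_indic t).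
Proof. exact: (integrable_indic_itv 0 t true false). Qed.

Lemma Rintegral_segment_indic t : 0 <= t -> \int[L]_s segment_indic t s = t.
Proof.
move=> t0; rewrite /Rintegral integral_indic// setIT.
exact: (congr1 fine (ereal_lebesgue_segment t0)).
Qed.

(** The integrand of the line integral of g over the segment from x to x + t e. The indicator
    replaces the restriction to [0, t], so that Fubini's theorem is applied on the full product
    space. *)
Definition line_kernel g e t (p : V * mR) : R :=
  segment_indic t p.2 * g (p.1 + p.2 *: e).

Definition line_integral g e t x : R := \int[L]_s line_kernel g e t (x, s).

Lemma measurable_line_kernel g e t : measurable_fun [set: V] g ->
  measurable_fun setT (line_kernel g e t).
Proof.
move=> mg; apply: measurable_funM.
  exact: (measurableT_comp (measurable_segment_indic t) measurable_snd).
exact: (measurableT_comp mg (measurable_line e)).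
Qed.

(** Tonelli with the integral in x inside: by translation invariance it equals the L^1 norm of g for
    each s in [0, t]. *)
Lemma integrable_line_kernel g e t : 0 <= t -> leb.-integrable setT (EFin \o g) ->
  (leb \x L)%E.-integrable setT (EFin \o line_kernel g e t).
Proof.
move=> t0 gi; have mg := integrable_measurable gi.
apply/integrable21ltyP.
  by apply/measurable_EFinP; exact: measurable_line_kernel.
have -> : (fun y => \int[leb]_x `|(EFin \o line_kernel g e t) (x, y)|)%E =
    (fun y => (segment_indic t y)%:E * \int[leb]_x `|(g x)%:E|)%E.
  apply/funext => s.
  rewrite -(ge0_integral_shift (s *: e) (f := fun x => `|(g x)%:E|%E)) => [||//].
    rewrite -ge0_integralZl//.
    - apply: eq_integral => x _ /=; rewrite /line_kernel/= normrM.
      by rewrite (ger0_norm (segment_indic_ge0 _ _)) EFinM.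
    - by apply/measurable_EFinP/measurableT_comp => //;
        exact: (measurableT_comp mg (measurable_row_shift _)).
    - by rewrite lee_fin segment_indic_ge0.
  by apply/measurable_EFinP/measurableT_comp.
have /integrableP[_ goo] := gi.
have gfin : (\int[leb]_x `|(g x)%:E|)%E \is a fin_num by rewrite ge0_fin_numE// integral_ge0.
rewrite -(fineK gfin) ge0_integralZr//.
- rewrite integral_indic// setIT [X in (X * _)%E](ereal_lebesgue_segment t0).
  by rewrite -EFinM ltry.
- by apply/measurable_EFinP; exact: measurable_segment_indic.
- by move=> s _; rewrite lee_fin segment_indic_ge0.
- by rewrite lee_fin; apply: fine_ge0; exact: integral_ge0.
Qed.

Lemma line_integral_weight g e t phi M : 0 <= t -> leb.-integrable setT (EFin \o g) ->
  measurable_fun [set: V] phi -> (forall x, `|phi x| <= M) ->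
  \int[leb]_x (line_integral g e t x * phi x) =
  \int[L]_s (segment_indic t s * \int[leb]_x (g (x + s *: e) * phi x)).
Proof.
move=> t0 gi mphi phiM; rewrite (Rfubini_weight (integrable_line_kernel e t0 gi) mphi phiM).
apply: eq_Rintegral => s _; rewrite -RintegralZl//.
  by apply: eq_Rintegral => x _; rewrite /line_kernel/= mulrA.
apply: integrable_bounded_mul => //.
exact: (integrable_shift (s *: e) gi).
Qed.

Lemma line_integral_integrable g e t : 0 <= t -> leb.-integrable setT (EFin \o g) ->
  leb.-integrable setT (EFin \o line_integral g e t).
Proof. by move=> t0 gi; exact: Rfubini_integrable1 (integrable_line_kernel e t0 gi). Qed.

Lemma Rintegral_line_integral g e t : 0 <= t -> leb.-integrable setT (EFin \o g) ->
  \int[leb]_x line_integral g e t x = t * \int[leb]_x g x.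
Proof.
move=> t0 gi; have mg := integrable_measurable gi.
have := @line_integral_weight g e t (cst 1) 1 t0 gi (measurable_cst _).
under eq_Rintegral do rewrite mulr1; move=> ->; last by move=> x; rewrite normr1.
under eq_Rintegral.
  move=> s _; rewrite (_ : \int[leb]_x _ = \int[leb]_x g x); last first.
    by rewrite -(Rintegral_shift (s *: e) mg); apply: eq_Rintegral => x _; rewrite mulr1.
  over.
by rewrite RintegralZr ?Rintegral_segment_indic//; exact: integrable_segment_indic.
Qed.

(** Jensen bounds the squared line integral by t times the line integral of g^2; integrating in x
    gives a second factor t. *)
Lemma line_integral_sq g e t : 0 <= t -> leb.-integrable setT (EFin \o g) ->
  sq_integrable leb setT g ->
  sq_integrable leb setT (line_integral g e t) /\
  \int[leb]_x (line_integral g e t x ^+ 2) <= t ^+ 2 * \int[leb]_x (g x ^+ 2).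
Proof.
move=> t0 gi [mg g2i].
have i1 := line_integral_integrable e t0 gi.
have i2 := line_integral_integrable e t0 g2i.
have mP := integrable_measurable i1.
have jensen : {ae leb, forall x, line_integral g e t x ^+ 2 <=
    t * line_integral (fun y => g y ^+ 2) e t x}.
  have := ae_integrable1 (integrable_line_kernel e t0 gi).
  have := ae_integrable1 (integrable_line_kernel e t0 g2i).
  apply: filterS2 => x h2 h1.
  rewrite mulrC; have := @weighted_jensen _ _ _ L setT (segment_indic t)
    (fun s => g (x + s *: e)) measurableT (fun s _ => segment_indic_ge0 t s)
    (integrable_segment_indic t) h1 h2.
  by rewrite Rintegral_segment_indic.
have le2 : (\int[leb]_x ((line_integral g e t x ^+ 2)%:E) <=
    \int[leb]_x (t * line_integral (fun y => g y ^+ 2) e t x)%:E)%E.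
  apply: ae_ge0_le_integral => //.
  - by move=> x _; rewrite lee_fin sqr_ge0.
  - by apply/measurable_EFinP/measurable_funX.
  - move=> x _; rewrite lee_fin mulr_ge0// Rintegral_ge0// => s _.
    by rewrite mulr_ge0 ?sqr_ge0 ?segment_indic_ge0.
  - by apply/measurable_EFinP/measurable_funM => //; exact: integrable_measurable i2.
  - by apply: filterS jensen => x h _; rewrite lee_fin.
have i3 := integrable_scale t measurableT i2.
have i4 : leb.-integrable setT (EFin \o (fun x => line_integral g e t x ^+ 2)).
  apply/integrableP; split; first by apply/measurable_EFinP/measurable_funX.
  under eq_integral do rewrite /= ger0_norm ?sqr_ge0//.
  by apply: le_lt_trans le2 _; exact: integrable_lty i3.
split; first by split.
rewrite expr2 -mulrA -(Rintegral_line_integral e t0 g2i) -RintegralZl//.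
by rewrite /Rintegral fine_le//; exact: integrable_fin_num.
Qed.

End translation.

(** * Translates of a function with a weak partial derivative *)

Section weak_partial.
Context {R : realType} {n : nat}.
Local Notation V := 'rV[R]_n.
Local Notation leb := (@lebesgue_row R n).
Local Notation mR := (measurableTypeR R).
Local Notation L := (@lebesgue_measure R).
Local Notation e := (fun i : 'I_n => delta_mx ord0 i : V).
Implicit Types (Omega : set V) (f g phi : V -> R) (i : 'I_n) (x : V) (t : R).

Definition weak_partial Omega i f g := forall phi, test_function Omega phi ->
  \int[leb]_(x in Omega) (f x * partial i phi x) =
  - \int[leb]_(x in Omega) (g x * phi x).

Lemma is_derive_along phi i x (r : R) : smooth phi ->
  is_derive r 1 (fun r : R => phi (x + r *: e i)) (partial i phi (x + r *: e i)).
Proof.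
move=> sphi; set y := x + r *: e i.
have [d1 d2] := smooth_is_derive i y sphi.
have d0 : is_derive ((fun r' : R => r' - r) r) 1 (fun h : R => phi (h *: e i + y))
    (partial i phi y).
  by rewrite /= subrr; apply: DeriveDef; [exact: (derivable1P _ _ _).1 d1|rewrite -derive_line].
have ds : is_derive r 1 (fun r' : R => r' - r) 1.
  by have := is_deriveB (is_derive_id r 1) (is_derive_cst r r 1); rewrite subr0.
have := @is_derive_dir_comp _ _ (fun h : R => phi (h *: e i + y)) (fun r' : R => r' - r)
  r 1 _ _ d0 ds; rewrite mulr1.
rewrite (_ : _ \o _ = (fun r => phi (x + r *: e i)))//.
by apply/funext => s /=; rewrite /y addrCA -scalerDl subrK.
Qed.

Lemma is_derive_backwards phi i x (s : R) : smooth phi ->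
  is_derive s 1 (fun s : R => phi (x - s *: e i)) (- partial i phi (x - s *: e i)).
Proof.
move=> sphi.
have d0 := is_derive_along i x (- s) sphi.
have ds : is_derive s 1 (fun s : R => - s) (-1) := is_deriveN (is_derive_id s 1).
have := @is_derive_dir_comp _ _ (fun r : R => phi (x + r *: e i)) (fun s : R => - s)
  s 1 _ _ d0 ds; rewrite mulrN1 scaleNr.
rewrite (_ : _ \o _ = (fun s => phi (x - s *: e i)))//.
by apply/funext => r /=; rewrite scaleNr.
Qed.

Lemma continuous_line (f : V -> R) x v : continuous f ->
  continuous (fun s : R => f (x + s *: v)).
Proof.
move=> cf s; apply: (@continuous_comp _ _ _ (fun s : R => x + s *: v)); last exact: cf.
apply: (@cvgD _ _ _ _ _ (fun=> x) (fun s : R => s *: v)).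
- by apply: cvg_cst; exact: nbhs_filter.
- by apply: cvgZl => //; exact: cvg_id.
Qed.

(** The segment points backwards because a forward translation of f becomes a backward one of the
    test function. *)
Lemma smooth_FTC phi i x t : 0 < t -> smooth phi ->
  \int[L]_s (segment_indic t s * partial i phi (x + s *: - e i)) = phi x - phi (x - t *: e i).
Proof.
move=> t0 sphi.
have cp : continuous (fun s : R => - partial i phi (x - s *: e i)).
  move=> s; apply: (@continuousN _ _ _ (fun s : R => partial i phi (x - s *: e i))).
  have := @continuous_line (partial i phi) x (- e i) (smooth_continuous (smooth_partial i sphi)).
  by under eq_fun do rewrite scalerN; exact.
have cphi : continuous (fun s : R => phi (x - s *: e i)).
  have := @continuous_line phi x (- e i) (smooth_continuous sphi).
  by under eq_fun do rewrite scalerN; exact.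
have ftc := @continuous_FTC2 R (fun s => - partial i phi (x - s *: e i))
  (fun s : R => phi (x - s *: e i)) 0 t t0.
transitivity (- \int[L]_(s in `[0, t]) (- partial i phi (x - s *: e i))).
  rewrite [in RHS]Rintegral_mkcond -mulN1r -RintegralZl//.
    apply: eq_Rintegral => s _; rewrite patchE /segment_indic indicE scalerN.
    by case: ifP => _; rewrite ?mul1r ?mul0r ?mulr0 ?mulN1r ?opprK.
  have ci : L.-integrable `[0, t] (EFin \o (fun s => - partial i phi (x - s *: e i))).
    apply: continuous_compact_integrable; first exact: segment_compact.
    exact: continuous_subspaceT.
  have := (integrable_mkcond (mu := L) (EFin \o (fun s => - partial i phi (x - s *: e i)))
    (measurable_itv `[0, t])).1 ci.
  by rewrite restrict_EFin.
rewrite /Rintegral ftc.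
- by rewrite scale0r subr0 /=; ring.
- exact: continuous_subspaceT.
- split.
  + by move=> s _; have [] := is_derive_backwards i x s sphi.
  + by apply: cvg_at_right_filter; exact: cphi.
  + by apply: cvg_at_left_filter; exact: cphi.
- move=> s _; rewrite derive1E; by have [_ ->] := is_derive_backwards i x s sphi.
Qed.

Lemma test_function_integrable Omega phi : test_function Omega phi ->
  leb.-integrable setT (EFin \o phi).
Proof.
move=> tphi; have [M _ phiM] := test_function_bounded tphi.
have [sphi [K [cK KO phi0]]] := tphi.
have mK := compact_measurable_row cK.
apply: (integrable_support mK) => //.
apply: measurable_bounded_integrable => //.
- exact: lebesgue_row_compact.
- exact: measurable_funS (smooth_measurable sphi).
- exists M; split; first exact: num_real.
  by move=> y My x _ /=; apply: le_trans (phiM x) (ltW My).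
Qed.

Lemma integrable_locally f Omega : leb.-integrable setT (EFin \o f) ->
  locally_integrable_on Omega f.
Proof.
move=> fi K cK KO; apply: integrableS fi => //; exact: compact_measurable_row.
Qed.

(** The fundamental theorem of calculus for weak derivatives. Both sides are tested against phi; the
    translation is moved onto phi, where the classical theorem applies. *)
Lemma weak_partial_line f g i t : leb.-integrable setT (EFin \o f) ->
  leb.-integrable setT (EFin \o g) -> weak_partial setT i f g -> 0 < t ->
  {ae leb, forall x, f (x + t *: e i) - f x = line_integral g (e i) t x}.
Proof.
move=> fi gi fg t0; have t0' := ltW t0.
have mf := integrable_measurable fi; have mg := integrable_measurable gi.
have fsi := integrable_shift (t *: e i) fi.
have Pi := line_integral_integrable (e i) t0' gi.
have Fi := integrable_sub measurableT (integrable_sub measurableT fsi fi) Pi.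
suff : {ae leb, forall x, [set: V] x ->
    f (x + t *: e i) - f x - line_integral g (e i) t x = 0}.
  by apply: filterS => x /(_ Logic.I)/eqP; rewrite subr_eq0 => /eqP.
apply: fundamental_lemma; first exact: openT.
  exact: integrable_locally Fi.
move=> phi tphi; have [M _ phiM] := test_function_bounded tphi.
have mphi := test_function_measurable tphi.
have sphi : smooth phi by case: tphi.
have tdphi := test_function_partial i tphi.
have [M' _ dphiM] := test_function_bounded tdphi.
have mdphi := test_function_measurable tdphi.
have bm h : leb.-integrable setT (EFin \o h) -> leb.-integrable setT (EFin \o (fun x => h x * phi x)).
  by move=> hi; apply: (integrable_bounded_mul (M := M)).
under eq_Rintegral do rewrite mulrBl mulrBl.
rewrite RintegralB//; last 2 first.
- by apply: integrable_sub => //; exact: bm.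
- exact: bm.
rewrite RintegralB//; [|exact: bm|exact: bm].
have -> : \int[leb]_x (f (x + t *: e i) * phi x) =
    \int[leb]_x (f x * phi (x - t *: e i)).
  rewrite -[RHS](Rintegral_shift (t *: e i)).
    by apply: eq_Rintegral => x _; rewrite addrK.
  apply: measurable_funM => //.
  exact: (measurableT_comp mphi (measurable_row_shift _)).
rewrite (line_integral_weight (e i) t0' gi mphi phiM).
(* The direction 0 in [line_kernel] leaves f untranslated. Integrated in s, h gives f times the
   increment of phi; integrated in x, it brings in the weak derivative. Fubini equates the two. *)
pose h (p : V * mR) := line_kernel f 0 t p * partial i phi (p.1 + p.2 *: - e i).
have hi : (leb \x L)%E.-integrable setT (EFin \o h).
  apply: (integrable_bounded_mul (M := M') measurableT) => //.
    exact: (measurableT_comp mdphi (measurable_line (- e i))).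
  exact: integrable_line_kernel.
have := Rfubini hi.
have -> : \int[leb]_x \int[L]_y h (x, y) = \int[leb]_x (f x * (phi x - phi (x - t *: e i))).
  apply: eq_Rintegral => x _; rewrite -(smooth_FTC i x t0 sphi) -RintegralZl//.
    apply: eq_Rintegral => s _; rewrite /h /line_kernel/= scaler0 addr0.
    by ring.
  apply: (integrable_bounded_mul (M := M') measurableT) => //.
    apply: (measurableT_comp mdphi).
    apply: measurable_fun_rowP => j.
    rewrite (_ : _ \o _ = (fun s : mR => x ord0 j + s * (- e i) ord0 j)).
      by apply: measurable_funD => //; apply: measurable_funM.
    by apply/funext => p; rewrite /row_coord/= !mxE.
  exact: integrable_segment_indic.
have -> : \int[L]_y \int[leb]_x h (x, y) =
    \int[L]_s (-1 * (segment_indic t s * \int[leb]_x (g (x + s *: e i) * phi x))).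
  apply: eq_Rintegral => s _.
  have tps := test_function_shift (- (s *: e i)) tphi.
  have tdps := test_function_shift (- (s *: e i)) tdphi.
  transitivity (segment_indic t s * \int[leb]_x (f x * partial i phi (x - s *: e i))).
    rewrite -RintegralZl//.
      apply: eq_Rintegral => x _; rewrite /h /line_kernel/= scaler0 addr0 scalerN.
      by rewrite mulrA.
    apply: (integrable_bounded_mul (M := M')) => //.
    exact: test_function_measurable tdps.
  rewrite mulN1r -mulrN; congr (_ * _).
  have := fg _ tps; rewrite partial_shift => ->; congr (- _).
  rewrite -[LHS](Rintegral_shift (s *: e i)).
    by apply: eq_Rintegral => x _; rewrite addrK.
  by apply: measurable_funM => //; exact: test_function_measurable tps.
under [in LHS]eq_Rintegral do rewrite mulrBr.
rewrite RintegralB//; [|exact: bm|]; last first.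
  apply: (integrable_bounded_mul (M := M)) => //.
  exact: test_function_measurable (test_function_shift _ tphi).
rewrite RintegralZl//.
  by move/(congr1 -%R); rewrite mulN1r opprK opprB => ->; rewrite subrr.
have hi' : (leb \x L)%E.-integrable setT
    (EFin \o (fun p : V * mR => line_kernel g (e i) t p * phi p.1)).
  apply: (integrable_bounded_mul (M := M) measurableT) => //.
    exact: (measurableT_comp mphi measurable_fst).
  exact: integrable_line_kernel.
apply: (eq_integrable_fun _ _ (Rfubini_integrable2 hi')) => //.
move=> s _; rewrite -RintegralZl//.
  by apply: eq_Rintegral => x _; rewrite /line_kernel/= mulrA.
apply: (integrable_bounded_mul (M := M)) => //.
exact: (integrable_shift (s *: e i) gi).
Qed.

Lemma sq_integrable_shift f (h : V) : sq_integrable leb setT f ->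
  sq_integrable leb setT (fun x => f (x + h)).
Proof.
move=> [mf fi]; split; first exact: (measurableT_comp mf (measurable_row_shift _)).
exact: (integrable_shift h fi).
Qed.

Lemma translation_sq f g i t : leb.-integrable setT (EFin \o f) ->
  leb.-integrable setT (EFin \o g) ->
  sq_integrable leb setT f -> sq_integrable leb setT g -> weak_partial setT i f g ->
  \int[leb]_x ((f (x + t *: e i) - f x) ^+ 2) <= t ^+ 2 * \int[leb]_x (g x ^+ 2).
Proof.
move=> fi gi f2 g2 fg; have mf := integrable_measurable fi.
have pos s : 0 < s ->
    \int[leb]_x ((f (x + s *: e i) - f x) ^+ 2) <= s ^+ 2 * \int[leb]_x (g x ^+ 2).
  move=> s0; have [[mP P2] leP] := line_integral_sq (e i) (ltW s0) gi g2.
  apply: le_trans leP; rewrite le_eqVlt; apply/orP; left; apply/eqP.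
  apply: Rintegral_ae_eq => //.
  - apply: measurable_funX; apply: measurable_funB => //.
    exact: (measurableT_comp mf (measurable_row_shift _)).
  - exact: measurable_funX.
  - by have := weak_partial_line fi gi fg s0; apply: filterS => x -> _.
have [t0|t0|->] := ltgtP t 0; last 2 first.
- exact: pos.
- rewrite Rintegral_le0_eq0//; last by move=> x _; rewrite scale0r addr0 subrr expr0n.
  by rewrite expr0n mul0r.
(* For t < 0, the substitution of x - t e for x reduces the claim to the positive increment - t. *)
rewrite -sqrrN; have nt0 : 0 < - t by rewrite oppr_gt0.
apply: le_trans (pos _ nt0).
rewrite -[leLHS](Rintegral_shift (- t *: e i)).
  rewrite le_eqVlt; apply/orP; left; apply/eqP; apply: eq_Rintegral => x _.
  by rewrite -addrA -scalerDl addNr scale0r addr0 -sqrrN opprB.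
apply: measurable_funX; apply: measurable_funB => //.
exact: (measurableT_comp mf (measurable_row_shift _)).
Qed.

End weak_partial.

(** * Averages over translates, and Nash's inequality *)

Section averaging.
Context {R : realType} {n : nat}.
Local Notation V := 'rV[R]_n.
Local Notation leb := (@lebesgue_row R n).
Local Notation e := (fun i : 'I_n => delta_mx ord0 i : V).
Implicit Types (Omega K : set V) (f g phi rho : V -> R) (i j : 'I_n) (x y : V).

Definition sqn f : R := \int[leb]_x (f x ^+ 2).

Lemma sqn_ge0 f : 0 <= sqn f.
Proof. by apply: Rintegral_ge0 => x _; exact: sqr_ge0. Qed.

Lemma sqnD_le f g : sq_integrable leb setT f -> sq_integrable leb setT g ->
  sqn (fun x => f x + g x) <= 2 * sqn f + 2 * sqn g.
Proof.
move=> hf hg; have hfg := sq_integrableD measurableT hf hg.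
have [_ f2] := hf; have [_ g2] := hg.
rewrite /sqn -!RintegralZl// -RintegralD//; [|exact: integrable_scale|exact: integrable_scale].
apply: le_Rintegral => //; first by case: hfg.
- by apply: integrable_add => //; exact: integrable_scale.
- by move=> x _; have := sqr_ge0 (f x - g x); nra.
Qed.

Let doubling_bound (a b c d p S : R) : a <= 2 * b + 2 * c -> b <= d ->
  c <= p * S -> 1 <= p -> 0 <= d -> a <= 2 * p * (d + S).
Proof. by move=> ? ? ? ? ?; nra. Qed.

(** The translation is made one coordinate at a time. Each step uses (a + b)^2 <= 2 a^2 + 2 b^2,
    whence the power of 2. *)
Lemma translation_sq_seq f (f_ : 'I_n -> V -> R) (s : seq 'I_n) y :
  leb.-integrable setT (EFin \o f) -> sq_integrable leb setT f ->
  (forall i, [/\ leb.-integrable setT (EFin \o f_ i), sq_integrable leb setT (f_ i) &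
     weak_partial setT i f (f_ i)]) ->
  sqn (fun x => f (x + \sum_(i <- s) y ord0 i *: e i) - f x) <=
  2 ^+ size s * \sum_(i <- s) y ord0 i ^+ 2 * sqn (f_ i).
Proof.
move=> fi f2 hf; have mf := integrable_measurable fi.
elim: s => [|i s IH].
  rewrite !big_nil mulr0 /sqn Rintegral_le0_eq0// => x _.
  by rewrite addr0 subrr expr0n.
have [gi g2 fg] := hf i.
rewrite !big_cons /= exprS.
set Y := \sum_(j <- s) _; set t := y ord0 i.
have h1 : sq_integrable leb setT (fun x => f (x + (t *: e i + Y)) - f (x + Y)).
  by apply: sq_integrableB => //; exact: sq_integrable_shift.
have h2 : sq_integrable leb setT (fun x => f (x + Y) - f x).
  by apply: sq_integrableB => //; exact: sq_integrable_shift.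
have E : sqn (fun x => f (x + (t *: e i + Y)) - f x) <=
    2 * sqn (fun x => f (x + (t *: e i + Y)) - f (x + Y)) + 2 * sqn (fun x => f (x + Y) - f x).
  apply: le_trans (sqnD_le h1 h2); rewrite le_eqVlt; apply/orP; left; apply/eqP.
  by apply: eq_Rintegral => x _; congr (_ ^+ 2); rewrite [in RHS]addrA subrK.
have E1 : sqn (fun x => f (x + (t *: e i + Y)) - f (x + Y)) <= t ^+ 2 * sqn (f_ i).
  apply: le_trans (translation_sq t fi gi f2 g2 fg).
  rewrite -[leRHS](Rintegral_shift Y).
    rewrite le_eqVlt; apply/orP; left; apply/eqP.
    by apply: eq_Rintegral => x _; rewrite -addrA [Y + _]addrC.
  apply: measurable_funX; apply: measurable_funB => //.
  exact: (measurableT_comp mf (measurable_row_shift _)).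
have p1 : 1 <= 2 ^+ size s :> R by rewrite exprn_ege1// ler1n.
have q0 : 0 <= t ^+ 2 * sqn (f_ i) by rewrite mulr_ge0 ?sqr_ge0 ?sqn_ge0.
exact: doubling_bound E E1 IH p1 q0.
Qed.

Lemma translation_sq_row f (f_ : 'I_n -> V -> R) y (s : R) :
  leb.-integrable setT (EFin \o f) -> sq_integrable leb setT f ->
  (forall i, [/\ leb.-integrable setT (EFin \o f_ i), sq_integrable leb setT (f_ i) &
     weak_partial setT i f (f_ i)]) ->
  (forall i, `|y ord0 i| <= s) ->
  sqn (fun x => f (x + y) - f x) <= 2 ^+ n * s ^+ 2 * \sum_i sqn (f_ i).
Proof.
move=> fi f2 hf ys.
have := translation_sq_seq (index_enum 'I_n) y fi f2 hf.
rewrite -row_sum_delta => /le_trans; apply.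
rewrite -mulrA (_ : size _ = n); last by rewrite [index_enum _]unlock -enumT size_enum_ord.
apply: ler_wpM2l; first exact: exprn_ge0.
rewrite mulr_sumr; apply: ler_sum => i _; apply: ler_wpM2r; first exact: sqn_ge0.
rewrite -[y ord0 i ^+ 2]real_normK ?num_real// lerXn2r ?nnegrE//.
by apply: le_trans (ys i).
Qed.

Definition avg_kernel rho f (p : V * V) : R := rho p.2 * f (p.1 + p.2).

Definition avg rho f x : R := \int[leb]_y avg_kernel rho f (x, y).

Lemma measurable_row_add : measurable_fun setT (fun p : V * V => p.1 + p.2).
Proof.
apply: measurable_fun_rowP => i.
rewrite (_ : _ \o _ = (fun p : V * V => row_coord i p.1 + row_coord i p.2)).
  apply: measurable_funD.
    exact: (measurableT_comp (@measurable_row_coord R n i) measurable_fst).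
  exact: (measurableT_comp (@measurable_row_coord R n i) measurable_snd).
by apply/funext => p; rewrite /row_coord/= !mxE.
Qed.

Lemma measurable_avg_kernel rho f : measurable_fun [set: V] rho ->
  measurable_fun [set: V] f -> measurable_fun setT (avg_kernel rho f).
Proof.
move=> mr mf; apply: measurable_funM; first exact: (measurableT_comp mr measurable_snd).
exact: (measurableT_comp mf measurable_row_add).
Qed.

(** Tonelli, for kernels whose slices at y have L^1 norm at most rho(y) B. *)
Lemma integrable_kernel_bounded (h : V * V -> R) rho (B : R) :
  measurable_fun setT h -> leb.-integrable setT (EFin \o rho) ->
  (forall y, leb.-integrable setT (fun x => (h (x, y))%:E) /\
     \int[leb]_x `|h (x, y)| <= rho y * B) ->
  (leb \x leb)%E.-integrable setT (EFin \o h).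
Proof.
move=> mh ri hb; have mr := integrable_measurable ri.
apply/integrable21ltyP; first by apply/measurable_EFinP.
have bi : leb.-integrable setT (EFin \o (fun y => rho y * B)).
  by under eq_fun do rewrite mulrC; exact: integrable_scale.
have : (\int[leb]_y `|(rho y * B)%:E| < +oo)%E by have /integrableP[] := bi.
apply: le_lt_trans; apply: ge0_le_integral => //.
- by move=> y _; exact: integral_ge0.
- apply: (measurable_fun_fubini_tonelli_G (fun p => `|(h p)%:E|%E)) => //.
  by apply: measurableT_comp => //; exact/measurable_EFinP.
- apply/measurable_EFinP; apply: measurableT_comp => //; exact: measurable_funM.
move=> y _; have [hi le] := hb y.
have hai : leb.-integrable setT (EFin \o (fun x => `|h (x, y)|)) by exact: integrable_norm.
have fin := integrable_fin_num measurableT hai.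
rewrite -[leLHS](fineK fin) lee_fin; apply: le_trans le _; exact: ler_norm.
Qed.

Lemma integrable_avg_kernel rho f : leb.-integrable setT (EFin \o rho) ->
  leb.-integrable setT (EFin \o f) ->
  (leb \x leb)%E.-integrable setT (EFin \o avg_kernel rho f).
Proof.
move=> ri fi; have mr := integrable_measurable ri; have mf := integrable_measurable fi.
apply: (@integrable_kernel_bounded _ (fun y => `|rho y|) (\int[leb]_x `|f x|)).
- exact: measurable_avg_kernel.
- exact: integrable_norm.
- move=> y; split.
    exact: (integrable_scale (rho y) measurableT (integrable_shift y fi)).
  have mnf : measurable_fun [set: V] (fun x => `|f x|) by exact: measurableT_comp.
  rewrite -(Rintegral_shift y mnf) -RintegralZl//.
    rewrite le_eqVlt; apply/orP; left; apply/eqP; apply: eq_Rintegral => x _.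
    by rewrite /avg_kernel/= normrM.
  exact: (integrable_norm (integrable_shift y fi)).
Qed.

Lemma integrable_avg rho f : leb.-integrable setT (EFin \o rho) ->
  leb.-integrable setT (EFin \o f) -> leb.-integrable setT (EFin \o avg rho f).
Proof. by move=> ri fi; exact: Rfubini_integrable1 (integrable_avg_kernel ri fi). Qed.

(** The difference is an average of f(x + y) - f(x) over y. Jensen moves the square inside, Fubini
    integrates in x first, and the translates over the support of rho are bounded by the
    gradient. *)
Lemma avg_sqn_diff rho f (f_ : 'I_n -> V -> R) (s : R) :
  leb.-integrable setT (EFin \o f) -> sq_integrable leb setT f ->
  (forall i, [/\ leb.-integrable setT (EFin \o f_ i), sq_integrable leb setT (f_ i) &
     weak_partial setT i f (f_ i)]) ->
  leb.-integrable setT (EFin \o rho) -> (forall y, 0 <= rho y) ->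
  \int[leb]_y rho y = 1 ->
  (forall y, ~ (forall i, `|y ord0 i| <= s) -> rho y = 0) ->
  sq_integrable leb setT (fun x => avg rho f x - f x) /\
  sqn (fun x => avg rho f x - f x) <= 2 ^+ n * s ^+ 2 * \sum_i sqn (f_ i).
Proof.
move=> fi f2 hf ri rho0 rho1 rhos.
have mr := integrable_measurable ri; have mf := integrable_measurable fi.
set B := 2 ^+ n * _ * _.
have ai := integrable_avg ri fi; have ma := integrable_measurable ai.
pose h (p : V * V) := rho p.2 * (f (p.1 + p.2) - f p.1) ^+ 2.
have mh : measurable_fun setT h.
  apply: measurable_funM; first exact: (measurableT_comp mr measurable_snd).
  apply: measurable_funX; apply: measurable_funB.
    exact: (measurableT_comp mf measurable_row_add).
  exact: (measurableT_comp mf measurable_fst).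
have h2 y : sq_integrable leb setT (fun x => f (x + y) - f x).
  by apply: sq_integrableB => //; exact: sq_integrable_shift.
have hy y : \int[leb]_x h (x, y) <= rho y * B.
  rewrite /h /= RintegralZl//; last by case: (h2 y).
  have [ys|/rhos ->] := pselect (forall i, `|y ord0 i| <= s); last by rewrite !mul0r.
  by apply: ler_wpM2l => //; exact: translation_sq_row.
have h0 x y : 0 <= h (x, y) by rewrite mulr_ge0 ?sqr_ge0.
have hi : (leb \x leb)%E.-integrable setT (EFin \o h).
  apply: (@integrable_kernel_bounded _ rho B) => // y; split.
    by have [_ h2y] := h2 y; exact: (integrable_scale (rho y) measurableT h2y).
  by under eq_Rintegral do rewrite ger0_norm//.
have Hi := Rfubini_integrable1 hi.
have jensen : {ae leb, forall x, (avg rho f x - f x) ^+ 2 <= \int[leb]_y h (x, y)}.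
  have := ae_integrable1 hi.
  have := ae_integrable1 (integrable_avg_kernel ri fi).
  apply: filterS2 => x k1 k2.
  have k3 : leb.-integrable setT (EFin \o (fun y => rho y * (f (x + y) - f x))).
    apply: (@eq_integrable_fun _ _ _ _ _ (fun y => avg_kernel rho f (x, y) - f x * rho y)) => //.
      by move=> y _; rewrite /avg_kernel/=; ring.
    by apply: integrable_sub => //; exact: integrable_scale.
  have -> : avg rho f x - f x = \int[leb]_y (rho y * (f (x + y) - f x)).
    transitivity (\int[leb]_y (avg_kernel rho f (x, y) - f x * rho y)).
      by rewrite RintegralB// ?RintegralZl// ?rho1 ?mulr1//; exact: integrable_scale.
    by apply: eq_Rintegral => y _; rewrite /avg_kernel/=; ring.
  have := @weighted_jensen _ _ _ leb setT rho (fun y => f (x + y) - f x) measurableT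
    (fun y _ => rho0 y) ri k3 k2.
  by rewrite rho1 mulr1.
have le2 : (\int[leb]_x ((avg rho f x - f x) ^+ 2)%:E <=
    \int[leb]_x (\int[leb]_y h (x, y))%:E)%E.
  apply: ae_ge0_le_integral => //.
  - by move=> x _; rewrite lee_fin sqr_ge0.
  - by apply/measurable_EFinP/measurable_funX; exact: measurable_funB.
  - by move=> x _; rewrite lee_fin Rintegral_ge0.
  - exact: measurable_int Hi.
  - by apply: filterS jensen => x k _; rewrite lee_fin.
have i4 : leb.-integrable setT (EFin \o (fun x => (avg rho f x - f x) ^+ 2)).
  apply/integrableP; split.
    by apply/measurable_EFinP/measurable_funX; exact: measurable_funB.
  under eq_integral do rewrite /= ger0_norm ?sqr_ge0//.
  by apply: le_lt_trans le2 _; exact: integrable_lty Hi.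
split; first by split => //; exact: measurable_funB.
apply: (@le_trans _ _ (\int[leb]_x \int[leb]_y h (x, y))).
  by rewrite /sqn /Rintegral fine_le//; exact: integrable_fin_num.
rewrite (Rfubini hi).
have -> : B = \int[leb]_y (B * rho y) by rewrite RintegralZl// rho1 mulr1.
apply: le_Rintegral => //.
- exact: Rfubini_integrable2.
- exact: integrable_scale.
- by move=> y _; rewrite mulrC.
Qed.

Lemma integral_abs_avg rho f : leb.-integrable setT (EFin \o f) ->
  leb.-integrable setT (EFin \o rho) -> (forall y, 0 <= rho y) ->
  \int[leb]_y rho y = 1 ->
  \int[leb]_x `|avg rho f x| <= \int[leb]_x `|f x|.
Proof.
move=> fi ri rho0 rho1; have nfi : leb.-integrable setT (EFin \o (fun x => `|f x|)) by exact: integrable_norm.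
have mf := integrable_measurable fi.
have ki := integrable_avg_kernel ri nfi.
apply: (@le_trans _ _ (\int[leb]_x avg rho (fun x => `|f x|) x)).
  have ai := integrable_avg ri fi; have nai := integrable_avg ri nfi.
  have le : (\int[leb]_x `|avg rho f x|%:E <= \int[leb]_x (avg rho (fun x => `|f x|) x)%:E)%E.
    apply: ae_ge0_le_integral => //.
    - by apply/measurable_EFinP; apply: measurableT_comp => //; exact: integrable_measurable ai.
    - by move=> x _; rewrite lee_fin Rintegral_ge0// => y _; rewrite mulr_ge0.
    - exact: measurable_int nai.
    - have := ae_integrable1 (integrable_avg_kernel ri fi); apply: filterS => x k1 _.
      rewrite lee_fin; apply: le_trans (le_normr_Rintegral _ k1) _ => //.
      rewrite le_eqVlt; apply/orP; left; apply/eqP; apply: eq_Rintegral => y _.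
      by rewrite /avg_kernel/= normrM ger0_norm.
  rewrite /Rintegral fine_le//; last exact: integrable_fin_num nai.
  exact: (integrable_fin_num measurableT (integrable_norm ai)).
rewrite /avg (Rfubini ki) le_eqVlt; apply/orP; left; apply/eqP.
transitivity (\int[leb]_y (rho y * \int[leb]_x `|f x|)).
  have mnf : measurable_fun [set: V] (fun x => `|f x|) by exact: measurableT_comp.
  apply: eq_Rintegral => y _; rewrite -(Rintegral_shift y mnf) -RintegralZl//; exact: (integrable_shift y nfi).
by rewrite RintegralZr// rho1 mul1r.
Qed.

Lemma avg_bound rho f (M : R) : leb.-integrable setT (EFin \o f) ->
  leb.-integrable setT (EFin \o rho) -> (forall y, `|rho y| <= M) ->
  forall x, `|avg rho f x| <= M * \int[leb]_x `|f x|.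
Proof.
move=> fi ri rM x; have mf := integrable_measurable fi; have mr := integrable_measurable ri.
have fsi : leb.-integrable setT (EFin \o (fun y => f (x + y))).
  have := integrable_shift x fi.
  by apply: eq_integrable_fun => // y _; rewrite addrC.
have ki : leb.-integrable setT (EFin \o (fun y => avg_kernel rho f (x, y))).
  apply: (@eq_integrable_fun _ _ _ _ _ (fun y => f (x + y) * rho y)) => //.
    by move=> y _; rewrite mulrC.
  exact: (integrable_bounded_mul (M := M)).
apply: le_trans (le_normr_Rintegral _ ki) _ => //.
have -> : \int[leb]_x `|f x| = \int[leb]_y `|f (x + y)|.
  have mnf : measurable_fun [set: V] (fun x => `|f x|) by exact: measurableT_comp.
  by rewrite -(Rintegral_shift x mnf); apply: eq_Rintegral => y _; rewrite addrC.
rewrite -RintegralZl//; last exact: integrable_norm fsi.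
apply: le_Rintegral => //.
- exact: integrable_norm ki.
- exact/integrable_scale/(integrable_norm fsi).
- by move=> y _; rewrite /avg_kernel/= normrM ler_wpM2r.
Qed.

(* f is compared with its average over the cube [0, s]^n: the difference is
   controlled by the gradient, the average by the L^1 norm. *)
Lemma nash f (f_ : 'I_n -> V -> R) (s : R) : 0 < s ->
  leb.-integrable setT (EFin \o f) -> sq_integrable leb setT f ->
  (forall i, [/\ leb.-integrable setT (EFin \o f_ i), sq_integrable leb setT (f_ i) &
     weak_partial setT i f (f_ i)]) ->
  sqn f <= 2 ^+ n.+1 * s ^+ 2 * \sum_i sqn (f_ i) +
    2 * s ^- n * (\int[leb]_x `|f x|) ^+ 2.
Proof.
move=> s0 fi f2 hf; have mf := integrable_measurable fi.
pose Q : set V := row_box (fun=> `[0, s]%classic).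
have mQ : measurable Q by apply: measurable_row_box => i; exact: measurable_itv.
have QE : leb Q = (s ^+ n)%:E.
  rewrite [LHS](lebesgue_row_box (A := fun=> `[0, s]%classic)); last first.
    by move=> _; exact: measurable_itv.
  under eq_bigr do rewrite [lebesgue_measure _](ereal_lebesgue_segment (ltW s0)).
  by rewrite prodEFin prodr_const card_ord.
have sn0 : 0 < s ^+ n by rewrite exprn_gt0.
have iQ : leb.-integrable setT (EFin \o \1_Q).
  apply/integrableP; split; first by apply/measurable_EFinP; exact: measurable_indic.
  under eq_integral do rewrite /= ger0_norm//.
  by rewrite integral_indic// setIT [X in (X < _)%E]QE ltry.
(* The normalized indicator of the cube has mass 1 and supremum s^(-n). *)
pose rho y : R := s ^- n * \1_Q y.
have ri : leb.-integrable setT (EFin \o rho) by exact: integrable_scale.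
have rho0 y : 0 <= rho y by rewrite mulr_ge0// invr_ge0 ltW.
have rho1 : \int[leb]_y rho y = 1.
  rewrite RintegralZl// /Rintegral integral_indic// setIT [X in fine X]QE /= mulVf// gt_eqF//.
have rhoM y : `|rho y| <= s ^- n.
  rewrite ger0_norm// /rho -[leRHS]mulr1 ler_wpM2l ?invr_ge0 ?(ltW sn0)//.
have rhos y : ~ (forall i, `|y ord0 i| <= s) -> rho y = 0.
  move=> ys; rewrite /rho indicE memNset ?mulr0// => Qy; apply: ys => i.
  by have := Qy i; rewrite /= in_itv/= => /andP[y0 ys]; rewrite ger0_norm.
have [d2 dle] := avg_sqn_diff fi f2 hf ri rho0 rho1 rhos.
have ai := integrable_avg ri fi; have ma := integrable_measurable ai.
have aM := avg_bound fi ri rhoM.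
have a1 := integral_abs_avg fi ri rho0 rho1.
set I1 := \int[leb]_x `|f x| in aM a1 *.
have nai : leb.-integrable setT (EFin \o (fun x => `|avg rho f x|)) by exact: integrable_norm.
have a2 : sq_integrable leb setT (avg rho f).
  split => //; apply: (integrable_le measurableT _ _ (integrable_scale (s ^- n * I1) measurableT nai)).
    exact: measurable_funX.
  by move=> x _; rewrite normrX expr2 ler_wpM2r.
(* The squared L^2 norm of the average is at most its supremum, s^(-n) I1, times its L^1 norm, which
   is at most I1. *)
have a2le : sqn (avg rho f) <= s ^- n * I1 ^+ 2.
  apply: (@le_trans _ _ (s ^- n * I1 * \int[leb]_x `|avg rho f x|)).
    rewrite -RintegralZl//; apply: le_Rintegral => //; first by case: a2.
      exact: integrable_scale.
    by move=> x _; rewrite -real_normK ?num_real// expr2 ler_wpM2r.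
  rewrite expr2 mulrA ler_wpM2l// mulr_ge0 ?invr_ge0 ?(ltW sn0)//.
  by apply: Rintegral_ge0.
have nd2 : sq_integrable leb setT (fun x => -1 * (avg rho f x - f x)) by exact: sq_integrableZ.
have := sqnD_le nd2 a2.
have -> : sqn (fun x => -1 * (avg rho f x - f x) + avg rho f x) = sqn f.
  by apply: eq_Rintegral => x _; congr (_ ^+ 2); ring.
have -> : sqn (fun x => -1 * (avg rho f x - f x)) = sqn (fun x => avg rho f x - f x).
  by apply: eq_Rintegral => x _; rewrite mulN1r sqrrN.
move=> /le_trans; apply; rewrite -mulrA exprS -(mulrA 2 (s ^- n)) lerD//.
  by rewrite -(mulrA 2) ler_wpM2l// mulrA.
by rewrite ler_wpM2l.
Qed.

End averaging.

(** * Mollification *)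

Section mollification.
Context {R : realType} {n : nat}.
Local Notation V := 'rV[R]_n.
Local Notation leb := (@lebesgue_row R n).
Local Notation e := (fun i : 'I_n => delta_mx ord0 i : V).
Implicit Types (Omega K : set V) (f g phi rho : V -> R) (i j : 'I_n) (x y : V).

Lemma smooth_lipschitz_dir phi i (M : R) x (t : R) : smooth phi ->
  (forall y, `|partial i phi y| <= M) -> `|phi (x + t *: e i) - phi x| <= M * `|t|.
Proof.
move=> sphi dM.
have pos y s : 0 <= s -> `|phi (y + s *: e i) - phi y| <= M * `|s|.
  move=> s0; have := @MVT_segment R (fun s => phi (y + s *: e i))
    (fun s => partial i phi (y + s *: e i)) 0 s s0
    (fun r _ => is_derive_along i y r sphi) _.
  have cl : continuous (fun s : R => phi (y + s *: e i)).
    by apply: continuous_line; exact: smooth_continuous.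
  move=> /(_ (continuous_subspaceT cl)) [c _]; rewrite scale0r addr0 subr0 => ->.
  by rewrite normrM ler_wpM2r.
have [t0|t0] := leP 0 t; first exact: pos.
have := pos (x + t *: e i) (- t); rewrite oppr_ge0 => /(_ (ltW t0)).
by rewrite -addrA -scalerDl subrr scale0r addr0 normrN distrC.
Qed.

Lemma smooth_lipschitz phi (M : R) x y : smooth phi ->
  (forall i y, `|partial i phi y| <= M) ->
  `|phi (x + y) - phi x| <= M * \sum_i `|y ord0 i|.
Proof.
move=> sphi dM; rewrite {1}(row_sum_delta y).
elim: (index_enum 'I_n) x => [|i s IH] x.
  by rewrite !big_nil addr0 subrr normr0 mulr0.
rewrite !big_cons mulrDr.
rewrite (_ : phi _ - phi x = (phi (x + y ord0 i *: e i + \sum_(j <- s) y ord0 j *: e j)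
   - phi (x + y ord0 i *: e i)) + (phi (x + y ord0 i *: e i) - phi x)); last first.
  by rewrite [in RHS]addrA subrK addrA.
apply: le_trans (ler_normD _ _) _; rewrite addrC lerD//.
exact: smooth_lipschitz_dir.
Qed.

(** The same as [avg rho f x], after the translation that puts x into the smooth factor, where it
    can be differentiated. *)
Definition conv f rho x : R := \int[leb]_z (f z * rho (z - x)).

Lemma test_function_gradient_bounded Omega phi : test_function Omega phi ->
  exists2 M, 0 < M & forall i y, `|partial i phi y| <= M.
Proof.
move=> tphi.
have /choice[M hM] : forall i, exists M, 0 < M /\ forall y, `|partial i phi y| <= M.
  move=> i; have [M M0 HM] := test_function_bounded (test_function_partial i tphi).
  by exists M.
exists (1 + \sum_i M i).
  by apply: ltr_pwDl => //; apply: sumr_ge0 => i _; have [/ltW] := hM i.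
move=> i y; have [_ /(_ y) h] := hM i; apply: le_trans h _.
rewrite (bigD1 i)//= addrCA lerDl addr_ge0// sumr_ge0// => j _.
by have [/ltW] := hM j.
Qed.

Lemma integrable_conv_kernel f rho x : leb.-integrable setT (EFin \o f) ->
  test_function setT rho -> leb.-integrable setT (EFin \o (fun z => f z * rho (z - x))).
Proof.
move=> fi trho; have [M _ rM] := test_function_bounded trho.
apply: (integrable_bounded_mul (M := M)) => //.
exact: test_function_measurable (test_function_shift (- x) trho).
Qed.

(** In fact Lipschitz: the gradient of rho is bounded and f is integrable. *)
Lemma continuous_conv f rho : leb.-integrable setT (EFin \o f) ->
  test_function setT rho -> continuous (conv f rho).
Proof.
move=> fi trho x.
have [M M0 dM] := test_function_gradient_bounded trho.
have [sr _] := trho.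
have nfi : leb.-integrable setT (EFin \o (fun x => `|f x|)) by exact: integrable_norm.
set I := \int[leb]_z `|f z|.
have I0 : 0 <= I by apply: Rintegral_ge0.
have lip y : `|conv f rho x - conv f rho y| <= I * (M * \sum_i `|(y - x) ord0 i|).
  rewrite /conv -RintegralB//; [|exact: integrable_conv_kernel|exact: integrable_conv_kernel].
  have di : leb.-integrable setT (EFin \o (fun z => f z * rho (z - x) - f z * rho (z - y))).
    by apply: integrable_sub => //; exact: integrable_conv_kernel.
  apply: le_trans (le_normr_Rintegral _ di) _ => //.
  rewrite mulrC -RintegralZl//; apply: le_Rintegral => //.
  - exact: integrable_norm di.
  - exact: integrable_scale.
  move=> z _; rewrite -mulrBr normrM mulrC ler_wpM2r//.
  have := smooth_lipschitz (z - y) (y - x) sr dM.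
  by rewrite addrA subrK.
apply/(cvgrPdist_le (FF := nbhs_filter x)) => eps eps0.
(* The added 1 keeps c positive when f has zero L^1 norm. *)
pose c := I * (M * n%:R) + 1.
have c0 : 0 < c by rewrite ltr_wpDl// !mulr_ge0// ltW.
have : nbhs x (ball x (eps / c)) by apply: nbhsx_ballx; exact: divr_gt0.
apply: filterS => y [_ xy]; apply: le_trans (lip y) _.
have le1 : \sum_i `|(y - x) ord0 i| <= n%:R * (eps / c).
  rewrite mulr_natl -[X in _ *+ X](card_ord n) -sumr_const; apply: ler_sum => i _.
  by have := xy ord0 i; rewrite -ball_normE /= !mxE distrC => /ltW.
apply: (@le_trans _ _ (I * (M * (n%:R * (eps / c))))).
  by apply: ler_wpM2l => //; apply: ler_wpM2l => //; exact: ltW.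
rewrite !mulrA ler_pdivrMr// -!mulrA [X in _ <= X]mulrC.
rewrite /c mulrDl !mulrA lerDl mul1r.
exact: ltW.
Qed.

(** Differentiation under the integral for increments in ]-1, 1[, dominated by M |f|. The derivative
    is again a [conv] with a test function, so smoothness follows by induction. *)
Lemma is_derive_conv f rho i x : leb.-integrable setT (EFin \o f) ->
  test_function setT rho ->
  is_derive x (e i) (conv f rho) (conv f (fun y => -1 * partial i rho y) x).
Proof.
move=> fi trho; have [sr _] := trho.
have tdrho := test_function_partial i trho.
have [M M0 dM] := test_function_bounded tdrho.
have mf := integrable_measurable fi.
pose F (h : R) (z : V) := f z * rho (z - x - h *: e i).
have dF (h : R) z : is_derive h 1 (F ^~ z) (f z * (-1 * partial i rho (z - x - h *: e i))).
  have := is_derive_backwards i (z - x) h sr => d.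
  have := is_deriveM (is_derive_cst (f z) h 1) d.
  rewrite -[X in is_derive _ _ _ X]/(f z * - _ + _ * 0) mulr0 addr0 mulN1r.
  by [].
have Fi h : leb.-integrable setT (EFin \o F h).
  have := integrable_conv_kernel (x + h *: e i) fi trho.
  by apply: eq_integrable_fun => // z _; rewrite /F opprD addrA.
have dFE h z : partial1of2 F h z = f z * (-1 * partial i rho (z - x - h *: e i)).
  by rewrite partial1of2E; have [_ ->] := dF h z.
have I0 : `](-1)%R, 1%R[%classic (0 : R) by rewrite /= in_itv/= ltrN10 ltr01.
have der h z : `](-1)%R, 1%R[%classic h -> [set: V] z -> derivable (F ^~ z) h 1.
  by move=> _ _; have [] := dF h z.
have G0 z : 0 <= M * `|f z| by rewrite mulr_ge0// ltW.
have Gi : leb.-integrable setT (EFin \o (fun z => M * `|f z|)).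
  by apply: integrable_scale => //; exact: integrable_norm.
have Gub h z : `](-1)%R, 1%R[%classic h -> [set: V] z -> `|partial1of2 F h z| <= M * `|f z|.
  by move=> _ _; rewrite dFE normrM mulrC mulN1r normrN ler_wpM2r.
have cv := @cvg_differentiation_under_integral R _ V leb F setT measurableT 0 (-1) 1
  I0 (fun h _ => Fi h) der _ G0 Gi Gub.
have E : \int[leb]_z partial1of2 F 0 z = conv f (fun y => -1 * partial i rho y) x.
  by apply: eq_Rintegral => z _; rewrite dFE scale0r subr0.
rewrite E in cv.
suff cv' : h^-1 *: ((conv f rho \o shift x) (h *: e i) - conv f rho x) @[h --> (0:R)^'] -->
    conv f (fun y => -1 * partial i rho y) x.
  by apply: DeriveDef; [apply/cvg_ex; eexists; exact: cv'|exact: cvg_lim cv'].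
suff <- : (fun h : R => h^-1 *: (\int[leb]_z F (h + 0) z - \int[leb]_z F 0 z)) =
  (fun h : R => h^-1 *: ((conv f rho \o shift x) (h *: e i) - conv f rho x)) by [].
apply/funext => h; rewrite /= addr0; congr (_ *: (_ - _)); apply: eq_Rintegral => z _.
  by rewrite /F opprD addrA addrAC.
by rewrite /F scale0r subr0.
Qed.

Lemma smooth_conv f rho : leb.-integrable setT (EFin \o f) ->
  test_function setT rho -> smooth (conv f rho).
Proof.
move=> fi trho; apply/smoothE => k; elim: k rho trho => [|k IH] rho trho.
  exact: continuous_conv.
split; first exact: continuous_conv.
exists (fun i => conv f (fun y => -1 * partial i rho y)) => i; split.
  by move=> x; exact: is_derive_conv.
by apply: IH; apply: test_functionZ; exact: test_function_partial.
Qed.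

Lemma avg_conv rho f x : leb.-integrable setT (EFin \o f) ->
  test_function setT rho -> avg rho f x = conv f rho x.
Proof.
move=> fi trho; have mf := integrable_measurable fi.
rewrite /conv -(Rintegral_shift x).
  by apply: eq_Rintegral => y _; rewrite /avg_kernel/= addrK mulrC addrC.
apply: measurable_funM => //.
exact: test_function_measurable (test_function_shift (- x) trho).
Qed.

(** The minus sign from differentiating rho(z - x) in x cancels the one in the definition of the
    weak derivative. *)
Lemma partial_conv rho f g i : leb.-integrable setT (EFin \o f) ->
  test_function setT rho -> weak_partial setT i f g ->
  partial i (conv f rho) = conv g rho.
Proof.
move=> fi trho fg; apply: is_derive_partial => x.
have := is_derive_conv i x fi trho; congr (is_derive _ _ _ _).
have := fg _ (test_function_shift (- x) trho); rewrite partial_shift => E.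
transitivity (-1 * \int[leb]_z (f z * partial i rho (z - x))).
  rewrite -RintegralZl//; last exact: (integrable_conv_kernel x fi (test_function_partial i trho)).
  by apply: eq_Rintegral => z _; ring.
by rewrite E mulN1r opprK.
Qed.

Lemma exists_mollifier (s : R) : 0 < s -> exists rho : V -> R,
  [/\ test_function setT rho, (forall y, 0 <= rho y), \int[leb]_y rho y = 1 &
      (forall y, ~ (forall i, `|y ord0 i| <= s) -> rho y = 0)].
Proof.
move=> s0; pose a : V := const_mx (- s); pose b : V := const_mx s.
pose beta := box_bump a b 0.
have tb : test_function setT beta by exact: test_function_box_bump.
have bi := test_function_integrable tb.
have b0 y : 0 <= beta y by have /andP[] := box_bump_itv a b 0 y.
have I0 : 0 < \int[leb]_y beta y.
  (* A bump with zero integral would vanish almost everywhere, but it is positive on the whole open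
     box, whose measure is (2 s)^n. *)
  rewrite lt_neqAle Rintegral_ge0// andbT; apply/eqP => I0.
  have : (\int[leb]_y `|(beta y)%:E| = 0)%E.
    under eq_integral do rewrite /= ger0_norm//.
    rewrite -(fineK (integrable_fin_num measurableT bi)).
    by rewrite -[fine _]/(\int[leb]_y beta y) -I0.
  move/ae_eq_integral_abs => /(_ measurableT).
  have mb : measurable_fun [set: V] (fun y => (beta y)%:E).
    by apply/measurable_EFinP; exact: test_function_measurable tb.
  move=> /(_ mb)[N [mN N0 NP]].
  have : (leb (open_box a b) <= leb N)%E.
    rewrite le_measure ?inE//; first exact: measurable_open_box.
    move=> y yab; apply: NP => /= /(_ Logic.I) [] /eqP.
    apply/negP; rewrite gt_eqF// lt_neqAle b0 andbT eq_sym.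
    have pp : 0 < \prod_i (flat 0 (y ord0 i - a ord0 i) * flat 0 (b ord0 i - y ord0 i)).
      apply: prodr_gt0 => i _; have /open_boxP/(_ i)/andP[? ?] := yab.
      by rewrite mulr_gt0// flat_gt0// subr_gt0.
    by rewrite /beta /box_bump expr1 subKr gt_eqF.
  rewrite N0 [X in (X <= _)%E](lebesgue_row_box
    (A := fun i => `]a ord0 i, b ord0 i[%classic)); last by move=> i; exact: measurable_itv.
  rewrite (eq_bigr (fun=> (2 * s)%:E)).
    by rewrite prodEFin lee_fin prodr_const leNgt exprn_gt0// mulr_gt0.
  move=> i _; rewrite lebesgue_measure_itv/= !mxE lte_fin.
  rewrite gtrN// -EFinB; congr EFin; ring.
exists (fun y => (\int[leb]_y beta y)^-1 * beta y); split.
- exact: test_functionZ.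
- by move=> y; rewrite mulr_ge0// invr_ge0 ltW.
- by rewrite RintegralZl// mulVf// gt_eqF.
- move=> y ys; rewrite [beta y]box_bump_out ?mulr0// => /open_boxP h; apply: ys => i.
  by have /andP[h1 h2] := h i; move: h1 h2; rewrite !mxE ler_norml => /ltW -> /ltW ->.
Qed.

End mollification.

(** * Approximation by test functions, symmetry of second derivatives *)

Section density.
Context {R : realType} {n : nat}.
Local Notation V := 'rV[R]_n.
Local Notation leb := (@lebesgue_row R n).
Local Notation e := (fun i : 'I_n => delta_mx ord0 i : V).
Implicit Types (Omega K : set V) (f g phi rho : V -> R) (i j : 'I_n) (x y z : V).

(** Leaves room for the mollification: functions vanishing off K, averaged at scale s, vanish off
    the compact set K'. *)
Lemma compact_margin Omega K : open Omega -> compact K -> K `<=` Omega ->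
  exists2 s, 0 < s & exists2 K', compact K' & K' `<=` Omega /\
    forall x z, K z -> (forall i, `|z ord0 i - x ord0 i| <= s) -> K' x.
Proof.
move=> oO cK KO.
have [s s0 hs] : exists2 s, 0 < s & forall z x, K z ->
    (forall i, `|z ord0 i - x ord0 i| <= s) -> Omega x.
  have /compact_near_coveringP/(_ _ ((0 : R)^'+)
      (fun (s : R) (z : V) => forall x : V, (forall i, `|z ord0 i - x ord0 i| <= s) -> Omega x)) := cK.
  have cov : forall z : V, K z -> \forall z' \near (z : V) & s \near (0 : R)^'+,
      forall x : V, (forall i, `|(z' : V) ord0 i - x ord0 i| <= s) -> Omega x.
    move=> z.
    move=> Kz; have /nbhs_ballP[d /= d0 dO] : nbhs z Omega by apply: open_nbhs_nbhs; split => //; exact: KO.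
    exists (ball z (d / 2), [set s | s < d / 2]) => /=.
      split; first by apply: nbhsx_ballx; rewrite divr_gt0.
      by apply: nbhs_right_lt; rewrite divr_gt0.
    move=> [z' s] /= [[_ zz'] sd] x xs; apply: dO; split => // k i.
    rewrite ord1 -ball_normE /=.
    have := zz' ord0 i; rewrite -ball_normE /=.
    have := xs i; rewrite ler_norml !ltr_norml => /andP[? ?] /andP[? ?].
    by apply/andP; split; lra.
  move=> /(_ _ cov) hnear.
  have : \forall s \near (0 : R)^'+, 0 < s /\
    (K `<=` (fun z : V => forall x : V, (forall i, `|z ord0 i - x ord0 i| <= s) -> Omega x)).
    by near=> s; split; [by []|near: s; exact: hnear].
  move=> /filter_ex[s [s0 hs]]; exists s => // z x Kz; exact: hs.
exists s => //.
(* K' is the Minkowski difference of K and the cube of half-side s, compact as a continuous image of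
   a product. *)
pose Q : set V := closed_box (const_mx (- s)) (const_mx s).
exists ((fun p : V * V => p.1 - p.2) @` (K `*` Q)).
  apply: continuous_compact.
    apply: continuous_subspaceT => p.
    by apply: (@cvgB _ _ _ _ _ fst snd); [exact: cvg_fst|exact: cvg_snd].
  by apply: compact_setX => //; exact: compact_closed_box.
split.
  move=> _ [[z y] /= [Kz /closed_boxP Qy] <-]; apply: (hs z) => // i.
  by have := Qy i; rewrite !mxE opprD opprK addrA subrr add0r ler_norml.
move=> x z Kz zx; exists (z, z - x) => /=; last by rewrite opprB addrC subrK.
split => //; apply/closed_boxP => i; rewrite !mxE -ler_norml; exact: zx.
Unshelve. all: end_near. Qed.

Lemma compact_support_integrable K f : compact K -> (forall x, ~ K x -> f x = 0) ->
  sq_integrable leb setT f -> leb.-integrable setT (EFin \o f).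
Proof.
move=> cK f0 f2; have mK := compact_measurable_row cK.
apply: (integrable_support mK) => //.
apply: finite_sq_integrable => //; first exact: lebesgue_row_compact.
exact: sq_integrableS f2.
Qed.

(* f1 lists the weak first partials of f on the whole space; f and f1 vanish
   off K. *)
Definition W1 K f (f1 : 'I_n -> V -> R) :=
  [/\ sq_integrable leb setT f, (forall x, ~ K x -> f x = 0) &
    forall i, [/\ sq_integrable leb setT (f1 i), (forall x, ~ K x -> f1 i x = 0) &
      weak_partial setT i f (f1 i)]].

Lemma W1_integrable K f (f1 : 'I_n -> V -> R) : compact K -> W1 K f f1 ->
  leb.-integrable setT (EFin \o f) /\
  forall i, [/\ leb.-integrable setT (EFin \o f1 i), sq_integrable leb setT (f1 i) &
     weak_partial setT i f (f1 i)].
Proof.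
move=> cK [f2 f0 hf]; split; first exact: compact_support_integrable f0 f2.
by move=> i; have [g2 g0 fg] := hf i; split => //; exact: compact_support_integrable g0 g2.
Qed.

(** The rate comes from [avg_sqn_diff], applied to f with its first derivatives and to each first
    derivative with the second ones. This is why two orders of derivatives are assumed in order to
    approximate one. *)
Lemma mollify Omega K f (f1 : 'I_n -> V -> R) (f2 : 'I_n -> 'I_n -> V -> R) (eps : R) :
  open Omega -> compact K -> K `<=` Omega ->
  W1 K f f1 -> (forall i, W1 K (f1 i) (f2 i)) -> 0 < eps ->
  exists2 phi, test_function Omega phi &
    sqn (fun x => f x - phi x) < eps /\
    forall i, sqn (fun x => f1 i x - partial i phi x) < eps.
Proof.
move=> oO cK KO h1 h2 eps0.
have [s0 s0_gt0 [K' cK' [K'O hK']]] := compact_margin oO cK KO.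
pose G := 1 + \sum_i sqn (f1 i) + \sum_i \sum_j sqn (f2 i j).
have S1 : 0 <= \sum_i sqn (f1 i) by apply: sumr_ge0 => i _; exact: sqn_ge0.
have S2 i : 0 <= \sum_j sqn (f2 i j) by apply: sumr_ge0 => j _; exact: sqn_ge0.
have S3 : 0 <= \sum_i \sum_j sqn (f2 i j) by apply: sumr_ge0 => i _; exact: S2.
have G0 : 0 < G by rewrite /G -addrA ltr_pwDl// addr_ge0.
have G1 : \sum_i sqn (f1 i) <= G by rewrite /G -addrA addrCA lerDl addr_ge0.
have G2 i : \sum_j sqn (f2 i j) <= G.
  rewrite /G [X in _ <= _ + X](bigD1 i)//= addrCA lerDl addr_ge0//; first exact: addr_ge0.
  by apply: sumr_ge0 => j _; exact: S2.
have p0 : 0 < 2 ^+ n :> R by rewrite exprn_gt0.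
(* Since s <= 1 and s <= c, also s^2 <= c, and the error 2^n s^2 G is at most eps / 2. *)
pose c := eps / (2 ^+ n * G) / 2.
have c0 : 0 < c by rewrite !divr_gt0// mulr_gt0.
pose s := Num.min s0 (Num.min 1 c).
have s_gt0 : 0 < s by rewrite !lt_min s0_gt0 ltr01 c0.
have ss0 : s <= s0 by rewrite ge_min lexx.
have s2c : s ^+ 2 <= c.
  apply: (@le_trans _ _ s); last by rewrite !ge_min lexx !orbT.
  by rewrite expr2 ler_piMl ?(ltW s_gt0)// !ge_min lexx orbT.
have small S : 0 <= S -> S <= G -> 2 ^+ n * s ^+ 2 * S < eps.
  move=> S0 SG; apply: (@le_lt_trans _ _ (2 ^+ n * c * G)).
    apply: ler_pM => //; first by rewrite mulr_ge0 ?sqr_ge0// ltW.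
    by apply: ler_wpM2l => //; exact: ltW.
  have -> : 2 ^+ n * c * G = eps / 2.
    by rewrite /c; field; rewrite (gt_eqF p0) (gt_eqF G0).
  by rewrite ltr_pdivrMr// ltr_pMr// ltr1n.
have [rho [trho rho0 rho1 rhos]] := @exists_mollifier R n s s_gt0.
have ri := test_function_integrable trho.
have [fi f1i] := W1_integrable cK h1.
have [f_sq f_0 _] := h1.
have [_ d1] := avg_sqn_diff fi f_sq f1i ri rho0 rho1 rhos.
exists (conv f rho).
  split; first exact: smooth_conv.
  exists K'; split => // x xK'; apply: Rintegral_le0_eq0 => // z _.
  have [Kz|Kz] := pselect (K z); last by rewrite f_0// mul0r.
  rewrite rhos ?mulr0// => hz; apply: xK'; apply: (hK' x z) => // i.
  by have := hz i; rewrite !mxE => /le_trans; exact.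
split.
  have -> : sqn (fun x => f x - conv f rho x) = sqn (fun x => avg rho f x - f x).
    by apply: eq_Rintegral => x _; rewrite avg_conv// -sqrrN opprB.
  by apply: le_lt_trans d1 _; exact: small.
move=> i; have [g1i g1_sq fg] := f1i i.
have [_ g2i] := W1_integrable cK (h2 i).
have [_ d2] := avg_sqn_diff g1i g1_sq g2i ri rho0 rho1 rhos.
rewrite (partial_conv fi trho fg).
have -> : sqn (fun x => f1 i x - conv (f1 i) rho x) = sqn (fun x => avg rho (f1 i) x - f1 i x).
  by apply: eq_Rintegral => x _; rewrite avg_conv// -sqrrN opprB.
by apply: le_lt_trans d2 _; exact: small.
Qed.

Lemma mean_value_along phi i x (h : R) : smooth phi -> 0 <= h ->
  exists2 c, 0 <= c <= h & phi (x + h *: e i) - phi x = partial i phi (x + c *: e i) * h.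
Proof.
move=> sphi h0; have := @MVT_segment R (fun s => phi (x + s *: e i))
  (fun s => partial i phi (x + s *: e i)) 0 h h0
  (fun r _ => is_derive_along i x r sphi) _.
have cl : continuous (fun s : R => phi (x + s *: e i)).
  by apply: continuous_line; exact: smooth_continuous.
move=> /(_ (continuous_subspaceT cl)) [c]; rewrite in_itv/= => ch.
by rewrite scale0r addr0 subr0; exists c.
Qed.

(** The mean value theorem twice. The left-hand side is symmetric in i and j, hence the symmetry of
    second derivatives. *)
Let second_difference phi i j x (h : R) : smooth phi -> 0 < h ->
  exists c d, [/\ 0 <= c <= h, 0 <= d <= h &
    phi (x + h *: e i + h *: e j) - phi (x + h *: e i) - phi (x + h *: e j) + phi x =
    partial j (partial i phi) (x + c *: e i + d *: e j) * h ^+ 2].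
Proof.
move=> sphi h0; pose g y := phi (y + h *: e j) - phi y.
have sgs := smooth_shift (h *: e j) sphi.
have sg : smooth g by exact: smoothB.
have [c ch E1] := mean_value_along i x sg (ltW h0).
have [d dh E2] := mean_value_along j (x + c *: e i) (smooth_partial i sphi) (ltW h0).
exists c, d; split => //.
rewrite expr2 mulrA -E2.
move: E1; rewrite /g partialB// partial_shift => <-.
by rewrite addrAC opprB addrA addrAC.
Qed.

Let dist_half (p q a b eps : R) : b = a -> `|q - b| <= eps / 2 ->
  `|p - a| <= eps / 2 -> `|p - q| <= eps.
Proof.
move=> -> qa pa; rewrite [leRHS]splitr; apply: le_trans (ler_distD a _ _) _.
by rewrite lerD// distrC.
Qed.

(** Needed because a multi-index fixes one order of differentiation, while second weak derivatives
    are used in both orders. *)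
Lemma partial_comm phi i j : smooth phi ->
  partial i (partial j phi) = partial j (partial i phi).
Proof.
move=> sphi; apply/funext => x.
set A := partial i (partial j phi); set B := partial j (partial i phi).
have cA : continuous A by apply/smooth_continuous/smooth_partial/smooth_partial.
have cB : continuous B by apply/smooth_continuous/smooth_partial/smooth_partial.
apply/eqP; rewrite -subr_eq0 -normr_le0; apply/ler_addgt0Pl => eps eps0; rewrite addr0.
have e2 : 0 < eps / 2 by rewrite divr_gt0.
have nA : \forall y \near x, `|A x - A y| <= eps / 2.
  by have /(cvgrPdist_le (FF := nbhs_filter x))/(_ _ e2) := cA x.
have nB : \forall y \near x, `|B x - B y| <= eps / 2.
  by have /(cvgrPdist_le (FF := nbhs_filter x))/(_ _ e2) := cB x.
have nAB : nbhs x [set y | `|A x - A y| <= eps / 2 /\ `|B x - B y| <= eps / 2].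
  exact: (@filterI _ (nbhs x) (nbhs_filter x) _ _ nA nB).
have /nbhs_ballP[d /= d0 dAB] := nAB.
(* Two displacements of size at most h stay within d / 2 of x, even in the same direction. *)
pose h := d / 4; have h0 : 0 < h by rewrite divr_gt0.
have near_pt k l (a b : R) : 0 <= a <= h -> 0 <= b <= h -> ball x d (x + a *: e k + b *: e l).
  move=> /andP[a0 ah] /andP[b0 bh]; split => // k' m; rewrite -ball_normE/= ord1 !mxE eqxx/=.
  have hb (c : R) (t : bool) : 0 <= c -> `|c * t%:R| <= c.
    by move=> c0; case: t; rewrite ?mulr1 ?mulr0 ?normr0// ger0_norm.
  rewrite -addrA opprD addNKr normrN.
  apply: (@le_lt_trans _ _ (a + b)).
    by apply: le_trans (ler_normD _ _) _; rewrite lerD// hb.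
  rewrite /h in ah bh; lra.
have [c1 [d1 [c1h d1h]]] := second_difference i j x sphi h0; rewrite -/B => E1.
have [c2 [d2 [c2h d2h]]] := second_difference j i x sphi h0; rewrite -/A => E2.
have E : B (x + c1 *: e i + d1 *: e j) = A (x + c2 *: e j + d2 *: e i).
  have h2 : h ^+ 2 != 0 by rewrite expf_neq0// gt_eqF.
  have aux (a b c p q r k : R) : a - b - c + p = q * k -> a - c - b + p = r * k ->
      k != 0 -> q = r.
    by move=> qk rk k0; apply: (mulIf k0); rewrite -qk -rk; congr (_ + _); rewrite addrAC.
  rewrite (_ : x + h *: e j + h *: e i = x + h *: e i + h *: e j) in E2; last exact: addrAC.
  by apply: aux E1 E2 h2.
have [_ b1] := dAB _ (near_pt i j c1 d1 c1h d1h).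
have [a2 _] := dAB _ (near_pt j i c2 d2 c2h d2h).
exact: dist_half E b1 a2.
Qed.

End density.

(** * Sobolev functions and the functional *)

Section weak_derivatives.
Context {R : realType} {n : nat}.
Local Notation V := 'rV[R]_n.
Local Notation leb := (@lebesgue_row R n).
Implicit Types (Omega K : set V) (f g h u v w phi eta : V -> R) (i j : 'I_n) (a : 'I_n -> nat).

(** The list of directions occurring in [mderiv a]. Its length is the order of a, so a case analysis
    on it recovers iterated partials. *)
Definition mlist a : seq 'I_n := flatten [seq nseq (a i) i | i <- enum 'I_n].

Lemma mem_mlist a i : (i \in mlist a) = (0 < a i)%N.
Proof.
apply/flatten_mapP/idP => [[j _]|ai].
  by rewrite mem_nseq => /andP[aj /eqP ->].
by exists i; rewrite ?mem_enum// mem_nseq ai eqxx.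
Qed.

Lemma size_mlist a : size (mlist a) = (\sum_i a i)%N.
Proof.
rewrite size_flatten /shape -map_comp sumnE big_map big_enum/=.
by apply: eq_bigr => i _; rewrite size_nseq.
Qed.

Lemma sum_eq_ord i : (\sum_k (k == i) = 1)%N.
Proof. by rewrite (bigD1 i)//= eqxx big1// => k /negbTE ->. Qed.

Lemma L2P Omega f : measurable Omega -> L2 Omega f <-> sq_integrable leb Omega f.
Proof.
move=> mO; have E : (\int[leb]_(x in Omega) `|(EFin \o (fun x => f x ^+ 2)%R) x|)%E =
    (\int[leb]_(x in Omega) ((`|f x| ^+ 2)%R)%:E)%E.
  by apply: eq_integral => x _; rewrite /= real_normK ?num_real// ger0_norm ?sqr_ge0.
split=> [[mf f2]|[mf /integrableP[_ f2]]]; split => //; last by rewrite -E.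
apply/integrableP; split; last by rewrite E.
by apply/measurable_EFinP; exact: measurable_funX.
Qed.

Lemma locally_integrable_measurable Omega f : open Omega ->
  locally_integrable_on Omega f -> measurable_fun Omega f.
Proof.
move=> oO lf mO Y mY.
pose B (p : 'rV[rat]_n * 'rV[rat]_n) : set V :=
  closed_box (map_mx ratr p.1) (map_mx ratr p.2).
have -> : Omega `&` f @^-1` Y = \bigcup_(p in [set p | B p `<=` Omega]) (B p `&` f @^-1` Y).
  apply/seteqP; split=> [x [Ox Yx]|x [p pO [Bx Yx]]]; last by split => //; exact: pO.
  have [p [xp pO]] := open_box_cover oO Ox.
  by exists p => //; split => //; exact: open_box_closed.
rewrite bigcup_mkcond; apply: countable_bigcupT_measurable => [|p]; first exact: countableP.
case: ifP => // /set_mem pO.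
apply: (integrable_measurable (lf _ _ pO)) => //; first exact: compact_closed_box.
exact: measurable_closed_box.
Qed.

Lemma locally_integrable_sub Omega f g : locally_integrable_on Omega f ->
  locally_integrable_on Omega g -> locally_integrable_on Omega (fun x => f x - g x).
Proof.
move=> lf lg K cK KO; apply: integrable_sub; [|exact: lf|exact: lg].
exact: compact_measurable_row.
Qed.

Lemma sq_locally_integrable Omega f : measurable Omega -> sq_integrable leb Omega f ->
  locally_integrable_on Omega f.
Proof.
move=> mO fi K cK KO; have mK := compact_measurable_row cK.
apply: finite_sq_integrable => //; first exact: lebesgue_row_compact.
exact: sq_integrableS fi.
Qed.

Lemma locally_integrable_test Omega f phi : open Omega -> locally_integrable_on Omega f ->
  test_function Omega phi -> leb.-integrable Omega (EFin \o (fun x => f x * phi x)).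
Proof.
move=> oO lf tphi; have mO := open_measurable_row oO.
have [M _ phiM] := test_function_bounded tphi.
have [_ [K [cK KO phi0]]] := tphi; have mK := compact_measurable_row cK.
apply: (@integrableS _ _ _ _ setT) => //.
apply: (@integrable_support _ _ _ _ K) => //; first by move=> x /phi0 ->; rewrite mulr0.
apply: (integrable_bounded_mul (M := M)) => //; last exact: lf.
apply: measurable_funS (test_function_measurable tphi) => //.
Qed.

Lemma weak_deriv_unique Omega a f g h : open Omega ->
  is_weak_deriv Omega a f g -> is_weak_deriv Omega a f h ->
  {ae leb, forall x, Omega x -> g x = h x}.
Proof.
move=> oO [lf lg fg] [_ lh fh].
have : {ae leb, forall x, Omega x -> g x - h x = 0}.
  apply: fundamental_lemma => //; first exact: locally_integrable_sub.
  move=> phi tphi; under eq_Rintegral do rewrite mulrBl.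
  rewrite RintegralB//; [|exact: open_measurable_row|
    exact: locally_integrable_test|exact: locally_integrable_test].
  apply/eqP; rewrite subr_eq0; apply/eqP.
  have := fg _ tphi; rewrite fh// => /(mulfI _) ->//.
  by rewrite signr_eq0.
by apply: filterS => x gh /gh /eqP; rewrite subr_eq0 => /eqP.
Qed.

(** [xget] picks some weak derivative as soon as one exists, and weak derivatives agree almost
    everywhere. *)
Lemma weak_derivE Omega a f g : open Omega -> is_weak_deriv Omega a f g ->
  measurable_fun Omega (weak_deriv Omega a f) /\
  {ae leb, forall x, Omega x -> weak_deriv Omega a f x = g x}.
Proof.
move=> oO fg; have h : is_weak_deriv Omega a f (weak_deriv Omega a f).
  rewrite [X in is_weak_deriv _ _ _ X]/weak_deriv; case: xgetP => [g' _ //|/(_ g) //].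
split; last exact: weak_deriv_unique h fg.
by have [_ lg _] := h; exact: locally_integrable_measurable.
Qed.

Lemma weak_deriv_integral Omega a f g : open Omega -> measurable_fun Omega g ->
  is_weak_deriv Omega a f g ->
  \int[leb]_(x in Omega) (`|weak_deriv Omega a f x| ^+ 2) = \int[leb]_(x in Omega) (g x ^+ 2).
Proof.
move=> oO mg fg; have [mw wg] := weak_derivE oO fg.
apply: Rintegral_ae_eq.
- exact: open_measurable_row.
- apply: measurable_funX; exact: measurableT_comp.
- exact: measurable_funX.
- by apply: filterS wg => x h /h ->; rewrite real_normK ?num_real.
Qed.

(** Explicit first and second weak derivatives, to be used in place of the values chosen by
    [weak_deriv], which are known only up to null sets. *)
Record W22 Omega u (u1 : 'I_n -> V -> R) (u2 : 'I_n -> 'I_n -> V -> R) : Prop := {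
  W22_sq : sq_integrable leb Omega u;
  W22_sq1 : forall i, sq_integrable leb Omega (u1 i);
  W22_sq2 : forall i j, sq_integrable leb Omega (u2 i j);
  W22_partial1 : forall i, weak_partial Omega i u (u1 i);
  W22_partial2 : forall i j, weak_partial Omega j (u1 i) (u2 i j) }.

Lemma is_weak_deriv_partial Omega a f g i : measurable Omega -> mlist a = [:: i] ->
  sq_integrable leb Omega f -> sq_integrable leb Omega g ->
  is_weak_deriv Omega a f g <-> weak_partial Omega i f g.
Proof.
move=> mO ai hf hg; rewrite /is_weak_deriv /mderiv -/(mlist a) -size_mlist ai /=.
split=> [[_ _ fg] phi /fg|fg]; first by rewrite expr1 mulN1r.
split; [exact: sq_locally_integrable|exact: sq_locally_integrable|].
by move=> phi /fg ->; rewrite expr1 mulN1r.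
Qed.

(** For the list [:: i; j] the outer derivative of the test function is the i-th, so that the weak
    derivative of f is used with the test function [partial j phi]. *)
Lemma is_weak_deriv_partial2 Omega a f f1 g i j : measurable Omega -> mlist a = [:: i; j] ->
  sq_integrable leb Omega f -> sq_integrable leb Omega g -> weak_partial Omega i f f1 ->
  is_weak_deriv Omega a f g <-> weak_partial Omega j f1 g.
Proof.
move=> mO ai hf hg ff1; rewrite /is_weak_deriv /mderiv -/(mlist a) -size_mlist ai /=.
split=> [[_ _ fg] phi tphi|fg].
  have := ff1 _ (test_function_partial j tphi); rewrite fg// sqrrN expr1n mul1r => ->.
  by rewrite opprK.
split; [exact: sq_locally_integrable|exact: sq_locally_integrable|].
move=> phi tphi; rewrite ff1; last exact: test_function_partial.
by rewrite fg// opprK sqrrN expr1n mul1r.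
Qed.

Lemma is_weak_deriv0 Omega a f : measurable Omega -> mlist a = [::] ->
  sq_integrable leb Omega f -> is_weak_deriv Omega a f f.
Proof.
move=> mO a0 hf; rewrite /is_weak_deriv /mderiv -/(mlist a) -size_mlist a0 /=.
split; [exact: sq_locally_integrable|exact: sq_locally_integrable|].
by move=> phi _; rewrite expr0 mul1r.
Qed.

Lemma W22_sobolev Omega  u (u1 : 'I_n -> V -> R) (u2 : 'I_n -> 'I_n -> V -> R) : measurable Omega -> W22 Omega u u1 u2 -> sobolev Omega 2 u.
Proof.
move=> mO [hu h1 h2 d1 d2]; split; first exact/L2P.
move=> a; rewrite -size_mlist; case E : (mlist a) => [|i [|j []]] // _.
- by exists u; [exact/L2P|exact: is_weak_deriv0].
- by exists (u1 i); [exact/L2P|apply/(is_weak_deriv_partial mO E)].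
- by exists (u2 i j); [exact/L2P|apply/(is_weak_deriv_partial2 mO E hu _ (d1 i))].
Qed.

Lemma sobolev_W1 Omega u : measurable Omega -> sobolev Omega 1 u ->
  exists u1 : 'I_n -> V -> R, forall i, sq_integrable leb Omega (u1 i) /\
    weak_partial Omega i u (u1 i).
Proof.
move=> mO [/(L2P _ mO) hu h].
suff /choice[u1 hu1] : forall i, exists g, sq_integrable leb Omega g /\ weak_partial Omega i u g.
  by exists u1.
move=> i.
pose a j : nat := j == i.
have Ea : mlist a = [:: i].
  have : size (mlist a) = 1%N.
    by rewrite size_mlist sum_eq_ord.
  have := mem_mlist a; case: (mlist a) => [//|j []]// /(_ j).
  by rewrite mem_seq1 eqxx /a; case: eqP => // ->.
have [|g /(L2P _ mO) hg ug] := h a; first by rewrite -size_mlist Ea.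
by exists g; split => //; apply/(is_weak_deriv_partial mO Ea hu hg).
Qed.

Lemma sobolevS Omega k l u : (k <= l)%N -> sobolev Omega l u -> sobolev Omega k u.
Proof.
by move=> kl [hu h]; split => // a ak; apply: h; exact: leq_trans kl.
Qed.

Lemma sobolev_W22 Omega u : measurable Omega -> sobolev Omega 2 u ->
  exists (u1 : 'I_n -> V -> R) (u2 : 'I_n -> 'I_n -> V -> R), W22 Omega u u1 u2.
Proof.
move=> mO su; have [/(L2P _ mO) hu h] := su.
have [u1 hu1] := sobolev_W1 mO (sobolevS (leqnSn 1) su).
have /choice[u2 hu2] : forall p : 'I_n * 'I_n, exists g, sq_integrable leb Omega g /\
    weak_partial Omega p.2 (u1 p.1) g.
  move=> [i j] /=; have [hi di] := hu1 i.
  pose a k : nat := ((k == i) + (k == j))%N.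
  have sa : size (mlist a) = 2%N by rewrite size_mlist big_split/= !sum_eq_ord.
  have ma k : (k \in mlist a) = (k == i) || (k == j).
    by rewrite mem_mlist /a; case: (k == i); case: (k == j).
  have [|g /(L2P _ mO) hg ug] := h a; first by rewrite -size_mlist sa.
  exists g; split => //.
  have [Ea|Ea] : mlist a = [:: i; j] \/ mlist a = [:: j; i].
    move: sa ma; case: (mlist a) => [//|k [//|l []]]// _ ma.
    have := ma i; have := ma j; have := ma k; have := ma l.
    rewrite !inE !eqxx !orbT /=.
    case: (eqVneq l i) => [->|_]; case: (eqVneq k i) => [->|_] /=.
    - by move=> _ _; rewrite orbb => /eqP -> _; left.
    - by move=> _ /esym/eqP -> _ _; right.
    - by move=> /esym/eqP -> _ _ _; left.
    - by [].
  - exact/(is_weak_deriv_partial2 mO Ea hu hg di).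
  (* Here the multi-index yields g as the i-th derivative of u1 j. Symmetry of the second
     derivatives of phi makes it the j-th derivative of u1 i as well. *)
  - have [hj dj] := hu1 j; move=> phi tphi.
    have := (is_weak_deriv_partial2 mO Ea hu hg dj).1 ug _ tphi.
    have := dj _ (test_function_partial i tphi); have := di _ (test_function_partial j tphi).
    by rewrite (partial_comm i j (proj1 tphi)) => -> /oppr_inj ->.
exists u1, (fun i j => u2 (i, j)); split => //=.
- by move=> i; have [] := hu1 i.
- by move=> i j; have [] := hu2 (i, j).
- by move=> i; have [] := hu1 i.
- by move=> i j; have [] := hu2 (i, j).
Qed.

(** The Leibniz rule, from testing with eta phi. The cutoff eta turns a weak derivative in [Omega]
    into one on the whole space. *)
Lemma weak_partialM Omega i u g eta : measurable Omega ->
  locally_integrable_on Omega u -> locally_integrable_on Omega g ->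
  weak_partial Omega i u g -> test_function Omega eta -> open Omega ->
  weak_partial setT i (fun x => u x * eta x) (fun x => g x * eta x + u x * partial i eta x).
Proof.
move=> mO lu lg ug teta oO phi [sphi _].
have [seta [K [cK KO eta0]]] := teta.
have out x : ~ Omega x -> eta x = 0 by move=> Ox; apply: eta0 => /KO.
have dteta := test_function_partial i teta.
have dout x : ~ Omega x -> partial i eta x = 0.
  move=> Ox; apply: (partial_eq0 i (compact_closed_row cK) eta0) => /KO.
  exact: Ox.
have tep : test_function Omega (fun x => eta x * phi x) by exact: test_functionMr.
have := ug _ tep; rewrite (partialM i seta sphi) => E.
rewrite (Rintegral_support _ mO); last by move=> x /out ->; rewrite mulr0 mul0r.
rewrite (Rintegral_support _ mO); last first.
  by move=> x Ox; rewrite out// dout// !mulr0 addr0 mul0r.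
have i1 := locally_integrable_test oO lu (test_functionMr (smooth_partial i sphi) teta).
have i2 := locally_integrable_test oO lu (test_functionMr sphi dteta).
have i3 := locally_integrable_test oO lg tep.
move: E; under eq_Rintegral do rewrite mulrDr [phi _ * _]mulrC.
rewrite RintegralD// => /eqP; rewrite addrC -subr_eq0 opprK => /eqP E.
under eq_Rintegral do rewrite -mulrA.
under [in RHS]eq_Rintegral do rewrite mulrDl -!mulrA.
rewrite RintegralD//; apply/eqP; rewrite -subr_eq0 opprK -E; apply/eqP.
by rewrite [in RHS]addrC addrCA addrC -addrA.
Qed.

Lemma weak_partialS Omega i f g : measurable Omega -> weak_partial setT i f g ->
  (forall x, ~ Omega x -> f x = 0) -> (forall x, ~ Omega x -> g x = 0) ->
  weak_partial Omega i f g.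
Proof.
move=> mO fg f0 g0 phi tphi; have := fg _ (test_functionS (@subsetT _ _) tphi).
rewrite (Rintegral_support _ mO); last by move=> x /f0 ->; rewrite mul0r.
by rewrite (Rintegral_support _ mO)// => x /g0 ->; rewrite mul0r.
Qed.

Lemma weak_partial_add Omega i f g f' g' : open Omega ->
  locally_integrable_on Omega f -> locally_integrable_on Omega f' ->
  locally_integrable_on Omega g -> locally_integrable_on Omega g' ->
  weak_partial Omega i f f' -> weak_partial Omega i g g' ->
  weak_partial Omega i (fun x => f x + g x) (fun x => f' x + g' x).
Proof.
move=> oO lf lf' lg lg' df dg phi tphi; have mO := open_measurable_row oO.
have tdphi := test_function_partial i tphi.
under eq_Rintegral do rewrite mulrDl.
under [in RHS]eq_Rintegral do rewrite mulrDl.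
rewrite !RintegralD//; try exact: locally_integrable_test.
by rewrite df// dg// opprD.
Qed.

Lemma weak_partial_scale Omega i c f f' : open Omega ->
  locally_integrable_on Omega f -> locally_integrable_on Omega f' ->
  weak_partial Omega i f f' ->
  weak_partial Omega i (fun x => c * f x) (fun x => c * f' x).
Proof.
move=> oO lf lf' df phi tphi; have mO := open_measurable_row oO.
have tdphi := test_function_partial i tphi.
under eq_Rintegral do rewrite -mulrA.
under [in RHS]eq_Rintegral do rewrite -mulrA.
rewrite !RintegralZl//; try exact: locally_integrable_test.
by rewrite df// mulrN.
Qed.

(** The derivative has the same integral as its average over a unit backward segment, which is
    phi(x) - phi(x - e); translation invariance makes that 0. *)
Lemma test_partial_integral0 i phi : test_function setT phi ->
  \int[leb]_x partial i phi x = 0.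
Proof.
move=> tphi; have [sphi _] := tphi.
have pi := test_function_integrable tphi.
have ti := test_function_integrable (test_function_partial i tphi).
have := Rintegral_line_integral (- delta_mx ord0 i) ler01 ti; rewrite mul1r => <-.
have mp := test_function_measurable tphi.
rewrite -[RHS](subrr (\int[leb]_x phi x)) -{2}(Rintegral_shift (- (1 *: delta_mx ord0 i)) mp).
rewrite -RintegralB//; last exact: (integrable_shift (- (1 *: delta_mx ord0 i)) pi).
by apply: eq_Rintegral => x _; exact: smooth_FTC.
Qed.

Lemma weak_partial_smooth i phi : test_function setT phi ->
  weak_partial setT i phi (partial i phi).
Proof.
move=> tphi psi tpsi; have [sphi _] := tphi; have [spsi _] := tpsi.
have := test_partial_integral0 i (test_functionMr spsi tphi).
rewrite (partialM i sphi spsi) RintegralD//.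
- move/eqP; rewrite addr_eq0 => /eqP ->; congr (- _).
  by apply: eq_Rintegral => x _; rewrite mulrC.
- apply: test_function_integrable (test_functionMr (smooth_partial i spsi) tphi).
- by apply: test_function_integrable (test_functionMr (smooth_partial i sphi) tpsi).
Qed.

Lemma test_sq_integrable Omega phi : test_function Omega phi -> sq_integrable leb setT phi.
Proof.
move=> tphi; have mp := test_function_measurable tphi; split => //.
exact: test_function_integrable (test_functionX 1 tphi).
Qed.

End weak_derivatives.

Lemma ge0_subset_Rintegral d (T : measurableType d) (R : realType)
    (m : {measure set T -> \bar R}) (D E : set T) (f : T -> R) :
  measurable D -> measurable E -> D `<=` E -> (forall x, E x -> 0 <= f x) ->
  m.-integrable E (EFin \o f) -> \int[m]_(x in D) f x <= \int[m]_(x in E) f x.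
Proof.
move=> mD mE DE f0 fi; apply: fine_le.
- exact: integrable_fin_num (integrableS mE mD DE fi).
- exact: integrable_fin_num fi.
by apply: ge0_subset_integral => //; exact: measurable_int fi.
Qed.

(** * Admissible perturbations and the value of the functional *)

Section functional.
Context {R : realType} {n : nat}.
Local Notation V := 'rV[R]_n.
Local Notation leb := (@lebesgue_row R n).
Implicit Types (K : set V) (f g h u v w phi eta : V -> R) (i j : 'I_n).
Context (Omega : set V) (oO : open Omega) (bO : bounded_set Omega).

Let mO : measurable Omega := open_measurable_row oO.

Record W12 u (u1 : 'I_n -> V -> R) : Prop := {
  W12_sq : sq_integrable leb Omega u;
  W12_sq1 : forall i, sq_integrable leb Omega (u1 i);
  W12_partial1 : forall i, weak_partial Omega i u (u1 i) }.

Lemma W12_sobolev u (u1 : 'I_n -> V -> R) : W12 u u1 -> sobolev Omega 1 u.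
Proof.
move=> [hu h1 d1]; split; first exact/L2P.
move=> a; rewrite -size_mlist; case E : (mlist a) => [|i []] // _.
- by exists u; [exact/L2P|exact: is_weak_deriv0].
- by exists (u1 i); [exact/L2P|apply/(is_weak_deriv_partial mO E)].
Qed.

Lemma W12_sub u (u1 : 'I_n -> V -> R) v (v1 : 'I_n -> V -> R) : W12 u u1 -> W12 v v1 ->
  W12 (fun x => u x - v x) (fun i x => u1 i x - v1 i x).
Proof.
move=> [hu hu1 du] [hv hv1 dv]; split; [exact: sq_integrableB|by move=> i; exact: sq_integrableB|].
move=> i; have lv := sq_locally_integrable mO hv; have lv1 := sq_locally_integrable mO (hv1 i).
have := weak_partial_scale (-1) oO lv lv1 (dv i) => dN.
have sN g : sq_integrable leb Omega g -> locally_integrable_on Omega (fun x => -1 * g x).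
  by move=> hg; apply: sq_locally_integrable => //; exact: sq_integrableZ.
have := weak_partial_add oO (sq_locally_integrable mO hu)
  (sq_locally_integrable mO (hu1 i)) (sN _ hv) (sN _ (hv1 i)) (du i) dN.
by under eq_fun do rewrite mulN1r; under [X in weak_partial _ _ _ X]eq_fun do rewrite mulN1r.
Qed.

Lemma W12_test phi : test_function Omega phi -> W12 phi (fun i => partial i phi).
Proof.
move=> tphi; have out f : test_function Omega f -> forall x, ~ Omega x -> f x = 0.
  by move=> [_ [K [_ KO f0]]] x Ox; apply: f0 => /KO.
split.
- exact: sq_integrableS (test_sq_integrable tphi).
- by move=> i; apply: sq_integrableS (test_sq_integrable (test_function_partial i tphi)).
- move=> i; apply: weak_partialS (out _ tphi) (out _ (test_function_partial i tphi)) => //.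
  exact: weak_partial_smooth (test_functionS (@subsetT _ _) tphi).
Qed.

Lemma W12_W1 K w (w1 : 'I_n -> V -> R) : K `<=` Omega -> W1 K w w1 -> W12 w w1.
Proof.
move=> KO [hw w0 h]; split.
- exact: sq_integrableS hw.
- by move=> i; have [h1 _ _] := h i; exact: sq_integrableS h1.
- move=> i; have [_ h0 d] := h i; apply: weak_partialS => // x Ox.
    by apply: w0 => /KO.
  by apply: h0 => /KO.
Qed.

(** The size of the finite type indexing the sum in [sobolev_norm], an upper bound for its number of
    terms. *)
Let nidx : R := #|{ffun 'I_n -> 'I_2}|%:R.

Lemma sobolev_norm_le f (f1 : 'I_n -> V -> R) (d : R) : 0 <= d -> W12 f f1 ->
  \int[leb]_(x in Omega) (f x ^+ 2) <= d ->
  (forall i, \int[leb]_(x in Omega) (f1 i x ^+ 2) <= d) ->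
  sobolev_norm Omega 1 f ^+ 2 <= nidx * d.
Proof.
move=> d0 [hf h1 d1] fd f1d; rewrite sqr_sqrtr; last first.
  by apply: sumr_ge0 => a _; apply: Rintegral_ge0 => x _; exact: sqr_ge0.
rewrite mulr_natl -sumr_const big_mkcond; apply: ler_sum => a _; case: ifP => // a1.
move: a1; rewrite -size_mlist; case E : (mlist _) => [|i []] // _.
- by rewrite (weak_deriv_integral oO _ (is_weak_deriv0 mO E hf)) //; case: hf.
- rewrite (weak_deriv_integral oO _ ((is_weak_deriv_partial mO E hf (h1 i)).2 (d1 i)))//.
  by case: (h1 i).
Qed.

Lemma sobolev_norm_ge f (f1 : 'I_n -> V -> R) : W12 f f1 ->
  \int[leb]_(x in Omega) (f x ^+ 2) <= sobolev_norm Omega 1 f ^+ 2 /\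
  forall i, \int[leb]_(x in Omega) (f1 i x ^+ 2) <= sobolev_norm Omega 1 f ^+ 2.
Proof.
move=> [hf h1 d1].
have ge0 (a : {ffun 'I_n -> 'I_2}) :
    0 <= \int[leb]_(x in Omega) (`|weak_deriv Omega (fun i => a i : nat) f x| ^+ 2).
  by apply: Rintegral_ge0 => x _; exact: sqr_ge0.
have S (a : {ffun 'I_n -> 'I_2}) : (size (mlist (fun i => a i : nat)) <= 1)%N ->
    \int[leb]_(x in Omega) (`|weak_deriv Omega (fun i => a i : nat) f x| ^+ 2) <=
    sobolev_norm Omega 1 f ^+ 2.
  rewrite size_mlist => sa; rewrite sqr_sqrtr; last by apply: sumr_ge0.
  by rewrite (bigD1 a)//= lerDl sumr_ge0.
split=> [|i].
  have E : mlist (fun i => [ffun=> (ord0 : 'I_2)] i : nat) = [::].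
    by apply/nilP; rewrite /nilp size_mlist big1// => i _; rewrite ffunE.
  have := S [ffun=> ord0]; rewrite E => /(_ isT); apply: le_trans.
  by rewrite (weak_deriv_integral oO _ (is_weak_deriv0 mO E hf)) //; case: hf.
pose a : {ffun 'I_n -> 'I_2} := [ffun j => inord (j == i)].
have Ea j : a j = (j == i) :> nat by rewrite ffunE inordK//; case: (j == i).
have E : mlist (fun i => a i : nat) = [:: i].
  have : size (mlist (fun i => a i : nat)) = 1%N.
    by rewrite size_mlist (eq_bigr (fun j => (j == i) : nat))// sum_eq_ord.
  have := mem_mlist (fun i => a i : nat); case: (mlist _) => [//|j []]// /(_ j).
  by rewrite mem_seq1 eqxx Ea; case: eqP => // ->.
have := S a; rewrite E => /(_ isT); apply: le_trans.
rewrite (weak_deriv_integral oO _ ((is_weak_deriv_partial mO E hf (h1 i)).2 (d1 i)))//.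
by case: (h1 i).
Qed.

Lemma sq_integral_sub f g : sq_integrable leb Omega f -> sq_integrable leb Omega g ->
  \int[leb]_(x in Omega) ((f x - g x) ^+ 2) <=
  2 * \int[leb]_(x in Omega) (f x ^+ 2) + 2 * \int[leb]_(x in Omega) (g x ^+ 2).
Proof.
move=> hf hg; have [_ f2] := hf; have [_ g2] := hg.
rewrite -!RintegralZl// -RintegralD//; [|exact: integrable_scale|exact: integrable_scale].
apply: le_Rintegral => //.
- by have [] := sq_integrableB mO hf hg.
- by apply: integrable_add => //; exact: integrable_scale.
- move=> x _; rewrite -subr_ge0.
  by rewrite (_ : _ - _ = (f x + g x) ^+ 2) ?sqr_ge0//; ring.
Qed.

(** The tolerances of [sobolev0_sub]: the first summand comes from approximating g in the Sobolev
    norm, the second from approximating w in squared L^2 norms. The additions of 1 cover N = 0. *)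
Let small_choice (N e : R) : 0 <= N -> 0 < e ->
  N * (2 * (e / (4 * (N + 1))) ^+ 2 + 2 * (e ^+ 2 / (8 * (N + 1)))) < e ^+ 2.
Proof.
move=> N0 e0; have e2 : 0 < e ^+ 2 by rewrite exprn_gt0.
have N1 : 0 < N + 1 by lra.
set q := N / (N + 1); have q1 : q < 1 by rewrite ltr_pdivrMr//; lra.
have q0 : 0 <= q by rewrite divr_ge0// ltW.
have r1 : (N + 1)^-1 <= 1 by rewrite invf_le1//; lra.
have r0 : 0 <= (N + 1)^-1 by rewrite invr_ge0 ltW.
have -> : N * (2 * (e / (4 * (N + 1))) ^+ 2 + 2 * (e ^+ 2 / (8 * (N + 1)))) =
  e ^+ 2 * (q * (N + 1)^-1 / 8 + q / 4) by rewrite /q; field; lra.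
rewrite -[ltRHS]mulr1 ltr_pM2l//.
have : q * (N + 1)^-1 <= 1 by rewrite -[leRHS]mulr1 ler_pM// ltW.
lra.
Qed.

(** Test functions close to g and to w are subtracted. For w, which has compact support and two weak
    derivatives, they come from [mollify]. *)
Lemma sobolev0_sub K g w (w1 : 'I_n -> V -> R) (w2 : 'I_n -> 'I_n -> V -> R) :
  compact K -> K `<=` Omega -> sobolev0 Omega g ->
  W1 K w w1 -> (forall i, W1 K (w1 i) (w2 i)) ->
  sobolev0 Omega (fun x => g x - w x).
Proof.
move=> cK KO [sg ag] hw hw1.
have [g1 hg1] := sobolev_W1 mO sg.
have Wg : W12 g g1.
  by split; [have [/(L2P _ mO)] := sg| |] => // i; have [] := hg1 i.
have Ww := W12_W1 KO hw; split; first exact: W12_sobolev (W12_sub Wg Ww).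
move=> e e0; have N0 : 0 <= nidx by exact: ler0n.
have N1 : 0 < nidx + 1 by rewrite ltr_wpDl.
have [|phi1 tphi1 a1] := ag (e / (4 * (nidx + 1))).
  by rewrite divr_gt0// mulr_gt0.
have [|phi2 tphi2 [a2 a2']] := @mollify R n Omega K w w1 w2 (e ^+ 2 / (8 * (nidx + 1))) oO cK KO hw hw1.
  by rewrite divr_gt0 ?exprn_gt0// mulr_gt0.
exists (fun x => phi1 x - phi2 x); first exact: test_functionB.
have WG := W12_sub Wg (W12_test tphi1); have WH := W12_sub Ww (W12_test tphi2).
have WF := W12_sub WG WH.
have [G0 G1] := sobolev_norm_ge WG.
have S0 : 0 <= sobolev_norm Omega 1 (fun x => g x - phi1 x) by exact: sqrtr_ge0.
have aS : sobolev_norm Omega 1 (fun x => g x - phi1 x) ^+ 2 <= (e / (4 * (nidx + 1))) ^+ 2.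
  by rewrite ler_sqr ?nnegrE// ltW// (le_lt_trans S0).
have sub f : sq_integrable leb setT f -> \int[leb]_(x in Omega) (f x ^+ 2) <= sqn f.
  by move=> [_ fi]; apply: ge0_subset_Rintegral => // x _; exact: sqr_ge0.
have -> : (fun x => g x - w x - (phi1 x - phi2 x)) = (fun x => g x - phi1 x - (w x - phi2 x)).
  by apply/funext => x; ring.
rewrite -ltr_sqr ?nnegrE ?sqrtr_ge0 ?ltW//; apply: le_lt_trans (small_choice N0 e0).
have [GS G1S _] := WG; have [HS H1S _] := WH; have [hws _ hw1s] := hw.
apply: sobolev_norm_le WF _ _.
- by rewrite addr_ge0// mulr_ge0// ?sqr_ge0// divr_ge0 ?sqr_ge0 ?mulr_ge0// ltW.
- apply: le_trans (sq_integral_sub GS HS) _; rewrite lerD// ler_pM2l//.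
    exact: le_trans aS.
  apply: le_trans (ltW a2); apply: sub.
  by apply: sq_integrableB => //; exact: test_sq_integrable tphi2.
- move=> i; apply: le_trans (sq_integral_sub (G1S i) (H1S i)) _; rewrite lerD// ler_pM2l//.
    exact: le_trans aS.
  apply: le_trans (ltW (a2' i)); apply: sub.
  apply: sq_integrableB => //; first by have [] := hw1s i.
  exact: test_sq_integrable (test_function_partial i tphi2).
Qed.

Lemma W22_W12 u (u1 : 'I_n -> V -> R) (u2 : 'I_n -> 'I_n -> V -> R) : W22 Omega u u1 u2 <-> W12 u u1 /\ forall i, W12 (u1 i) (u2 i).
Proof.
split=> [[h h1 h2 d1 d2]|[[h h1 d1] H]]; first by split => [|i]; split.
by split => // [i j|i j]; have [] := H i.
Qed.

Lemma W22_sub u (u1 : 'I_n -> V -> R) (u2 : 'I_n -> 'I_n -> V -> R) v (v1 : 'I_n -> V -> R) (v2 : 'I_n -> 'I_n -> V -> R) : W22 Omega u u1 u2 -> W22 Omega v v1 v2 ->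
  W22 Omega (fun x => u x - v x) (fun i x => u1 i x - v1 i x) (fun i j x => u2 i j x - v2 i j x).
Proof.
move=> /W22_W12[hu hu1] /W22_W12[hv hv1]; apply/W22_W12; split; first exact: W12_sub.
by move=> i; exact: W12_sub.
Qed.

Definition lap (v2 : 'I_n -> 'I_n -> V -> R) x : R := \sum_i v2 i i x.

Lemma lap_sq v (v1 : 'I_n -> V -> R) (v2 : 'I_n -> 'I_n -> V -> R) : W22 Omega v v1 v2 -> sq_integrable leb Omega (lap v2).
Proof. by move=> [_ _ h2 _ _]; exact: sq_integrable_sum. Qed.

Lemma measurable_positivity_set v : measurable_fun Omega v ->
  measurable (positivity_set Omega v).
Proof.
move=> mv; have := mv mO `]0, +oo[%classic (measurable_itv _).
by congr (measurable _); apply/seteqP; split => x /=; rewrite in_itv/= andbT.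
Qed.

Lemma fin_measure (B : set V) : measurable B -> B `<=` Omega -> leb B \is a fin_num.
Proof.
move=> mB BO; rewrite ge0_fin_numE//.
by apply: le_lt_trans (lebesgue_row_bounded mO bO); apply: le_measure; rewrite ?inE.
Qed.

Lemma fin_positivity_set v : measurable_fun Omega v ->
  leb (positivity_set Omega v) \is a fin_num.
Proof.
by move=> mv; apply: fin_measure; [exact: measurable_positivity_set|move=> x []].
Qed.

(** The chosen weak derivatives in [laplacian] agree almost everywhere with the u2 i i, and the
    volume is finite on a bounded domain: the functional becomes a real number. *)
Lemma functionalE v (v1 : 'I_n -> V -> R) (v2 : 'I_n -> 'I_n -> V -> R) : W22 Omega v v1 v2 ->
  functional_J Omega v = (\int[leb]_(x in Omega) (lap v2 x ^+ 2) + volume (positivity_set Omega v))%:E.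
Proof.
move=> W; have [hv h1 h2 d1 d2] := W; have [mv _] := hv.
have mp := measurable_positivity_set mv.
have [ml li] := lap_sq W.
have /choice[wd hwd] : forall i, exists g, [/\ measurable_fun Omega g,
   {ae leb, forall x, Omega x -> g x = v2 i i x} &
   weak_deriv Omega (fun j => if j == i then 2%N else 0%N) v = g].
  move=> i; have E : mlist (fun j => if j == i then 2%N else 0%N) = [:: i; i].
    have : size (mlist (fun j => if j == i then 2%N else 0%N)) = 2%N.
      by rewrite size_mlist (bigD1 i)//= eqxx big1// => j /negbTE ->.
    have := mem_mlist (fun j => if j == i then 2%N else 0%N).
    case: (mlist _) => [//|k [//|l []]]// H _; have := H k; have := H l.
    by rewrite !inE !eqxx ?orbT/=; do 2! case: eqP => [->|//].
  have [m1 m2] := weak_derivE oO ((is_weak_deriv_partial2 mO E hv (h2 i i) (d1 i)).2 (d2 i i)).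
  by eexists; split; [exact: m1|exact: m2|].
have lapE : laplacian Omega v = fun x => \sum_i wd i x.
  by apply/funext => x; apply: eq_bigr => i _; have [_ _ ->] := hwd i.
have mlap : measurable_fun Omega (laplacian Omega v).
  by rewrite lapE; apply: measurable_sum => i; have [] := hwd i.
have mi : measurable_fun Omega (\1_(positivity_set Omega v) : V -> R).
  exact: measurable_indic.
transitivity (\int[leb]_(x in Omega) ((lap v2 x ^+ 2 + \1_(positivity_set Omega v) x)%R)%:E)%E.
  apply: ge0_ae_eq_integral => //.
  - apply/measurable_EFinP; apply: measurable_funD => //; apply: measurable_funX.
    exact: measurableT_comp.
  - by apply/measurable_EFinP; apply: measurable_funD => //; apply: measurable_funX.
  - by move=> x _; rewrite lee_fin addr_ge0 ?sqr_ge0.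
  have : {ae leb, forall x, forall i, Omega x -> wd i x = v2 i i x}.
    by apply: ae_countable => i; have [] := hwd i.
  apply: filterS => x hx Ox; rewrite lapE /lap (eq_bigr _ (fun i _ => hx i Ox)).
  by rewrite real_normK ?num_real.
under eq_integral do rewrite EFinD.
rewrite ge0_integralD//.
- rewrite integral_indic// setIidl; last by move=> x [].
  have -> : (\int[leb]_(x in Omega) (lap v2 x ^+ 2)%:E)%E = (\int[leb]_(x in Omega) (lap v2 x ^+ 2))%:E.
    by rewrite /Rintegral fineK//; exact: integrable_fin_num li.
  exact: (f_equal2 adde erefl (esym (fineK (fin_positivity_set mv)))).
- by move=> x _; rewrite lee_fin sqr_ge0.
- by apply/measurable_EFinP; exact: measurable_funX.
- by apply/measurable_EFinP.
Qed.

Lemma W1_W22 K w (w1 : 'I_n -> V -> R) (w2 : 'I_n -> 'I_n -> V -> R) : K `<=` Omega ->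
  W1 K w w1 -> (forall i, W1 K (w1 i) (w2 i)) -> W22 Omega w w1 w2.
Proof.
by move=> KO hw hw1; apply/W22_W12; split=> [|i]; exact: W12_W1 KO _.
Qed.

Lemma W1_mul K u (u1 : 'I_n -> V -> R) eta : compact K -> K `<=` Omega -> smooth eta ->
  (forall x, ~ K x -> eta x = 0) -> W12 u u1 ->
  W1 K (fun x => u x * eta x) (fun i x => u1 i x * eta x + u x * partial i eta x).
Proof.
move=> cK KO seta eta0 [hu hu1 du].
have teta : test_function Omega eta by split => //; exists K.
have out f : (forall x, ~ K x -> f x = 0) -> forall x, ~ Omega x -> f x = 0.
  by move=> f0 x Ox; apply: f0 => /KO.
have mul g f : sq_integrable leb Omega g -> test_function Omega f ->
    (forall x, ~ K x -> f x = 0) -> sq_integrable leb setT (fun x => g x * f x).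
  move=> hg tf f0; have [M _ fM] := test_function_bounded tf.
  apply: (sq_integrable_support mO).
    by move=> x /(out _ f0) ->; rewrite mulr0.
  apply: (sq_integrable_bounded (M := M)) => //.
  exact: measurable_funS (test_function_measurable tf).
have deta0 i := partial_eq0 i (compact_closed_row cK) eta0.
split; [exact: mul|by move=> x /eta0 ->; rewrite mulr0|move=> i; split].
- apply: sq_integrableD => //; first exact: mul.
  by apply: mul => //; [exact: test_function_partial|exact: deta0].
- by move=> x Kx; rewrite eta0// deta0// !mulr0 addr0.
- by apply: (weak_partialM mO _ _ (du i) teta oO); exact: sq_locally_integrable.
Qed.

Lemma W1_add K f (f1 : 'I_n -> V -> R) g (g1 : 'I_n -> V -> R) :
  W1 K f f1 -> W1 K g g1 -> W1 K (fun x => f x + g x) (fun i x => f1 i x + g1 i x).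
Proof.
move=> [hf f0 hf1] [hg g0 hg1]; have oT : open [set: V] by exact: openT.
split; [exact: sq_integrableD|by move=> x Kx; rewrite f0// g0// addr0|].
move=> i; have [h1 h0 d] := hf1 i; have [h1' h0' d'] := hg1 i; split.
- exact: sq_integrableD.
- by move=> x Kx; rewrite h0// h0'// addr0.
- by apply: weak_partial_add => //; exact: sq_locally_integrable.
Qed.

Lemma W1_scale K c f (f1 : 'I_n -> V -> R) :
  W1 K f f1 -> W1 K (fun x => c * f x) (fun i x => c * f1 i x).
Proof.
move=> [hf f0 hf1]; have oT : open [set: V] by exact: openT.
split; [exact: sq_integrableZ|by move=> x Kx; rewrite f0// mulr0|].
move=> i; have [h1 h0 d] := hf1 i; split.
- exact: sq_integrableZ.
- by move=> x Kx; rewrite h0// mulr0.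
- by apply: weak_partial_scale => //; exact: sq_locally_integrable.
Qed.

Lemma W1_test K phi : compact K -> K `<=` Omega -> smooth phi ->
  (forall x, ~ K x -> phi x = 0) -> W1 K phi (fun i => partial i phi).
Proof.
move=> cK KO sphi phi0; have tphi : test_function setT phi by split => //; exists K.
split => //; first exact: test_sq_integrable tphi.
move=> i; split.
- exact: test_sq_integrable (test_function_partial i tphi).
- exact: partial_eq0 (compact_closed_row cK) phi0.
- exact: weak_partial_smooth.
Qed.

End functional.

(** * Comparison with perturbations of the minimizer *)

Section euler_lagrange.
Context {R : realType} {n : nat}.
Local Notation V := 'rV[R]_n.
Local Notation leb := (@lebesgue_row R n).
Implicit Types (K : set V) (f g h v w phi eta : V -> R) (i j : 'I_n).
Context (Omega : set V) (oO : open Omega) (bO : bounded_set Omega).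
Context (u0 u : V -> R) (u1 : 'I_n -> V -> R) (u2 : 'I_n -> 'I_n -> V -> R).
Context (umin : minimizer Omega u0 u) (uW : W22 Omega u u1 u2).

Let mO : measurable Omega := open_measurable_row oO.
Let D := lap u2.
Let A := \int[leb]_(x in Omega) (D x ^+ 2).

(** The competitor is u - w, admissible because w has compact support in [Omega]. *)
Lemma minimizer_le K w (w1 : 'I_n -> V -> R) (w2 : 'I_n -> 'I_n -> V -> R) :
  compact K -> K `<=` Omega -> W1 K w w1 -> (forall i, W1 K (w1 i) (w2 i)) ->
  A + volume (positivity_set Omega u) <=
  \int[leb]_(x in Omega) ((D x - lap w2 x) ^+ 2) +
  volume (positivity_set Omega (fun x => u x - w x)).
Proof.
move=> cK KO hw hw1; have Ww := W1_W22 oO KO hw hw1.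
have Wv := W22_sub oO uW Ww.
have [[su au] /(_ (fun x => u x - w x))] := umin.
rewrite (functionalE oO bO uW) (functionalE oO bO Wv) lee_fin.
have -> : lap (fun i j x => u2 i j x - w2 i j x) = fun x => D x - lap w2 x.
  by apply/funext => x; rewrite /D /lap sumrB.
apply; split; first exact: W22_sobolev mO Wv.
have := sobolev0_sub oO cK KO au hw hw1.
by congr (sobolev0 _ _); apply/funext => x; rewrite addrAC.
Qed.

Lemma minimizer_scale_le K w (w1 : 'I_n -> V -> R) (w2 : 'I_n -> 'I_n -> V -> R) (t : R) :
  compact K -> K `<=` Omega -> W1 K w w1 -> (forall i, W1 K (w1 i) (w2 i)) ->
  volume (positivity_set Omega u) <=
  - (2 * t) * \int[leb]_(x in Omega) (D x * lap w2 x) +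
    t ^+ 2 * \int[leb]_(x in Omega) (lap w2 x ^+ 2) +
  volume (positivity_set Omega (fun x => u x - t * w x)).
Proof.
move=> cK KO hw hw1.
have := minimizer_le cK KO (W1_scale t hw) (fun i => W1_scale t (hw1 i)).
have -> : lap (fun i j x => t * w2 i j x) = fun x => t * lap w2 x.
  by apply/funext => x; rewrite /lap mulr_sumr.
have hD : sq_integrable leb Omega D := lap_sq oO uW.
have hW : sq_integrable leb Omega (lap w2) := lap_sq oO (W1_W22 oO KO hw hw1).
have -> : \int[leb]_(x in Omega) ((D x - t * lap w2 x) ^+ 2) =
   \int[leb]_(x in Omega) (1 * D x ^+ 2 + - (2 * t) * (D x * lap w2 x) + t ^+ 2 * lap w2 x ^+ 2).
  by apply: eq_Rintegral => x _; ring.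
rewrite Rintegral_lin3//; [|by case: hD|exact: sq_integrableM|by case: hW].
by rewrite mul1r -!addrA lerD2l.
Qed.

(** First-order optimality at t = 0, stated for a quadratic in t so that nothing has to be
    differentiated. *)
Let derivative_zero (P B e : R) : 0 < e -> 0 <= B ->
  (forall t, `|t| < e -> 0 <= - (2 * t) * P + t ^+ 2 * B) -> P = 0.
Proof.
move=> e0 B0 h; apply/eqP/negPn/negP => P0.
have q0 : 0 < B + `|P| + 1 by rewrite ltr_wpDl// addr_ge0.
(* The second bound gives s B < |P|, so the quadratic is negative at t = sgn(P) s. *)
pose s := Num.min (e / 2) (`|P| / (B + `|P| + 1)).
have Pp : 0 < `|P| by rewrite normr_gt0.
have s0 : 0 < s by rewrite lt_min !divr_gt0.
have se : s < e by rewrite gt_min ltr_pdivrMr// ltr_pMr// ltr1n.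
have sB : s * B < `|P|.
  apply: (@le_lt_trans _ _ (`|P| / (B + `|P| + 1) * B)).
    by rewrite ler_wpM2r// ge_min lexx orbT.
  by rewrite mulrAC ltr_pdivrMr// ltr_pM2l// -addrA ltrDl ltr_pwDr.
have := h (Num.sg P * s).
have sg1 : `|Num.sg P| = 1 by rewrite normr_sg P0.
rewrite normrM sg1 mul1r gtr0_norm// => /(_ se).
have -> : - (2 * (Num.sg P * s)) * P + (Num.sg P * s) ^+ 2 * B =
   s * (s * B * Num.sg P ^+ 2 - 2 * (Num.sg P * P)) by ring.
rewrite -normrEsg sqr_sg P0 mulr1 pmulr_rge0//; lra.
Qed.

Let derivative_le0 (P B : R) : 0 <= B ->
  (forall t, 0 <= t -> 0 <= - (2 * t) * P + t ^+ 2 * B) -> P <= 0.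
Proof.
move=> B0 h; rewrite leNgt; apply/negP => P0.
have q0 : 0 < B + 1 by rewrite ltr_wpDl.
have s0 : 0 < P / (B + 1) by rewrite divr_gt0.
have := h _ (ltW s0).
have -> : - (2 * (P / (B + 1))) * P + (P / (B + 1)) ^+ 2 * B =
  P / (B + 1) * (P * (B / (B + 1) - 2)) by ring.
rewrite pmulr_rge0// pmulr_rge0//.
have : B / (B + 1) < 1 by rewrite ltr_pdivrMr// mul1r ltrDl.
lra.
Qed.

(** The Laplacian of u eta, expanded by the Leibniz rule. *)
Definition lap_mul eta x : R :=
  D x * eta x + 2 * (\sum_i u1 i x * partial i eta x) + u x * \sum_i partial i (partial i eta) x.

Definition hess_mul eta i j x : R := u2 i j x * eta x + u1 i x * partial j eta x +
  (u1 j x * partial i eta x + u x * partial j (partial i eta) x).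

Let lap_mulE eta : lap (hess_mul eta) = lap_mul eta.
Proof.
apply/funext => x; rewrite /lap /lap_mul /D /lap mulr_suml !mulr_sumr -!big_split/=.
by apply: eq_bigr => i _; rewrite /hess_mul; ring.
Qed.

Lemma W1_hess_mul K eta : compact K -> K `<=` Omega -> smooth eta -> (forall x, ~ K x -> eta x = 0) ->
  W1 K (fun x => u x * eta x) (fun i x => u1 i x * eta x + u x * partial i eta x) /\
  forall i, W1 K (fun x => u1 i x * eta x + u x * partial i eta x) (hess_mul eta i).
Proof.
move=> cK KO seta eta0; have [U1 U2] := (W22_W12 _ _ _ _).1 uW.
split=> [|i]; first exact: (W1_mul oO).
apply: W1_add; first exact: (W1_mul oO).
apply: (W1_mul oO) => //; first exact: smooth_partial.
exact: partial_eq0 (compact_closed_row cK) eta0.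
Qed.

Lemma lap_mul_sq eta : test_function Omega eta -> sq_integrable leb Omega (lap_mul eta).
Proof.
move=> [seta [K [cK KO eta0]]]; have [h1 h2] := W1_hess_mul cK KO seta eta0.
have := lap_sq oO (W1_W22 oO KO h1 h2).
by rewrite lap_mulE.
Qed.

Lemma euler_lagrange eta : test_function Omega eta ->
  \int[leb]_(x in Omega) (D x * lap_mul eta x) = 0.
Proof.
move=> teta; have [M M0 etaM] := test_function_bounded teta.
have [seta [K [cK KO eta0]]] := teta; have [h1 h2] := W1_hess_mul cK KO seta eta0.
have M1 : 0 < M^-1 by rewrite invr_gt0.
rewrite -lap_mulE; apply: (derivative_zero M1 (B := \int[leb]_(x in Omega) (lap (hess_mul eta) x ^+ 2))).
  by apply: Rintegral_ge0 => x _; exact: sqr_ge0.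
move=> t tM; have := minimizer_scale_le t cK KO h1 h2.
(* For |t| < 1/M the perturbation multiplies u by the positive factor 1 - t eta: the volume term
   does not change, and t of both signs is allowed. *)
have -> : positivity_set Omega (fun x => u x - t * (u x * eta x)) = positivity_set Omega u.
  have pos x : 0 < 1 - t * eta x.
    rewrite subr_gt0; apply: le_lt_trans (ler_norm _) _; rewrite normrM.
    apply: (@le_lt_trans _ _ (`|t| * M)); first by rewrite ler_wpM2l.
    by rewrite -ltr_pdivlMr// div1r.
  apply/seteqP; split => x [Ox].
    rewrite (_ : u x - _ = u x * (1 - t * eta x)); last by ring.
    by rewrite pmulr_lgt0.
  move=> ux; split => //; rewrite (_ : u x - _ = u x * (1 - t * eta x)); last by ring.
  by rewrite mulr_gt0.
by rewrite -[X in X <= _]add0r lerD2r.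
Qed.

Lemma laplacian_superharmonic phi : test_function Omega phi -> (forall x, 0 <= phi x) ->
  \int[leb]_(x in Omega) (D x * \sum_i partial i (partial i phi) x) <= 0.
Proof.
move=> tphi phi_ge0; have [sphi [K [cK KO phi0]]] := tphi.
have h1 := W1_test cK KO sphi phi0.
have h2 i := W1_test cK KO (smooth_partial i sphi) (partial_eq0 i (compact_closed_row cK) phi0).
apply: (@derivative_le0 _ (\int[leb]_(x in Omega) (lap (fun i j => partial j (partial i phi)) x ^+ 2))).
  by apply: Rintegral_ge0 => x _; exact: sqr_ge0.
move=> t t0; have := minimizer_scale_le t cK KO h1 h2.
have [hu _] := W22_sq uW.
have mv : measurable_fun Omega (fun x => u x - t * phi x).
  apply: measurable_funB => //; apply: measurable_funM => //.
  exact: measurable_funS (test_function_measurable tphi).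
(* Subtracting t phi >= 0 can only shrink {u > 0}, so only the quadratic part can pay for the loss;
   hence a one-sided condition. *)
have : volume (positivity_set Omega (fun x => u x - t * phi x)) <= volume (positivity_set Omega u).
  apply: fine_le; [exact: fin_positivity_set|exact: fin_positivity_set|].
  apply: le_measure; rewrite ?inE; [exact: measurable_positivity_set|exact: measurable_positivity_set|].
  by move=> x [Ox ux]; split => //; apply: lt_le_trans ux _; rewrite gerBl mulr_ge0.
set a := volume _; set b := volume _; move=> ba le2.
have : b <= - (2 * t) * \int[leb]_(x in Omega) (D x * lap (fun i j => partial j (partial i phi)) x) +
   t ^+ 2 * \int[leb]_(x in Omega) (lap (fun i j => partial j (partial i phi)) x ^+ 2) + b.
  by apply: le_trans le2 _; rewrite lerD2l.
by rewrite -[X in X <= _]add0r lerD2r.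
Qed.

(** The competitor u - u eta stays positive exactly on {u > 0} minus {eta = 1}. The linear term of
    the expansion vanishes by [euler_lagrange], so the volume saved is paid by the quadratic one. *)
Lemma positivity_bound eta : test_function Omega eta -> (forall x, 0 <= eta x <= 1) ->
  volume (positivity_set Omega u `&` [set x | eta x = 1]) <=
  \int[leb]_(x in Omega) (lap_mul eta x ^+ 2).
Proof.
move=> teta eta01; have [seta [K [cK KO eta0]]] := teta.
have [h1 h2] := W1_hess_mul cK KO seta eta0.
have := minimizer_scale_le 1 cK KO h1 h2.
rewrite lap_mulE euler_lagrange// mulr0 add0r expr1n mul1r.
have -> : positivity_set Omega (fun x => u x - 1 * (u x * eta x)) =
    positivity_set Omega u `\` [set x | eta x = 1].
  apply/seteqP; split => x.
    move=> [Ox]; rewrite (_ : u x - _ = u x * (1 - eta x)); last by ring.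
    have /andP[e0 e1] := eta01 x; move=> ue.
    have e1' : eta x != 1 by apply: contraTneq ue => ->; rewrite subrr mulr0 ltxx.
    have : 0 < 1 - eta x by rewrite subr_gt0 lt_neqAle e1' e1.
    by move=> h; move: ue; rewrite pmulr_lgt0// => ux; split => //; apply/eqP.
  move=> [[Ox ux] /eqP e1']; split => //.
  rewrite (_ : u x - _ = u x * (1 - eta x)); last by ring.
  by rewrite mulr_gt0// subr_gt0 lt_neqAle e1'; have /andP[] := eta01 x.
have [hu _] := W22_sq uW.
have mp := measurable_positivity_set oO hu.
have mE : measurable [set x | eta x = 1].
  rewrite -[X in measurable X]setTI; exact: (test_function_measurable teta) measurableT _ (measurable_set1 1).
have fp := fin_positivity_set oO bO hu.
have E : volume (positivity_set Omega u) = volume (positivity_set Omega u `\` [set x | eta x = 1]) +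
   volume (positivity_set Omega u `&` [set x | eta x = 1]).
  rewrite /volume -fineD.
  - by rewrite [X in fine X](measureDI _ mp mE).
  - by apply: (fin_measure oO bO); [exact: measurableD|move=> x [[]]].
  - by apply: (fin_measure oO bO); [exact: measurableI|move=> x [[]]].
by rewrite {1}E addrC lerD2r.
Qed.

End euler_lagrange.

(** * Radial cutoffs and their scale-invariant bounds *)

Section cutoff.
Context {R : realType} {n : nat}.
Local Notation V := 'rV[R]_n.
Implicit Types (i : 'I_n) (x : V).

(** Equal to 1 for t <= 1/4 and to 0 for t >= 1/2, where t stands for a scaled squared distance. *)
Definition bump (t : R) : R := step (2 - 4 * t).

Lemma smooth1_bump : smooth1 bump.
Proof.
apply: (@Cinf_comp _ _ _ _ step (fun t : R => 2 - 4 * t)); first exact: smooth1_step.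
rewrite (_ : (fun t => _) = (fun t => 2 + - 4 * t)); first exact: smooth1_affine.
by apply/funext => t; rewrite mulNr.
Qed.

Lemma bump_itv t : 0 <= bump t <= 1.
Proof. by rewrite step_ge0 step_le1. Qed.

Lemma bump_eq1 t : t <= 4^-1 -> bump t = 1.
Proof. by move=> t4; apply: step_eq1; lra. Qed.

Lemma bump_eq0 t : 2^-1 <= t -> bump t = 0.
Proof. by move=> t2; apply: step_eq0; lra. Qed.

Lemma smooth1_continuous (S : R -> R) : smooth1 S -> continuous S.
Proof. by move=> sS; exact: Cinf_continuous sS. Qed.

Lemma derive1_eq0 (S : R -> R) (c t : R) : (forall s, c < s -> S s = 0) -> c < t ->
  derive1 S t = 0.
Proof.
move=> S0 ct; rewrite derive1E (@near_eq_derive _ _ _ S (cst 0)) ?derive_cst//.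
have : nbhs t `]c, +oo[%classic by apply: open_nbhs_nbhs; split => //; rewrite /= in_itv/= ct.
by apply: filterS => s; rewrite /= in_itv/= andbT => /S0.
Qed.

Lemma segment_bounded (g : R -> R) : continuous g ->
  exists2 M, 0 < M & forall t, 0 <= t <= 1 -> `|g t| <= M.
Proof.
move=> cg; have cn : continuous (fun t => `|g t|).
  by move=> t; apply: continuous_comp; [exact: cg|exact: norm_continuous].
have [c _ cM] := EVT_max ler01 (continuous_subspaceT cn).
exists (1 + `|g c|); first by rewrite ltr_pwDl.
by move=> t t01; rewrite (le_trans (cM t _)) ?in_itv// lerDr.
Qed.

Lemma sum_partial_sq_radial (S : R -> R) x0 (a : R) x : smooth1 S ->
  \sum_i partial i (radial S x0 a) x ^+ 2 =
  a * (4 * (a * dist2 x0 x) * derive1 S (a * dist2 x0 x) ^+ 2).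
Proof.
move=> sS; rewrite (eq_bigr (fun i => (4 * a ^+ 2 * derive1 S (a * dist2 x0 x) ^+ 2) *
    (x ord0 i - x0 ord0 i) ^+ 2)); last first.
  by move=> i _; rewrite partial_radial// /radial; ring.
by rewrite -mulr_sumr -/(dist2 x0 x); ring.
Qed.

Lemma dist2_ge0 x0 x : 0 <= dist2 x0 x.
Proof. by apply: sumr_ge0 => i _; exact: sqr_ge0. Qed.

Lemma radial_bounds (S : R -> R) : smooth1 S -> (forall t, 2^-1 < t -> S t = 0) ->
  exists2 M, 0 < M & forall x0 (a : R) x, 0 < a ->
    [/\ `|radial S x0 a x| <= M * (a * dist2 x0 x <= 2^-1)%R%:R,
     \sum_i partial i (radial S x0 a) x ^+ 2 <= M * a * (a * dist2 x0 x <= 2^-1)%R%:R &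
     `|\sum_i partial i (partial i (radial S x0 a)) x| <= M * a * (a * dist2 x0 x <= 2^-1)%R%:R].
Proof.
move=> sS S0; have sS1 := smooth1_derive sS; have sS2 := smooth1_derive sS1.
have S1_0 := derive1_eq0 S0; have S2_0 := derive1_eq0 S1_0.
have sid := @smooth1_id R.
have [M0 M00 hM0] := segment_bounded (smooth1_continuous sS).
have [M1 M10 hM1] : exists2 M, 0 < M & forall t, 0 <= t <= 1 ->
    `|4 * t * derive1 S t ^+ 2| <= M.
  apply: segment_bounded; apply: smooth1_continuous.
  by apply: CinfM; [exact: CinfZ|exact: CinfX].
have [M2 M20 hM2] : exists2 M, 0 < M & forall t, 0 <= t <= 1 ->
    `|4 * t * derive1 (derive1 S) t + 2 * n%:R * derive1 S t| <= M.
  apply: segment_bounded; apply: smooth1_continuous.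
  by apply: CinfD; [apply: CinfM => //; exact: CinfZ|exact: CinfZ].
exists (M0 + M1 + M2); first by rewrite !addr_gt0.
move=> x0 a x a0; have q0 : 0 <= a * dist2 x0 x by rewrite mulr_ge0 ?dist2_ge0// ltW.
rewrite sum_partial_sq_radial// laplacian_radial// /radial.
have [q2|q2] := leP (a * dist2 x0 x) 2^-1; last first.
  by rewrite S0// S1_0// S2_0// !(expr0n, mulr0, addr0) normr0.
have q01 : 0 <= a * dist2 x0 x <= 1 by rewrite q0; lra.
rewrite !mulr1; split.
- by apply: le_trans (hM0 _ q01) _; rewrite -addrA lerDl addr_ge0// ltW.
- rewrite [leRHS]mulrC ler_pM2l//.
  apply: le_trans (ler_norm _) (le_trans (hM1 _ q01) _).
  by rewrite addrAC lerDr addr_ge0// ltW.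
- rewrite normrM gtr0_norm// [leRHS]mulrC ler_pM2l//.
  apply: le_trans (hM2 _ q01) _.
  by rewrite lerDr addr_ge0// ltW.
Qed.

Lemma sum_cauchy_schwarz (I : finType) (a b : I -> R) :
  (\sum_i a i * b i) ^+ 2 <= (\sum_i a i ^+ 2) * \sum_i b i ^+ 2.
Proof.
apply: quadratic_ge0_disc; first by apply: sumr_ge0 => i _; exact: sqr_ge0.
move=> c; rewrite [leRHS](_ : _ = \sum_i (a i - c * b i) ^+ 2).
  by apply: sumr_ge0 => i _; exact: sqr_ge0.
rewrite !mulr_sumr -sumrB -big_split/=; apply: eq_bigr => i _; ring.
Qed.

End cutoff.

(** * Caccioppoli estimates *)

Section by_parts.
Context {R : realType} {n : nat}.
Local Notation V := 'rV[R]_n.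
Local Notation leb := (@lebesgue_row R n).
Implicit Types (K : set V) (f g h v w phi eta : V -> R) (i j : 'I_n).
Context (Omega : set V) (oO : open Omega).

Let mO : measurable Omega := open_measurable_row oO.

Let small_eq0 (X A : R) : 0 <= A -> (forall e, 0 < e -> X ^+ 2 <= A * e) -> X = 0.
Proof.
move=> A0 h; apply/eqP; rewrite -sqrf_eq0 eq_le sqr_ge0 andbT.
apply/ler_addgt0Pl => e e0; rewrite addr0.
have A1 : 0 < A + 1 by rewrite ltr_wpDl.
apply: le_trans (h (e / (A + 1)) _) _; first by rewrite divr_gt0.
by rewrite mulrCA ger_pMr// ler_pdivrMr// mul1r lerDl.
Qed.

(** Extends the weak derivative from test functions to w1 = the gradient of a compactly supported
    W^(2,2) function, such as u times a cutoff, by [mollify] and Cauchy-Schwarz. *)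
Lemma integration_by_parts K f g w (w1 : 'I_n -> V -> R) (w2 : 'I_n -> 'I_n -> V -> R) i :
  sq_integrable leb Omega f -> sq_integrable leb Omega g -> weak_partial Omega i f g ->
  compact K -> K `<=` Omega -> W1 K w w1 -> (forall i, W1 K (w1 i) (w2 i)) ->
  \int[leb]_(x in Omega) (f x * w1 i x) = - \int[leb]_(x in Omega) (g x * w x).
Proof.
move=> hf hg fg cK KO hw hw1.
have sub h : sq_integrable leb setT h -> \int[leb]_(x in Omega) (h x ^+ 2) <= sqn h.
  by move=> [_ hi]; apply: ge0_subset_Rintegral => // x _; exact: sqr_ge0.
have [hwT _ hw1T] := hw; have [hw1i _ _] := hw1T i.
have subO h : sq_integrable leb setT h -> sq_integrable leb Omega h by exact: sq_integrableS.
pose A := 2 * (\int[leb]_(x in Omega) (f x ^+ 2) + \int[leb]_(x in Omega) (g x ^+ 2)).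
have pos h : 0 <= \int[leb]_(x in Omega) (h x ^+ 2).
  by apply: Rintegral_ge0 => x _; exact: sqr_ge0.
apply/eqP; rewrite -subr_eq0 opprK; apply/eqP; apply: (@small_eq0 _ A).
  by rewrite mulr_ge0// addr_ge0.
move=> e e0; have [phi tphi [a1 a2]] := mollify oO cK KO hw hw1 e0.
have hphi := test_sq_integrable tphi; have hdphi := test_sq_integrable (test_function_partial i tphi).
have hp : sq_integrable leb setT (fun x => w x - phi x) by exact: sq_integrableB.
have hq : sq_integrable leb setT (fun x => w1 i x - partial i phi x) by exact: sq_integrableB.
have E : \int[leb]_(x in Omega) (f x * w1 i x) + \int[leb]_(x in Omega) (g x * w x) =
   \int[leb]_(x in Omega) (f x * (w1 i x - partial i phi x)) +
   \int[leb]_(x in Omega) (g x * (w x - phi x)).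
  under [X in _ = X + _]eq_Rintegral do rewrite mulrBr.
  under [X in _ = _ + X]eq_Rintegral do rewrite mulrBr.
  rewrite !RintegralB//; try by apply: sq_integrableM => //; exact: subO.
  by rewrite fg// opprK; ring.
have C1 := cauchy_schwarz mO hf (subO _ hq).
have C2 := cauchy_schwarz mO hg (subO _ hp).
rewrite E.
set X := \int[leb]_(x in Omega) (f x * (w1 i x - partial i phi x)) in C1 *.
set Y := \int[leb]_(x in Omega) (g x * (w x - phi x)) in C2 *.
apply: (@le_trans _ _ (2 * X ^+ 2 + 2 * Y ^+ 2)).
  by rewrite -subr_ge0 (_ : _ - _ = (X - Y) ^+ 2) ?sqr_ge0//; ring.
rewrite -mulrDr /A -mulrA ler_pM2l// mulrDl lerD//.
  apply: le_trans C1 _; rewrite ler_wpM2l//; exact: le_trans (sub _ hq) (ltW (a2 i)).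
by apply: le_trans C2 _; rewrite ler_wpM2l//; exact: le_trans (sub _ hp) (ltW a1).
Qed.

End by_parts.

(** * Pointwise inequalities for the Caccioppoli estimates *)

Section pointwise_estimates.
Context {R : realType}.
Implicit Types (d z s T t l u N k : R).

Let sq_le_of_norm (x y : R) : 0 <= y -> `|x| <= y -> x ^+ 2 <= y ^+ 2.
Proof. by move=> y0 xy; rewrite -[x ^+ 2]real_normK ?num_real// ler_sqr ?nnegrE. Qed.

(** Off the support of the cutoff all its data vanish; elsewhere the indicator k is 1 and disappears
    from the estimates. *)
Let indicator01 z t l N k : k = 0 \/ k = 1 -> 0 <= z <= k -> 0 <= t <= N * k ->
  `|l| <= N * k -> k = 1 \/ [/\ k = 0, z = 0, t = 0 & l = 0].
Proof.
move=> [->|->]; last by left.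
rewrite mulr0 normr_le0 => /le_anti <- /le_anti <- /eqP ->; by right.
Qed.

(* Pointwise forms of the Caccioppoli estimates: d is the Laplacian of u, z the
   cutoff, s the inner product of the gradients of u and z, T and t their squared
   lengths, l the Laplacian of z, and k the indicator of a set carrying z. The
   right-hand side is d times the Laplacian of u z^4. *)
Lemma caccioppoli_pointwise d z s T t l u N k : k = 0 \/ k = 1 -> 0 <= z <= k ->
  0 <= t <= N * k -> `|l| <= N * k -> 0 <= T -> s ^+ 2 <= T * t ->
  2^-1 * (d * z ^+ 2) ^+ 2 + - (64 * N) * (T * z ^+ 2) + - (256 * N ^+ 2) * (u * k) ^+ 2 <=
  d * (d * (z ^+ 2) ^+ 2 + 2 * (4 * z ^+ 3 * s) + u * (z ^+ 2 * (4 * z * l + 12 * t))).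
Proof.
move=> hk hz ht hl T0 sT; have [k1|[k0 z0 t0 l0]] := indicator01 hk hz ht hl; last first.
  rewrite k0 z0 ?t0 ?l0.
  by rewrite le_eqVlt; apply/orP; left; apply/eqP; ring.
move: hz ht hl; rewrite k1 !mulr1 => /andP[z0 z1] /andP[t0 tN] lN.
have N0 : 0 <= N := le_trans t0 tN.
have h3 : z ^+ 2 * s ^+ 2 <= z ^+ 2 * (T * N).
  by rewrite ler_wpM2l ?sqr_ge0// (le_trans sT)// ler_wpM2l.
have hQ : `|4 * z * l + 12 * t| <= 16 * N.
  apply: le_trans (ler_normD _ _) _.
  have : `|4 * z * l| <= 4 * N.
    rewrite !normrM (ger0_norm z0) ger0_norm// -mulrA ler_pM2l//.
    by rewrite -[leRHS]mul1r ler_pM.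
  rewrite (@ger0_norm _ (12 * t)) ?mulr_ge0//; lra.
have h4 : u ^+ 2 * (4 * z * l + 12 * t) ^+ 2 <= u ^+ 2 * (16 * N) ^+ 2.
  by rewrite ler_wpM2l ?sqr_ge0//; apply: sq_le_of_norm => //; rewrite mulr_ge0.
rewrite -subr_ge0.
(* Completing squares: each cross term with d is absorbed by a quarter of (d z^2)^2, and the last
   two summands are the slack in the bounds for s and for the Laplacian of z^4. *)
rewrite (_ : _ - _ = (2^-1 * z ^+ 2 * d + 8 * z * s) ^+ 2 +
   (2^-1 * z ^+ 2 * d + u * (4 * z * l + 12 * t)) ^+ 2 +
   64 * (z ^+ 2 * (T * N) - z ^+ 2 * s ^+ 2) +
   (u ^+ 2 * (16 * N) ^+ 2 - u ^+ 2 * (4 * z * l + 12 * t) ^+ 2)); last by field.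
apply: addr_ge0; last by rewrite subr_ge0.
apply: addr_ge0; last by rewrite mulr_ge0// subr_ge0.
by rewrite addr_ge0// sqr_ge0.
Qed.

(* The right-hand side integrates to 0. The weight 1/(512 N) of the Laplacian term
   lets caccioppoli_absorb close the loop with caccioppoli_pointwise. *)
Lemma gradient_pointwise d z s T t l u N k : 0 < N -> k = 0 \/ k = 1 -> 0 <= z <= k ->
  0 <= t <= N * k -> `|l| <= N * k -> 0 <= T -> s ^+ 2 <= T * t ->
  2^-1 * (T * z ^+ 2) + - (512 * N)^-1 * (d * z ^+ 2) ^+ 2 + - (130 * N) * (u * k) ^+ 2 <=
  T * z ^+ 2 + u * (2 * z * s) + d * (u * z ^+ 2).
Proof.
move=> N0 hk hz ht hl T0 sT; have [k1|[k0 z0 t0 l0]] := indicator01 hk hz ht hl; last first.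
  rewrite k0 z0 ?t0 ?l0.
  by rewrite le_eqVlt; apply/orP; left; apply/eqP; ring.
move: hz ht hl; rewrite k1 !mulr1 => /andP[z0 z1] /andP[t0 tN] lN.
have [N0' Nn] := (ltW N0, lt0r_neq0 N0).
have X0 : 0 <= 2^-1 * (T * z ^+ 2) + 2 * N * u ^+ 2.
  apply: addr_ge0; apply: mulr_ge0; rewrite ?sqr_ge0 ?invr_ge0//; apply: mulr_ge0 => //.
  exact: sqr_ge0.
have h : `|u * (2 * z * s)| <= 2^-1 * (T * z ^+ 2) + 2 * N * u ^+ 2.
  rewrite -ler_sqr ?nnegrE// real_normK ?num_real//.
  apply: (@le_trans _ _ (4 * u ^+ 2 * (z ^+ 2 * (T * N)))).
    rewrite (_ : (u * _) ^+ 2 = 4 * u ^+ 2 * (z ^+ 2 * s ^+ 2)); last by ring.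
    apply: ler_wpM2l; first by rewrite mulr_ge0 ?sqr_ge0.
    by apply: ler_wpM2l; rewrite ?sqr_ge0// (le_trans sT)// ler_wpM2l.
  rewrite -subr_ge0 (_ : _ - _ = (2^-1 * (T * z ^+ 2) - 2 * N * u ^+ 2) ^+ 2) ?sqr_ge0//.
  by field.
have h' : 0 <= u * (2 * z * s) + (2^-1 * (T * z ^+ 2) + 2 * N * u ^+ 2).
  by move: h; rewrite ler_norml => /andP[h _]; rewrite -lerBlDr sub0r.
rewrite -subr_ge0 (_ : _ - _ = (u * (2 * z * s) + (2^-1 * (T * z ^+ 2) + 2 * N * u ^+ 2)) +
   (512 * N)^-1 * (d * z ^+ 2 + 256 * N * u) ^+ 2); last by field.
apply: (addr_ge0 h'); apply: mulr_ge0; last exact: sqr_ge0.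
by rewrite invr_ge0; apply: mulr_ge0; [exact: ler0n|exact: N0'].
Qed.

(** The left-hand side is the squared Laplacian of u z^2, split by (a + b + c)^2 <= 3 (a^2 + b^2 +
    c^2). *)
Lemma positivity_pointwise d z s T t l u N k : k = 0 \/ k = 1 -> 0 <= z <= k ->
  0 <= t <= N * k -> `|l| <= N * k -> 0 <= T -> s ^+ 2 <= T * t ->
  (d * z ^+ 2 + 2 * (2 * z * s) + u * (2 * z * l + 2 * t)) ^+ 2 <=
  3 * (d * z ^+ 2) ^+ 2 + (48 * N) * (T * z ^+ 2) + (48 * N ^+ 2) * (u * k) ^+ 2.
Proof.
move=> hk hz ht hl T0 sT; have [k1|[k0 z0 t0 l0]] := indicator01 hk hz ht hl; last first.
  rewrite k0 z0 ?t0 ?l0.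
  by rewrite le_eqVlt; apply/orP; left; apply/eqP; ring.
move: hz ht hl; rewrite k1 !mulr1 => /andP[z0 z1] /andP[t0 tN] lN.
have N0 : 0 <= N := le_trans t0 tN.
have h3 : z ^+ 2 * s ^+ 2 <= z ^+ 2 * (T * N).
  by rewrite ler_wpM2l ?sqr_ge0// (le_trans sT)// ler_wpM2l.
have hQ : `|2 * z * l + 2 * t| <= 4 * N.
  apply: le_trans (ler_normD _ _) _.
  have : `|2 * z * l| <= 2 * N.
    rewrite !normrM (ger0_norm z0) ger0_norm// -mulrA ler_pM2l//.
    by rewrite -[leRHS]mul1r ler_pM.
  rewrite (@ger0_norm _ (2 * t)) ?mulr_ge0//; lra.
have h4 : u ^+ 2 * (2 * z * l + 2 * t) ^+ 2 <= u ^+ 2 * (4 * N) ^+ 2.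
  by rewrite ler_wpM2l ?sqr_ge0//; apply: sq_le_of_norm => //; rewrite mulr_ge0.
rewrite -subr_ge0.
set a := d * z ^+ 2; set c := u * (2 * z * l + 2 * t).
rewrite (_ : _ - _ = (a - 4 * z * s) ^+ 2 + (a - c) ^+ 2 + (4 * z * s - c) ^+ 2 +
   48 * (z ^+ 2 * (T * N) - z ^+ 2 * s ^+ 2) +
   3 * (u ^+ 2 * (4 * N) ^+ 2 - u ^+ 2 * (2 * z * l + 2 * t) ^+ 2)); last by rewrite /a /c; ring.
apply: addr_ge0; last by rewrite mulr_ge0// subr_ge0.
apply: addr_ge0; last by rewrite mulr_ge0// subr_ge0.
by rewrite !addr_ge0// sqr_ge0.
Qed.

(** F, G and I stand for the integrals of (D zeta^2)^2, of the squared gradient of u times zeta^2,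
    and of u^2. The constant 500 * 500 rounds up 3 * 256 * 264 + 48 * 524 + 48. *)
Lemma caccioppoli_absorb (F G I N : R) : 0 < N -> 0 <= I ->
  2^-1 * F + - (64 * N) * G + - (256 * N ^+ 2) * I <= 0 ->
  2^-1 * G + - (512 * N)^-1 * F + - (130 * N) * I <= 0 ->
  [/\ F <= (256 * 264) * N ^+ 2 * I, G <= 524 * N * I &
      3 * F + (48 * N) * G + (48 * N ^+ 2) * I <= (500 * 500) * N ^+ 2 * I].
Proof.
move=> N0 I0 h1 h2; have Nn := lt0r_neq0 N0.
(* With the factor 128 N, adding the second inequality to the first cancels G and leaves F / 4. *)
have h3 : 128 * N * (2^-1 * G + - (512 * N)^-1 * F + - (130 * N) * I) <= 0.
  by rewrite pmulr_rle0// mulr_gt0.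
have E : 128 * N * (2^-1 * G + - (512 * N)^-1 * F + - (130 * N) * I) =
   64 * N * G - 4^-1 * F - (64 * 260) * (N ^+ 2 * I) by field.
rewrite E in h3.
have aux (P Q : R) : 0 <= Q -> 2^-1 * F - 64 * P - 256 * Q <= 0 ->
    64 * P - 4^-1 * F - 64 * 260 * Q <= 0 ->
    [/\ F <= 256 * 264 * Q, P <= 524 * Q & 3 * F + 48 * P + 48 * Q <= (500 * 500) * Q].
  by move=> Q0 h4 h5; split; lra.
have [] := aux (N * G) (N ^+ 2 * I).
- by rewrite mulr_ge0// sqr_ge0.
- by move: h1; congr (_ <= 0); ring.
- by move: h3; congr (_ <= 0); ring.
move=> hF hG hV; split; first by rewrite -mulrA.
  by rewrite -(ler_pM2l N0); move: hG; congr (_ <= _); ring.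
by move: hV; congr (_ <= _); ring.
Qed.

End pointwise_estimates.

(** * The Caccioppoli inequalities for a minimizer *)

Section minimizer_caccioppoli.
Context {R : realType} {n : nat}.
Local Notation V := 'rV[R]_n.
Local Notation leb := (@lebesgue_row R n).
Implicit Types (K : set V) (f g h v w phi eta : V -> R) (i j : 'I_n).

Lemma partial_sq f i : smooth f ->
  partial i (fun x => f x ^+ 2) = (fun x => 2 * (f x * partial i f x)).
Proof.
move=> sf; under eq_fun do rewrite expr2.
by rewrite partialM//; apply/funext => x; ring.
Qed.

Lemma laplacian_sq f x : smooth f ->
  \sum_i partial i (partial i (fun x => f x ^+ 2)) x =
  2 * f x * (\sum_i partial i (partial i f) x) + 2 * \sum_i partial i f x ^+ 2.
Proof.
move=> sf; rewrite !mulr_sumr -big_split/=; apply: eq_bigr => i _.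
rewrite partial_sq// partialZ; last by apply: smoothM => //; exact: smooth_partial.
by rewrite partialM//; [ring|exact: smooth_partial].
Qed.

Lemma lap_mul_square u (u1 : 'I_n -> V -> R) (u2 : 'I_n -> 'I_n -> V -> R) f x : smooth f ->
  lap_mul u u1 u2 (fun x => f x ^+ 2) x = lap u2 x * f x ^+ 2 +
    2 * (2 * f x * \sum_i u1 i x * partial i f x) +
    u x * (2 * f x * (\sum_i partial i (partial i f) x) + 2 * \sum_i partial i f x ^+ 2).
Proof.
move=> sf; rewrite /lap_mul laplacian_sq//; congr (_ + _ * _ + _).
by rewrite mulr_sumr; apply: eq_bigr => i _; rewrite partial_sq//; ring.
Qed.

Lemma lap_mul_fourth u (u1 : 'I_n -> V -> R) (u2 : 'I_n -> 'I_n -> V -> R) f x : smooth f ->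
  lap_mul u u1 u2 (fun x => (f x ^+ 2) ^+ 2) x = lap u2 x * (f x ^+ 2) ^+ 2 +
    2 * (4 * f x ^+ 3 * \sum_i u1 i x * partial i f x) +
    u x * (f x ^+ 2 * (4 * f x * (\sum_i partial i (partial i f) x) +
       12 * \sum_i partial i f x ^+ 2)).
Proof.
move=> sf; rewrite (lap_mul_square _ _ _ _ (smoothX 2 sf)) laplacian_sq//.
have -> : \sum_i u1 i x * partial i (fun x => f x ^+ 2) x =
    2 * f x * \sum_i u1 i x * partial i f x.
  by rewrite mulr_sumr; apply: eq_bigr => i _; rewrite partial_sq//; ring.
have -> : \sum_i partial i (fun x => f x ^+ 2) x ^+ 2 = 4 * f x ^+ 2 * \sum_i partial i f x ^+ 2.
  by rewrite mulr_sumr; apply: eq_bigr => i _; rewrite partial_sq//; ring.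
ring.
Qed.

Lemma compact_dist2 (x0 : V) (c : R) : compact [set x | dist2 x0 x <= c].
Proof.
apply: (@subclosed_compact _ _ (closed_box (\row_i (x0 ord0 i - (1 + `|c|)))
   (\row_i (x0 ord0 i + (1 + `|c|))))).
- have /continuous_closedP := smooth_continuous (smooth_dist2 x0).
  by move=> /(_ _ (@closed_le R c)).
- exact: compact_closed_box.
- move=> x /= xc; apply/closed_boxP => i; rewrite !mxE.
  suff : `|x ord0 i - x0 ord0 i| <= 1 + `|c|.
    by rewrite ler_norml => /andP[h1 h2]; apply/andP; split; lra.
  have c1 : 0 <= 1 + `|c| by rewrite addr_ge0.
  rewrite -ler_sqr ?nnegrE// real_normK ?num_real//.
  apply: (@le_trans _ _ (dist2 x0 x)).
    by rewrite /dist2 (bigD1 i)//= lerDl sumr_ge0// => j _; exact: sqr_ge0.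
  apply: (le_trans xc); apply: le_trans (ler_norm _) _.
  by rewrite sqrrD expr1n mul1r mulr2n; have := sqr_ge0 `|c|; have := normr_ge0 c; lra.
Qed.

Lemma Rintegral_sum d (T : measurableType d) (m : {measure set T -> \bar R}) (D : set T)
    (I : Type) (s : seq I) (F : I -> T -> R) : measurable D ->
  (forall k, m.-integrable D (EFin \o F k)) ->
  m.-integrable D (EFin \o (fun x => \sum_(k <- s) F k x)) /\
  \int[m]_(x in D) (\sum_(k <- s) F k x) = \sum_(k <- s) \int[m]_(x in D) F k x.
Proof.
move=> mD Fi; elim: s => [|k s [IH1 IH2]].
  rewrite big_nil; split; last by apply: Rintegral_le0_eq0 => // x _; rewrite big_nil.
  by under eq_fun do rewrite big_nil; exact: integrable0.
split.
  by under eq_fun do rewrite big_cons; exact: integrable_add.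
under eq_Rintegral do rewrite big_cons.
by rewrite RintegralD// big_cons IH2.
Qed.

Context (Omega : set V) (oO : open Omega) (bO : bounded_set Omega).
Context (u0 u : V -> R) (u1 : 'I_n -> V -> R) (u2 : 'I_n -> 'I_n -> V -> R).
Context (umin : minimizer Omega u0 u) (uW : W22 Omega u u1 u2).

Let mO : measurable Omega := open_measurable_row oO.

(** The fourth power of zeta is chosen because its first derivatives keep a factor zeta^3 and its
    second derivatives a factor zeta^2: each term containing D then contains D zeta^2, which is
    absorbed on the left. *)
Lemma caccioppoli (x0 : V) (a N : R) (zeta := radial bump x0 a)
    (kappa := fun x : V => (a * dist2 x0 x <= 2^-1)%R%:R : R)
    (I := \int[leb]_(x in Omega) ((u x * kappa x) ^+ 2)) :
  0 < a -> 0 < N -> [set x | a * dist2 x0 x <= 2^-1] `<=` Omega ->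
  (forall x, \sum_i partial i zeta x ^+ 2 <= N * kappa x) ->
  (forall x, `|\sum_i partial i (partial i zeta) x| <= N * kappa x) ->
  [/\ \int[leb]_(x in Omega) ((lap u2 x * zeta x ^+ 2) ^+ 2) <= (256 * 264) * N ^+ 2 * I,
      \int[leb]_(x in Omega) (\sum_i (u1 i x * zeta x) ^+ 2) <= 524 * N * I &
      volume (positivity_set Omega u `&` [set x | a * dist2 x0 x <= 4^-1]) <=
        (500 * 500) * N ^+ 2 * I].
Proof.
move=> a0 N0 BO zN lN.
have sz : smooth zeta by apply: smooth_radial; exact: smooth1_bump.
set B := [set x | a * dist2 x0 x <= 2^-1] in BO.
have cBc c : compact [set x | a * dist2 x0 x <= c].
  rewrite (_ : [set x | _] = [set x | dist2 x0 x <= a^-1 * c]); first exact: compact_dist2.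
  by apply/seteqP; split => x; rewrite /= ler_pdivlMl.
have cB : compact B := cBc _.
have z0 x : ~ B x -> zeta x = 0.
  by move=> /negP; rewrite -ltNge => /ltW; exact: bump_eq0.
have z01 x : 0 <= zeta x <= 1 by exact: bump_itv.
have kP x : kappa x = 0 \/ kappa x = 1 by rewrite /kappa; case: (_ <= _); [right|left].
have zk x : 0 <= zeta x <= kappa x.
  have := z01 x; rewrite /kappa; case: (boolP (a * dist2 x0 x <= 2^-1)) => [//|/negP Bx].
  by rewrite (z0 _ Bx) lexx.
have tz : test_function Omega zeta by split => //; exists B.
have mz : measurable_fun Omega zeta.
  by apply: measurable_funS (test_function_measurable tz).
have zb x : `|zeta x| <= 1 by have /andP[? ?] := z01 x; rewrite ger0_norm.
have mk : measurable_fun Omega kappa.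
  rewrite (_ : kappa = \1_B); first by apply: measurable_indic; exact: compact_measurable_row.
  apply/funext => x; rewrite indicE /kappa; congr (_%:R); congr nat_of_bool.
  by apply/idP/idP; rewrite inE.
have [hu hu1 _ _ _] := uW; have hD : sq_integrable leb Omega (lap u2) := lap_sq oO uW.
pose Fx x := (lap u2 x * zeta x ^+ 2) ^+ 2.
pose Gx x := \sum_i (u1 i x * zeta x) ^+ 2.
pose Ix x := (u x * kappa x) ^+ 2.
have hDz2 : sq_integrable leb Omega (fun x => lap u2 x * zeta x ^+ 2).
  apply: (sq_integrable_bounded (M := 1)) => //; first exact: measurable_funX.
  by move=> x _; rewrite normrX exprn_ile1.
have huz i : sq_integrable leb Omega (fun x => u1 i x * zeta x).
  exact: (sq_integrable_bounded (M := 1)).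
have huk : sq_integrable leb Omega (fun x => u x * kappa x).
  apply: (sq_integrable_bounded (M := 1)) => // x _.
  by case: (kP x) => ->; rewrite ?normr0 ?normr1.
have Fi : leb.-integrable Omega (EFin \o Fx) by case: hDz2.
have [Gi _] : leb.-integrable Omega (EFin \o Gx) /\ _ :=
  Rintegral_sum (index_enum 'I_n) mO (fun i => proj2 (huz i)).
have Ii : leb.-integrable Omega (EFin \o Ix) by case: huk.
have GxE x : Gx x = (\sum_i u1 i x ^+ 2) * zeta x ^+ 2.
  by rewrite mulr_suml; apply: eq_bigr => i _; rewrite exprMn.
have t0 x : 0 <= \sum_i partial i zeta x ^+ 2 <= N * kappa x.
  by rewrite zN andbT sumr_ge0// => i _; exact: sqr_ge0.
have T0 x : 0 <= \sum_i u1 i x ^+ 2 by apply: sumr_ge0 => i _; exact: sqr_ge0.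
have sT x : (\sum_i u1 i x * partial i zeta x) ^+ 2 <=
    (\sum_i u1 i x ^+ 2) * \sum_i partial i zeta x ^+ 2 by exact: sum_cauchy_schwarz.
pose z2 := fun x => zeta x ^+ 2.
have sz2 : smooth z2 by exact: smoothX.
have tz2 : test_function Omega z2 by exact: (test_functionX 1 tz).
pose z4 := fun x => z2 x ^+ 2.
have tz4 : test_function Omega z4 by exact: (test_functionX 1 tz2).
have l2 x := lap_mul_square u u1 u2 x sz.
have l4 x := lap_mul_fourth u u1 u2 x sz.
(* From the Euler-Lagrange equation with eta = zeta^4. *)
have E1 : 2^-1 * \int[leb]_(x in Omega) Fx x + - (64 * N) * \int[leb]_(x in Omega) Gx x +
    - (256 * N ^+ 2) * \int[leb]_(x in Omega) Ix x <= 0.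
  rewrite -Rintegral_lin3// -(euler_lagrange oO bO umin uW tz4).
  apply: le_Rintegral => //.
  - by apply: integrable_add => //; [apply: integrable_add => //|]; exact: integrable_scale.
  - by apply: sq_integrableM => //; exact: (lap_mul_sq oO uW).
  - by move=> x _; rewrite l4 GxE; exact: caccioppoli_pointwise.
(* From integrating the gradient of u by parts against that of u zeta^2, which produces - D u
   zeta^2. *)
have E2 : 2^-1 * \int[leb]_(x in Omega) Gx x + - (512 * N)^-1 * \int[leb]_(x in Omega) Fx x +
    - (130 * N) * \int[leb]_(x in Omega) Ix x <= 0.
  have z20 x : ~ B x -> z2 x = 0 by move=> /z0; rewrite /z2 => ->; rewrite expr0n.
  have [hw hw1] := W1_hess_mul oO uW cB BO sz2 z20.
  pose w1 i x := u1 i x * z2 x + u x * partial i z2 x.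
  have [hwT _ hw1T] := hw.
  have hwO : sq_integrable leb Omega (fun x => u x * z2 x) by exact: sq_integrableS hwT.
  have hw1O i : sq_integrable leb Omega (w1 i).
    by have [h _ _] := hw1T i; exact: sq_integrableS h.
  have [_ _ hu2 _ d2] := uW.
  have ibp i := integration_by_parts oO (hu1 i) (hu2 i i) (d2 i i) cB BO hw hw1.
  have [S1 S2] := Rintegral_sum (index_enum 'I_n) mO (fun i => sq_integrableM mO (hu1 i) (hw1O i)).
  have [S3 S4] := Rintegral_sum (index_enum 'I_n) mO (fun i => sq_integrableM mO (hu2 i i) hwO).
  have E : \int[leb]_(x in Omega) ((\sum_i u1 i x * w1 i x) + \sum_i u2 i i x * (u x * z2 x)) = 0.
    rewrite RintegralD// S2 S4 -big_split big1//= => i _.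
    by rewrite ibp addNr.
  rewrite -Rintegral_lin3// -[leRHS]E; apply: le_Rintegral => //.
  - by apply: integrable_add => //; [apply: integrable_add => //|]; exact: integrable_scale.
  - exact: integrable_add.
  - move=> x _; rewrite -mulr_suml -/(lap u2 x).
    have -> : \sum_i u1 i x * w1 i x = (\sum_i u1 i x ^+ 2) * zeta x ^+ 2 +
        u x * (2 * zeta x * \sum_i u1 i x * partial i zeta x).
      rewrite mulr_suml !mulr_sumr -big_split; apply: eq_bigr => i _.
      by rewrite /w1 /z2 partial_sq//=; ring.
    by rewrite GxE; exact: gradient_pointwise.
have I0 : 0 <= I by apply: Rintegral_ge0 => x _; exact: sqr_ge0.
have [hF hG hV] := caccioppoli_absorb N0 I0 E1 E2; split => //; apply: le_trans hV.
have z21 x : 0 <= z2 x <= 1.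
  by have /andP[? ?] := z01 x; rewrite /z2 exprn_ge0//= exprn_ile1.
have mp := measurable_positivity_set oO (proj1 hu).
apply: (@le_trans _ _ (volume (positivity_set Omega u `&` [set x | z2 x = 1]))).
  have m1 : measurable [set x | z2 x = 1].
    rewrite -[X in measurable X]setTI.
    exact: (test_function_measurable tz2) measurableT _ (measurable_set1 1).
  have m4 : measurable [set x | a * dist2 x0 x <= 4^-1] := compact_measurable_row (cBc _).
  apply: fine_le.
  - by apply: (fin_measure oO bO); [exact: measurableI|move=> x [[]]].
  - by apply: (fin_measure oO bO); [exact: measurableI|move=> x [[]]].
  - apply: le_measure; rewrite ?inE; [exact: measurableI|exact: measurableI|].
    by move=> x [? /= x4]; split => //; rewrite /z2 /zeta /radial /= bump_eq1// expr1n.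
apply: le_trans (positivity_bound oO bO umin uW tz2 z21) _.
(* The volume is estimated with eta = zeta^2, which equals 1 where zeta does. *)
rewrite -Rintegral_lin3//; apply: le_Rintegral => //.
- by have [] := lap_mul_sq oO uW tz2.
- by apply: integrable_add => //; [apply: integrable_add => //|]; exact: integrable_scale.
- by move=> x _; rewrite l2 GxE; exact: positivity_pointwise.
Qed.

End minimizer_caccioppoli.

(** * Euclidean balls and their volumes *)

Section balls.
Context {R : realType} {n : nat}.
Local Notation V := 'rV[R]_n.
Local Notation leb := (@lebesgue_row R n).
Implicit Types (x : V).

(** The closed Euclidean ball when rho >= 0, written with squares to match [dist2]. *)
Definition cball (x0 : V) (rho : R) : set V := [set x | dist2 x0 x <= rho ^+ 2].

Lemma compact_cball x0 rho : compact (cball x0 rho).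
Proof. exact: compact_dist2. Qed.

Lemma measurable_cball x0 rho : measurable (cball x0 rho).
Proof. by apply: compact_measurable_row; exact: compact_cball. Qed.

Lemma cballS x0 rho s : 0 <= rho <= s -> cball x0 rho `<=` cball x0 s.
Proof.
move=> /andP[r0 rs] x /= xr; apply: le_trans xr _.
by rewrite ler_sqr ?nnegrE// (le_trans r0).
Qed.

Definition cube (x0 : V) (s : R) : set V := [set x | forall i, `|x ord0 i - x0 ord0 i| <= s].

Lemma lebesgue_cube (x0 : V) s : 0 <= s -> leb (cube x0 s) = ((2 * s) ^+ n)%:E.
Proof.
move=> s0; pose A i : set R := `[x0 ord0 i - s, x0 ord0 i + s]%classic.
rewrite [cube x0 s](_ : _ = [set x : V | forall i, A i (x ord0 i)]); last first.
  apply/seteqP; split => x h i; have := h i; rewrite /A /= in_itv/= ler_norml;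
    move=> /andP[h1 h2]; apply/andP; split; lra.
rewrite [LHS]lebesgue_row_box; last by move=> i; exact: measurable_itv.
rewrite (eq_bigr (fun=> (2 * s)%:E)).
  by rewrite prodEFin prodr_const card_ord.
move=> i _; rewrite lebesgue_measure_itv/= lte_fin.
case: ltP => h; first by rewrite -EFinB; congr EFin; ring.
by congr EFin; lra.
Qed.

Lemma lebesgue_cball_fin x0 rho : leb (cball x0 rho) \is a fin_num.
Proof. by rewrite ge0_fin_numE//; apply: lebesgue_row_compact; exact: compact_cball. Qed.

Let measurable_cube (x0 : V) s : measurable (cube x0 s).
Proof.
rewrite [cube x0 s](_ : _ = closed_box (\row_i (x0 ord0 i - s)) (\row_i (x0 ord0 i + s))).
  exact: measurable_closed_box.
apply/seteqP; split => x.
  move=> h; apply/closed_boxP => i; have := h i.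
  by rewrite !mxE ler_norml => /andP[h1 h2]; apply/andP; split; lra.
move=> /closed_boxP h i; have := h i; rewrite !mxE ler_norml => /andP[h1 h2].
by apply/andP; split; lra.
Qed.

Lemma volume_cball_le x0 rho : 0 <= rho -> volume (cball x0 rho) <= (2 * rho) ^+ n.
Proof.
move=> r0; rewrite -[leRHS]/(fine ((2 * rho) ^+ n)%:E) -(lebesgue_cube x0 r0).
apply: fine_le; [exact: lebesgue_cball_fin|by rewrite lebesgue_cube|].
apply: le_measure; rewrite ?inE; [exact: measurable_cball|exact: measurable_cube|].
move=> x xr i; rewrite -ler_sqr ?nnegrE// real_normK ?num_real//.
apply: le_trans xr; rewrite /dist2 (bigD1 i)//= lerDl.
by apply: sumr_ge0 => j _; exact: sqr_ge0.
Qed.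

(** The cube of half-side rho / n is inscribed, since n (rho / n)^2 <= rho^2. *)
Lemma volume_cball_ge x0 rho : (0 < n)%N -> 0 <= rho ->
  (2 * (rho / n%:R)) ^+ n <= volume (cball x0 rho).
Proof.
move=> n0 r0; have nR : 0 < n%:R :> R by rewrite ltr0n.
have s0 : 0 <= rho / n%:R by rewrite divr_ge0.
rewrite -[leLHS]/(fine ((2 * (rho / n%:R)) ^+ n)%:E) -(lebesgue_cube x0 s0).
apply: fine_le; [by rewrite lebesgue_cube|exact: lebesgue_cball_fin|].
apply: le_measure; rewrite ?inE; [exact: measurable_cube|exact: measurable_cball|].
move=> x h; rewrite /cball /= /dist2.
apply: (@le_trans _ _ (\sum_(i < n) (rho / n%:R) ^+ 2)).
  apply: ler_sum => i _; rewrite -[leLHS]real_normK ?num_real// ler_sqr ?nnegrE//.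
rewrite sumr_const card_ord -[leLHS]mulr_natl expr_div_n mulrCA ler_piMr ?sqr_ge0//.
rewrite -exprVn expr2 mulrA divff ?gt_eqF// mul1r invf_le1//.
by rewrite ler1n.
Qed.

Lemma eballE x0 rho x : 0 < rho -> eball x0 rho x <-> dist2 x0 x < rho ^+ 2.
Proof.
move=> r0; rewrite /eball /enorm /=.
have -> : \sum_i (x - x0) ord0 i ^+ 2 = dist2 x0 x by apply: eq_bigr => i _; rewrite !mxE.
by rewrite -[X in _ < X <-> _](ger0_norm (ltW r0)) -sqrtr_sqr ltr_sqrt// exprn_gt0.
Qed.

Lemma cball_eball x0 rho s : 0 <= rho -> rho < s -> cball x0 rho `<=` eball x0 s.
Proof.
move=> r0 rs x xr; apply/eballE; first exact: le_lt_trans rs.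
by apply: le_lt_trans xr _; rewrite ltr_sqr ?nnegrE// ltW// (le_lt_trans r0).
Qed.

Lemma eball_cball x0 rho : 0 < rho -> eball x0 rho `<=` cball x0 rho.
Proof. by move=> r0 x /(eballE _ _ r0)/ltW. Qed.

Lemma measurable_eball x0 rho : 0 < rho -> measurable (eball x0 rho).
Proof.
move=> r0.
have m := smooth_measurable (smooth_dist2 x0).
have := m measurableT `]-oo, rho ^+ 2[%classic (measurable_itv _).
congr (measurable _); rewrite setTI; apply/seteqP; split => x.
  by rewrite /= in_itv/= => h; apply/eballE.
by move=> /(eballE _ _ r0) h; rewrite /= in_itv.
Qed.

End balls.

Lemma Rintegral_subset_support d (T : measurableType d) (R : realType)
    (m : {measure set T -> \bar R}) (D E : set T) (f : T -> R) :
  D `<=` E -> (forall x, E x -> ~ D x -> f x = 0) ->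
  \int[m]_(x in E) f x = \int[m]_(x in D) f x.
Proof.
move=> DE f0; rewrite Rintegral_mkcond [RHS]Rintegral_mkcond; congr (Rintegral _ _ _).
apply/funext => x; rewrite !patchE; case: (boolP (x \in D)) => xD.
  by rewrite mem_set//; apply: DE; exact: set_mem.
case: ifP => // /set_mem xE; apply: f0 => // /mem_set xD'.
by rewrite xD' in xD.
Qed.

(** * The estimates in scale-invariant form *)

Section energy.
Context {R : realType} {n : nat}.
Local Notation V := 'rV[R]_n.
Local Notation leb := (@lebesgue_row R n).
Implicit Types (Omega : set V) (u : V -> R) (x : V).

Definition energy u (x0 : V) (rho : R) : R := \int[leb]_(x in cball x0 rho) (u x ^+ 2).

(** The scale 1 / (2 rho^2) makes it vanish off the ball of radius rho and equal 1 where [dist2] <=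
    rho^2 / 2. *)
Definition cutoff (x0 : V) (rho : R) : V -> R := radial bump x0 (2 * rho ^+ 2)^-1.

Definition minimizer_data Omega (u0 : V -> R) u (u1 : 'I_n -> V -> R) (u2 : 'I_n -> 'I_n -> V -> R) :=
  [/\ open Omega, bounded_set Omega, minimizer Omega u0 u & W22 Omega u u1 u2].

Let scale2 (rho q c : R) : 0 < rho -> ((2 * rho ^+ 2)^-1 * q <= c) = (q <= (2 * c) * rho ^+ 2).
Proof.
by move=> r0; rewrite ler_pdivrMl ?mulr_gt0 ?exprn_gt0// mulrAC.
Qed.

Lemma cutoff_eq1 (x0 : V) (rho : R) x : 0 < rho -> dist2 x0 x <= rho ^+ 2 / 2 -> cutoff x0 rho x = 1.
Proof.
move=> r0 xr; apply: bump_eq1; rewrite scale2//.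
by rewrite [leRHS](_ : _ = rho ^+ 2 / 2)//; field.
Qed.

Lemma cutoff_eq0 (x0 : V) (rho : R) x : 0 < rho -> ~ cball x0 rho x -> cutoff x0 rho x = 0.
Proof.
move=> r0 /negP; rewrite -ltNge => xr; apply: bump_eq0.
by apply: ltW; rewrite ltNge scale2// divff// mul1r -ltNge.
Qed.

Lemma cutoff_itv (x0 : V) (rho : R) x : 0 <= cutoff x0 rho x <= 1.
Proof. exact: bump_itv. Qed.

Lemma smooth_cutoff (x0 : V) (rho : R) : smooth (cutoff x0 rho).
Proof. by apply: smooth_radial; exact: smooth1_bump. Qed.

Let constants (M : R) : 0 < M -> exists2 K, 0 < K &
  [/\ (256 * 264) * M ^+ 2 <= 4 * K, (500 * 500) * M ^+ 2 <= 4 * K, 524 * M <= 2 * K & M <= 2 * K].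
Proof.
move=> M0; have H := sqr_ge0 M; exists ((500 * 500) * M ^+ 2 + 524 * M + M).
  by move: H; move: (M ^+ 2) => X X0; lra.
by move: H; move: (M ^+ 2) => X X0; split; lra.
Qed.

(** [caccioppoli] with N = M a and a = 1 / (2 rho^2): since a rho^2 = 1/2, all powers of rho cancel,
    with the factors 1/4 and 1/2 that appear in [constants]. *)
Lemma energy_estimates : exists2 K : R, 0 < K &
  forall Omega (u0 u : V -> R) (u1 : 'I_n -> V -> R) (u2 : 'I_n -> 'I_n -> V -> R) (x0 : V) (rho : R),
    minimizer_data Omega u0 u u1 u2 -> 0 < rho -> cball x0 rho `<=` Omega ->
  [/\ rho ^+ 4 * \int[leb]_(x in Omega) ((lap u2 x * cutoff x0 rho x ^+ 2) ^+ 2) <= K * energy u x0 rho,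
      rho ^+ 2 * \int[leb]_(x in Omega) (\sum_i (u1 i x * cutoff x0 rho x) ^+ 2) <= K * energy u x0 rho,
      rho ^+ 4 * volume (positivity_set Omega u `&` [set x | dist2 x0 x <= rho ^+ 2 / 2]) <=
        K * energy u x0 rho &
      forall x, rho ^+ 2 * \sum_i partial i (cutoff x0 rho) x ^+ 2 <= K].
Proof.
have [M M0 HM] := @radial_bounds R n bump smooth1_bump (fun t t2 => bump_eq0 (ltW t2)).
have [K K0 [c1 c2 c3 c4]] := constants M0.
exists K => // Omega u0 u u1 u2 x0 rho [oO bO umin uW] r0 cO.
pose a := (2 * rho ^+ 2)^-1.
have r2 : 0 < rho ^+ 2 by rewrite exprn_gt0.
have a0 : 0 < a by rewrite invr_gt0 mulr_gt0.
have N0 : 0 < M * a by rewrite mulr_gt0.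
have hB : [set x | a * dist2 x0 x <= 2^-1] = cball x0 rho.
  by apply/seteqP; split => x; rewrite /= scale2// divff ?mul1r.
have BO : [set x | a * dist2 x0 x <= 2^-1] `<=` Omega by rewrite hB.
have zN x : \sum_i partial i (radial bump x0 a) x ^+ 2 <= M * a * (a * dist2 x0 x <= 2^-1)%R%:R.
  by have [] := HM x0 a x a0.
have lN x : `|\sum_i partial i (partial i (radial bump x0 a)) x| <=
    M * a * (a * dist2 x0 x <= 2^-1)%R%:R by have [] := HM x0 a x a0.
have [F G H] := @caccioppoli R n Omega oO bO u0 u u1 u2 umin uW x0 a (M * a) a0 N0 BO zN lN.
have EI : \int[leb]_(x in Omega) ((u x * ((a * dist2 x0 x <= 2^-1)%R%:R : R)) ^+ 2) = energy u x0 rho.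
  rewrite (@Rintegral_subset_support _ _ _ _ (cball x0 rho))//.
    by apply: eq_Rintegral => x /set_mem; rewrite -hB /= => ->; rewrite mulr1.
  by move=> x _; rewrite -hB /= => /negP/negbTE ->; rewrite mulr0 expr0n.
rewrite EI in F G H; set E := energy u x0 rho in F G H *.
have E0 : 0 <= E by apply: Rintegral_ge0 => x _; exact: sqr_ge0.
have ar : a * rho ^+ 2 = 2^-1 by rewrite /a; field; rewrite gt_eqF.
have fin c (X : R) : c * M ^+ 2 <= 4 * K -> X <= c * (M * a) ^+ 2 * E -> rho ^+ 4 * X <= K * E.
  move=> cK XE; apply: (@le_trans _ _ (rho ^+ 4 * (c * (M * a) ^+ 2 * E))).
    by rewrite ler_wpM2l// exprn_ge0// ltW.
  rewrite [leLHS](_ : _ = (c * M ^+ 2 * (a * rho ^+ 2) ^+ 2) * E); last by ring.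
  rewrite ler_wpM2r// ar exprVn ler_pdivrMr ?exprn_gt0//.
  by rewrite [leRHS]mulrC (_ : 2 ^+ 2 = 4 :> R)//; ring.
split.
- exact: fin c1 F.
- apply: (@le_trans _ _ (rho ^+ 2 * (524 * (M * a) * E))); first by rewrite ler_wpM2l// ltW.
  rewrite [leLHS](_ : _ = 524 * M * (a * rho ^+ 2) * E); last by ring.
  by rewrite ler_wpM2r// ar ler_pdivrMr// [leRHS]mulrC.
- have H' : volume (positivity_set Omega u `&` [set x | dist2 x0 x <= rho ^+ 2 / 2]) <=
      500 * 500 * (M * a) ^+ 2 * E.
    move: H; congr (volume (_ `&` _) <= _); apply/seteqP; split => x /=; rewrite scale2//;
      by rewrite (_ : 2 / 4 * _ = rho ^+ 2 / 2)//; field.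
  exact: fin c2 H'.
- move=> x; have [_ h _] := HM x0 a x a0.
  apply: (@le_trans _ _ (rho ^+ 2 * (M * a))).
    rewrite ler_wpM2l ?(ltW r2)//; apply: le_trans h _.
    by rewrite ger_pMr//; case: (a * dist2 x0 x <= 2^-1).
  rewrite [leLHS](_ : _ = M * (a * rho ^+ 2)); last by ring.
  by rewrite ar ler_pdivrMr// mulrC.
Qed.

End energy.

(** * Means of the minimizer *)

Section scaled_kernels.
Context {R : realType} {n : nat}.
Local Notation V := 'rV[R]_n.
Local Notation leb := (@lebesgue_row R n).
Implicit Types (Omega : set V) (S : R -> R) (x : V) (rho : R).

(** Normalized so that its integral would not depend on rho: integration against it is a weighted
    mean over the ball. *)
Definition scaled S (x0 : V) rho x : R := rho^-1 ^+ n * radial S x0 (rho^-1 ^+ 2) x.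

(* The rho-derivative of [scaled (dkernel S) x0 rho] is rho times the Laplacian
   of [scaled S x0 rho], see is_derive_scaled; testing against both kernels turns
   information on the Laplacian of u into a differential inequality in rho. *)
Definition dkernel S : R -> R := fun t => - 2 * derive1 S t.

Lemma smooth1_dkernel S : smooth1 S -> smooth1 (dkernel S).
Proof. by move=> sS; apply: CinfZ; exact: smooth1_derive. Qed.

Lemma is_derive_inv_exp m (t : R) : t != 0 ->
  is_derive t 1 (fun s : R => s^-1 ^+ m) (- m%:R * t^-1 ^+ m.+1).
Proof.
move=> tn0.
have dV : is_derive (t : R) 1 (fun x : R => x^-1) (- t ^- 2).
  apply: DeriveDef; first exact: derivableV.
  by rewrite deriveV// derive_id scaler1.
have dX := is_deriveX m dV.
rewrite (_ : (fun s : R => s^-1 ^+ m) = [eta GRing.inv] ^+ m); last by rewrite exprfctE.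
apply: is_derive_eq; rewrite -[LHS]/(m%:R * t^-1 ^+ m.-1 * - t ^- 2).
rewrite -[t ^- 2]exprVn; case: m {dX} => [|m] /=; last by rewrite !exprS; ring.
by ring.
Qed.

Lemma smooth_scaled S x0 rho : smooth1 S -> smooth (scaled S x0 rho).
Proof. by move=> sS; apply: smoothZ; exact: smooth_radial. Qed.

Lemma laplacian_scaled S x0 rho x : smooth1 S ->
  \sum_i partial i (partial i (scaled S x0 rho)) x =
  rho^-1 ^+ n * \sum_i partial i (partial i (radial S x0 (rho^-1 ^+ 2))) x.
Proof.
move=> sS; have sr : smooth (radial S x0 (rho^-1 ^+ 2)) by exact: smooth_radial.
rewrite mulr_sumr; apply: eq_bigr => i _; rewrite /scaled partialZ//.
by rewrite partialZ//; exact: smooth_partial.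
Qed.

Let derive_identity (rho q A B : R) : rho != 0 ->
  rho^-1 ^+ n * (- 2 * A * (- 2 * rho^-1 ^+ 3 * (rho ^+ 2 * q))) +
    - 2 * B * (- n%:R * rho^-1 ^+ n.+1) =
  rho * (rho^-1 ^+ n * (rho^-1 ^+ 2 * (4 * q * A + 2 * n%:R * B))).
Proof. by move=> r0; rewrite [rho^-1 ^+ n.+1]exprS; move: (rho^-1 ^+ n) => w; field. Qed.

Lemma is_derive_scaled S x0 rho x : smooth1 S -> rho != 0 ->
  is_derive rho 1 (fun r => scaled (dkernel S) x0 r x)
    (rho * \sum_i partial i (partial i (scaled S x0 rho)) x).
Proof.
move=> sS r0; have d1 := is_derive_inv_exp n r0.
have d2 : is_derive rho 1 (fun s : R => s^-1 ^+ 2 * dist2 x0 x)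
    (- 2%:R * rho^-1 ^+ 3 * dist2 x0 x).
  have := is_deriveM (is_derive_inv_exp 2 r0) (is_derive_cst (dist2 x0 x) rho 1).
  by rewrite scaler0 add0r [_ *: _]mulrC.
have d3 := @is_derive_dir_comp R R (dkernel S) (fun s : R => s^-1 ^+ 2 * dist2 x0 x) rho 1 _ _
  (smooth1_is_derive (rho^-1 ^+ 2 * dist2 x0 x) (smooth1_dkernel sS)) d2.
have d4 := is_deriveM d1 d3; refine (is_derive_eq d4 _).
rewrite laplacian_scaled// laplacian_radial// /radial /dkernel.
have sS1 := smooth1_derive sS.
have -> : derive1 (fun t => - 2 * derive1 S t) (rho^-1 ^+ 2 * dist2 x0 x) =
   - 2 * derive1 (derive1 S) (rho^-1 ^+ 2 * dist2 x0 x).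
  rewrite derive1E deriveZ; last by have [] := smooth1_is_derive (rho^-1 ^+ 2 * dist2 x0 x) sS1.
  by rewrite -derive1E.
rewrite -![_ *: _]/(_ * _) /=.
set q := rho^-1 ^+ 2 * dist2 x0 x; set A := derive1 _ q; set B := derive1 _ q.
have -> : dist2 x0 x = rho ^+ 2 * q by rewrite /q; field.
exact: derive_identity.
Qed.

(** With the threshold 1/2, [scaled S x0 rho] lives where [cutoff x0 rho] equals 1. *)
Definition vanishes S := forall t, 2^-1 < t -> S t = 0.

Lemma vanishes_dkernel S : vanishes S -> vanishes (dkernel S).
Proof. by move=> S0 t t2; rewrite /dkernel (derive1_eq0 S0)// mulr0. Qed.

Lemma scaled_out S x0 rho x : vanishes S -> 0 < rho -> rho ^+ 2 / 2 < dist2 x0 x ->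
  scaled S x0 rho x = 0.
Proof.
move=> S0 r0 xr; rewrite /scaled /radial S0 ?mulr0//.
by rewrite exprVn ltr_pdivlMl// exprn_gt0.
Qed.

Lemma test_function_scaled Omega S x0 rho : smooth1 S -> vanishes S -> 0 < rho ->
  cball x0 rho `<=` Omega -> test_function Omega (scaled S x0 rho).
Proof.
move=> sS S0 r0 cO; split; first exact: smooth_scaled.
exists (cball x0 rho); split => //; first exact: compact_cball.
move=> x /negP; rewrite -ltNge => xr; apply: scaled_out => //.
by apply: le_lt_trans xr; rewrite ler_pdivrMr// ler_peMr ?sqr_ge0// ler1n.
Qed.

Lemma scaled_bounds S : smooth1 S -> vanishes S -> exists2 M, 0 < M &
  forall x0 rho x, 0 < rho ->
    `|scaled S x0 rho x| <= M * rho^-1 ^+ n /\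
    `|rho * \sum_i partial i (partial i (scaled S x0 rho)) x| <= M * rho^-1 ^+ n.+1.
Proof.
move=> sS S0; have [M M0 HM] := @radial_bounds R n S sS S0.
exists M => // x0 rho x r0; have a0 : 0 < rho^-1 ^+ 2 by rewrite exprn_gt0// invr_gt0.
have w0 m : 0 < rho^-1 ^+ m by rewrite exprn_gt0// invr_gt0.
have ind (b : bool) (c : R) : 0 < c -> c * b%:R <= c by move=> c0; rewrite ger_pMr//; case: b.
have [h1 _ h2] := HM x0 _ x a0; split.
  rewrite /scaled normrM gtr0_norm// mulrC ler_pM2r//.
  by apply: le_trans h1 _; exact: ind.
rewrite laplacian_scaled// normrM (gtr0_norm r0) normrM (gtr0_norm (w0 n)).
have E : M * rho^-1 ^+ n.+1 = rho * (rho^-1 ^+ n * (M * rho^-1 ^+ 2)).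
  by rewrite exprS; move: (rho^-1 ^+ n) => w; field; rewrite gt_eqF.
rewrite E ler_pM2l// ler_pM2l//; apply: le_trans h2 _; apply: ind.
by rewrite mulr_gt0.
Qed.

(** Differentiation under the integral; dominated because [scaled_bounds] is uniform as long as the
    radius stays away from 0. *)
Lemma is_derive_scaled_integral (D : set V) f S x0 rho : measurable D ->
  leb.-integrable D (EFin \o f) -> smooth1 S -> vanishes S -> 0 < rho ->
  is_derive rho 1 (fun r => \int[leb]_(x in D) (f x * scaled (dkernel S) x0 r x))
    (rho * \int[leb]_(x in D) (f x * \sum_i partial i (partial i (scaled S x0 rho)) x)).
Proof.
move=> mD fi sS S0 r0.
have [M M0 HM] := scaled_bounds sS S0.
have [M' M'0 HM'] := scaled_bounds (smooth1_dkernel sS) (vanishes_dkernel S0).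
pose L r x := \sum_i partial i (partial i (scaled S x0 r)) x.
have mL r : measurable_fun D (L r).
  apply: measurable_sum => i; apply: (@measurable_funS _ _ _ _ setT) => //.
  by apply: smooth_measurable; do 2! apply: smooth_partial; exact: smooth_scaled.
pose F (r : R) (x : V) := f x * scaled (dkernel S) x0 r x.
(* Radii above rho / 2 keep the negative powers of the radius bounded. *)
have Ia : `]rho / 2, rho + 1[%classic rho.
  by rewrite /= in_itv/= ltrDl ltr01 ltr_pdivrMr// ltr_pMr// ltr1n.
have pos (r : R) : `]rho / 2, rho + 1[%classic r -> 0 < r /\ rho / 2 < r.
  by rewrite /= in_itv/= => /andP[h _]; split => //; apply: lt_trans h; rewrite divr_gt0.
have dF (r : R) x : 0 < r -> is_derive r 1 (F ^~ x) (f x * (r * L r x)).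
  move=> r1; have := is_deriveM (is_derive_cst (f x) r 1) (is_derive_scaled x0 x sS (lt0r_neq0 r1)).
  by rewrite -[X in is_derive _ _ _ X]/(f x * (r * L r x) + _ * 0) mulr0 addr0.
have Fi (r : R) : `]rho / 2, rho + 1[%classic r -> leb.-integrable D (EFin \o F r).
  move=> /pos[r1 _]; apply: (integrable_bounded_mul (M := M' * r^-1 ^+ n)) => //.
    apply: (@measurable_funS _ _ _ _ setT) => //; apply: smooth_measurable.
    by apply: smooth_scaled; exact: smooth1_dkernel.
  by move=> x _; have [] := HM' x0 r x r1.
have dFE (r : R) x : 0 < r -> partial1of2 F r x = f x * (r * L r x).
  by move=> r1; rewrite partial1of2E; have [_ ->] := dF r x r1.
have der (r : R) x : `]rho / 2, rho + 1[%classic r -> D x -> derivable (F ^~ x) r 1.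
  by move=> /pos[r1 _] _; have [] := dF r x r1.
pose G x := M * (rho / 2)^-1 ^+ n.+1 * `|f x|.
have c0 : 0 <= M * (rho / 2)^-1 ^+ n.+1 by rewrite mulr_ge0 ?exprn_ge0 ?invr_ge0 ?divr_ge0// ltW.
have G0 x : 0 <= G x by rewrite mulr_ge0.
have Gi : leb.-integrable D (EFin \o G).
  by apply: integrable_scale => //; exact: integrable_norm.
have Gub (r : R) x : `]rho / 2, rho + 1[%classic r -> D x -> `|partial1of2 F r x| <= G x.
  move=> /pos[r1 r2] _; rewrite dFE// normrM mulrC ler_wpM2r//.
  have [_ h] := HM x0 r x r1; apply: le_trans h _.
  rewrite ler_wpM2l ?(ltW M0)// lerXn2r ?nnegrE ?invr_ge0 ?divr_ge0 ?(ltW r0) ?(ltW r1)//.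
  by rewrite lef_pV2 ?posrE ?divr_gt0// ltW.
have cv := @cvg_differentiation_under_integral R _ V leb F D mD rho (rho / 2) (rho + 1)
  Ia Fi der G G0 Gi Gub.
have E : \int[leb]_(x in D) partial1of2 F rho x = rho * \int[leb]_(x in D) (f x * L rho x).
  rewrite -RintegralZl//; last first.
    apply: (integrable_bounded_mul (M := rho^-1 * (M * rho^-1 ^+ n.+1))) => // x _.
    have [_] := HM x0 rho x r0; rewrite normrM gtr0_norm// => h.
    by rewrite ler_pdivlMl.
  by apply: eq_Rintegral => x _; rewrite dFE// mulrCA.
rewrite E in cv.
have E2 : (fun h : R => h^-1 *: (\int[leb]_(x in D) F (h + rho) x - \int[leb]_(x in D) F rho x)) =
  (fun h : R => h^-1 *: (((fun r => \int[leb]_(x in D) (f x * scaled (dkernel S) x0 r x)) \o shift rho)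
     (h *: 1) - \int[leb]_(x in D) (f x * scaled (dkernel S) x0 rho x))).
  by apply/funext => h /=; rewrite [_%:A]mulr1.
rewrite E2 in cv.
by apply: DeriveDef; [apply/cvg_ex; eexists; exact: cv|exact: cvg_lim cv].
Qed.

End scaled_kernels.

(** * Monotone means of the Laplacian and growth of the means of u *)

Section mean_value.
Context {R : realType} {n : nat}.
Local Notation V := 'rV[R]_n.
Local Notation leb := (@lebesgue_row R n).
Implicit Types (x : V) (rho : R).

Lemma derive_ge0_le (f f' : R -> R) (a b : R) : a <= b ->
  (forall r, a <= r <= b -> is_derive r 1 f (f' r)) ->
  (forall r, a <= r <= b -> 0 <= f' r) -> f a <= f b.
Proof.
move=> ab df f0; have cf : {within `[a, b], continuous f}.
  by apply: derivable_within_continuous => r; rewrite in_itv/= => /df[].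
have df' r : r \in `]a, b[ -> is_derive r 1 f (f' r).
  by rewrite in_itv/= => /andP[ar rb]; apply: df; rewrite !ltW.
have [c + E] := @MVT_segment R f f' a b ab df' cf.
by rewrite in_itv/= => cab; rewrite -subr_ge0 E mulr_ge0 ?f0// subr_ge0.
Qed.

(* The cut at 1/3 keeps the argument of [flat 0] below 1/2, where it is convex:
   this makes [dkernel (dkernel (bowl 0))] nonnegative. *)
Definition bowl (m : nat) : R -> R := fun t => flat m (3^-1 - t).

Lemma smooth1_bowl m : smooth1 (bowl m).
Proof.
apply: (@Cinf_comp _ _ _ _ (flat m) (fun t : R => 3^-1 - t)); first exact: smooth1_flat.
rewrite (_ : (fun t => _) = (fun t => 3^-1 + - 1 * t)); first exact: smooth1_affine.
by apply/funext => t; rewrite mulN1r.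
Qed.

Lemma vanishes_bowl m : vanishes (bowl m).
Proof. by move=> t t2; rewrite /bowl flat_eq0//; lra. Qed.

Lemma derive_bowl m : derive1 (bowl m) = fun t => m%:R * bowl m.+1 t - bowl m.+2 t.
Proof.
apply/funext => t; have d1 : is_derive t 1 (fun s : R => 3^-1 - s) (-1).
  have := is_deriveB (is_derive_cst (3^-1 : R) t 1) (is_derive_id t 1).
  by rewrite sub0r.
have [_ d2] := @is_derive_dir_comp R R (flat m) (fun s : R => 3^-1 - s) t 1 _ _
  (is_derive_flat m (3^-1 - t)) d1.
by rewrite derive1E [LHS]d2 /bowl; ring.
Qed.

Lemma dkernel_bowl : dkernel (bowl 0) = fun t => 2 * bowl 2 t.
Proof. by apply/funext => t; rewrite /dkernel derive_bowl; ring. Qed.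

Lemma dkernel2_bowl : dkernel (dkernel (bowl 0)) = fun t => 4 * (bowl 4 t - 2 * bowl 3 t).
Proof.
apply/funext => t; rewrite dkernel_bowl /dkernel derive1E deriveZ; last first.
  by have [] := smooth1_is_derive t (smooth1_bowl 2).
by rewrite -derive1E derive_bowl -[_ *: _]/(_ * _); ring.
Qed.

Lemma dkernel2_bowlE t : t < 3^-1 -> dkernel (dkernel (bowl 0)) t =
  4 * ((3^-1 - t)^-1 ^+ 4 * expR (- (3^-1 - t)^-1) * (1 - 2 * (3^-1 - t))).
Proof.
move=> t3; have s0 : 0 < 3^-1 - t by rewrite subr_gt0.
rewrite dkernel2_bowl /bowl /flat leNgt s0/=; move: (expR _) => E.
by move: (3^-1 - t) s0 => s s0; field; rewrite gt_eqF.
Qed.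

Lemma dkernel2_bowl_ge0 t : 0 <= t -> 0 <= dkernel (dkernel (bowl 0)) t.
Proof.
move=> t0; have [t3|t3] := ltP t 3^-1; last first.
  by rewrite dkernel2_bowl /bowl !flat_eq0 ?subr_le0// mulr0 subrr mulr0.
rewrite dkernel2_bowlE//; apply: mulr_ge0 => //; apply: mulr_ge0; last by lra.
by rewrite mulr_ge0 ?expR_ge0// exprn_ge0// invr_ge0 subr_ge0 ltW.
Qed.

(** The bound t <= 1/16 is the ball of radius rho / 4. There s = 1/3 - t lies between 1/8 and 1/3,
    so s^(-4) >= 1, exp(-1/s) >= exp(-8) and 4 (1 - 2 s) >= 4/3. *)
Lemma dkernel2_bowl_ge t : 0 <= t <= 16^-1 -> expR (- 8) <= dkernel (dkernel (bowl 0)) t.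
Proof.
move=> /andP[t0 t16]; have t3 : t < 3^-1 by lra.
rewrite dkernel2_bowlE//; set s := 3^-1 - t.
have s0 : 0 < s by rewrite /s; lra.
have s8 : s^-1 <= 8 by rewrite invf_ple ?posrE// /s; lra.
have s1 : 1 <= s^-1 by rewrite invf_ge1// /s; lra.
have e8 : expR (- 8) <= expR (- s^-1) by rewrite ler_expR lerN2.
have s4 : 1 <= s^-1 ^+ 4 by rewrite exprn_ege1.
have h3 : 3^-1 <= 1 - 2 * s by rewrite /s; lra.
have e0 : 0 <= expR (- s^-1) := expR_ge0 _.
apply: (le_trans e8); rewrite -[leLHS]mul1r -mulrA mulrCA [leRHS]mulrA.
have : 1 * expR (- s^-1) <= s^-1 ^+ 4 * expR (- s^-1) by rewrite ler_wpM2r.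
rewrite !mul1r => h.
have : expR (- s^-1) * 3^-1 <= s^-1 ^+ 4 * expR (- s^-1) * (1 - 2 * s).
  by apply: ler_pM.
move=> h'; rewrite [leRHS](_ : _ = 4 * (s^-1 ^+ 4 * expR (- s^-1) * (1 - 2 * s))); last by ring.
move: h'; move: (s^-1 ^+ 4 * _ * _) => X hX; lra.
Qed.

Lemma sq_integral_le_volume (D B : set V) (f : V -> R) (m : R) : measurable D -> measurable B -> B `<=` D ->
  leb B \is a fin_num -> measurable_fun D f -> (forall x, D x -> ~ B x -> f x = 0) ->
  (forall x, D x -> `|f x| <= m) ->
  sq_integrable leb D f /\ \int[leb]_(x in D) (f x ^+ 2) <= m ^+ 2 * volume B.
Proof.
move=> mD mB BD fB mf f0 fm.
have Boo : (leb B < +oo)%E by rewrite -ge0_fin_numE.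
have f2m x : D x -> f x ^+ 2 <= m ^+ 2.
  move=> Dx; rewrite -[f x ^+ 2]real_normK ?num_real// ler_sqr ?nnegrE ?fm//.
  by apply: le_trans (fm x Dx).
have cB (c : R) : leb.-integrable B (EFin \o cst c).
  by apply: measurable_bounded_integrable => //; exact: bounded_cst.
have fBi : leb.-integrable B (EFin \o (fun x => f x ^+ 2)).
  apply: (integrable_le mB _ _ (cB (m ^+ 2))).
    by apply: measurable_funX; exact: measurable_funS mf.
  by move=> x Bx; rewrite ger0_norm ?sqr_ge0// f2m//; exact: BD.
have fDi : leb.-integrable D (EFin \o (fun x => f x ^+ 2)).
  have ind : leb.-integrable setT (EFin \o (\1_B : V -> R)).
    apply: (integrable_support mB).
      by move=> x Bx; rewrite indicE memNset.
    apply: (eq_integrable_fun mB _ (cB 1)) => x Bx.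
    by rewrite indicE mem_set.
  have indD : leb.-integrable D (EFin \o (fun x => m ^+ 2 * (\1_B : V -> R) x)).
    by apply: integrable_scale => //; exact: integrableS ind.
  apply: (integrable_le mD _ _ indD); first exact: measurable_funX.
  move=> x Dx; rewrite ger0_norm ?sqr_ge0// indicE; case: (boolP (x \in B)) => xB.
    by rewrite mulr1 f2m.
  by rewrite f0 ?expr0n ?mulr0// => /mem_set; apply/negP.
split; first by split.
rewrite (@Rintegral_subset_support _ _ _ _ B)//; last by move=> x Dx Bx; rewrite f0// expr0n.
apply: (@le_trans _ _ (\int[leb]_(x in B) (m ^+ 2))).
  by apply: le_Rintegral => //; [exact: cB|move=> x Bx; apply: f2m; exact: BD].
by rewrite Rintegral_cst// /volume.
Qed.

Let squeeze (a b c d eps : R) : - (eps / 2) <= c -> d <= eps / 2 -> c - d <= b - a -> a <= b + eps.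
Proof. by move=> *; lra. Qed.

Section estimates.
Context (Omega : set V) (u0 u : V -> R) (u1 : 'I_n -> V -> R) (u2 : 'I_n -> 'I_n -> V -> R).
Context (hu : minimizer_data Omega u0 u u1 u2) (x0 : V).

Let oO : open Omega. Proof. by case: hu. Qed.
Let bO : bounded_set Omega. Proof. by case: hu. Qed.
Let umin : minimizer Omega u0 u. Proof. by case: hu. Qed.
Let uW : W22 Omega u u1 u2. Proof. by case: hu. Qed.
Let mO : measurable Omega := open_measurable_row oO.
Let D := lap u2.

Lemma sq_integrable_domain f : sq_integrable leb Omega f -> leb.-integrable Omega (EFin \o f).
Proof. by apply: finite_sq_integrable => //; exact: lebesgue_row_bounded. Qed.

Lemma laplacian_by_parts phi : test_function Omega phi ->
  \int[leb]_(x in Omega) (u x * \sum_i partial i (partial i phi) x) =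
  \int[leb]_(x in Omega) (D x * phi x).
Proof.
move=> tphi; have [hu0 hu1 hu2 d1 d2] := uW.
have tdd i : test_function Omega (partial i (partial i phi)) by do 2! apply: test_function_partial.
have li f : sq_integrable leb Omega f -> locally_integrable_on Omega f.
  exact: sq_locally_integrable.
have [_ E1] := Rintegral_sum (index_enum 'I_n) mO
  (fun i => locally_integrable_test oO (li _ hu0) (tdd i)).
have [_ E2] := Rintegral_sum (index_enum 'I_n) mO
  (fun i => locally_integrable_test oO (li _ (hu2 i i)) tphi).
under eq_Rintegral do rewrite mulr_sumr.
under [in RHS]eq_Rintegral do rewrite mulr_suml.
rewrite [LHS]E1 [RHS]E2; apply: eq_bigr => i _.
rewrite (d1 i _ (test_function_partial i tphi)).
by rewrite (d2 i i _ tphi) opprK.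
Qed.

(** [flux] is a weighted mean of D and [mean] one of u. The second kernel is [dkernel] of the first,
    so that the derivative of [mean] at rho is rho times [flux rho]. *)
Definition flux rho := \int[leb]_(x in Omega) (D x * scaled (dkernel (bowl 0)) x0 rho x).
Definition mean rho := \int[leb]_(x in Omega) (u x * scaled (dkernel (dkernel (bowl 0))) x0 rho x).

(** The derivative of [flux] at r is r times the integral of D against the Laplacian of a
    nonnegative test function, which is at most 0 by superharmonicity. *)
Lemma flux_noninc (s rho : R) : 0 < s <= rho -> cball x0 rho `<=` Omega -> flux rho <= flux s.
Proof.
move=> /andP[s0 sr] cO.
have Di : leb.-integrable Omega (EFin \o D) := sq_integrable_domain (lap_sq oO uW).
have dA (r : R) : 0 < r -> is_derive r 1 flux
    (r * \int[leb]_(x in Omega) (D x * \sum_i partial i (partial i (scaled (bowl 0) x0 r)) x)).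
  by move=> r0; apply: is_derive_scaled_integral => //; [exact: smooth1_bowl|exact: vanishes_bowl].
rewrite -lerN2; apply: (@derive_ge0_le (fun r => - flux r) (fun r => - (r * _)) s rho sr).
  by move=> r /andP[sr' _]; apply: is_deriveN; apply: dA; exact: lt_le_trans sr'.
move=> r /andP[sr' rr]; have r0 : 0 < r := lt_le_trans s0 sr'.
rewrite oppr_ge0 pmulr_rle0//; apply: (laplacian_superharmonic oO bO umin uW).
  apply: test_function_scaled => //; [exact: smooth1_bowl|exact: vanishes_bowl|].
  by apply: subset_trans cO; apply: cballS; rewrite rr ltW.
move=> x; rewrite /scaled mulr_ge0 ?exprn_ge0 ?invr_ge0 ?(ltW r0)//; exact: flat_ge0.
Qed.

(** The difference [mean t] - [flux r] t^2 / 2 has derivative t ([flux t] - [flux r]) >= 0. *)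
Lemma mean_growth (s rho r : R) : 0 < s <= rho -> rho <= r -> cball x0 r `<=` Omega ->
  mean s - flux r * (s ^+ 2 / 2) <= mean rho - flux r * (rho ^+ 2 / 2).
Proof.
move=> /andP[s0 srho] rhor cO.
have ui : leb.-integrable Omega (EFin \o u) := sq_integrable_domain (W22_sq uW).
have dM (t : R) : 0 < t <= r -> is_derive t 1 mean (t * flux t).
  move=> /andP[t0 tr].
  have ct : cball x0 t `<=` Omega by apply: subset_trans cO; apply: cballS; rewrite tr ltW.
  have h : is_derive t 1 mean (t * \int[leb]_(x in Omega)
      (u x * \sum_i partial i (partial i (scaled (dkernel (bowl 0)) x0 t)) x)).
    apply: is_derive_scaled_integral => //; first exact/smooth1_dkernel/smooth1_bowl.
    exact/vanishes_dkernel/vanishes_bowl.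
  move: h; rewrite laplacian_by_parts//; apply: test_function_scaled => //.
    exact/smooth1_dkernel/smooth1_bowl.
  exact/vanishes_dkernel/vanishes_bowl.
have d2 (t : R) : is_derive t 1 (fun t : R => flux r * (t ^+ 2 / 2)) (flux r * t).
  have dX := is_deriveX 2 (is_derive_id t 1).
  have dM' := is_deriveM (is_derive_cst (flux r / 2) t 1) dX.
  rewrite (_ : (fun t : R => flux r * (t ^+ 2 / 2)) = (cst (flux r / 2) : R -> R) * (id ^+ 2)).
    refine (is_derive_eq dM' _).
    by rewrite -[LHS]/((flux r / 2) * ((2 * t ^+ 1) * 1) + t ^+ 2 * 0); field.
  by apply/funext => y; rewrite -[RHS]/(flux r / 2 * y ^+ 2); field.
apply: (@derive_ge0_le (fun t => mean t - flux r * (t ^+ 2 / 2))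
   (fun t => t * flux t - flux r * t) s rho srho) => t /andP[st trho].
  apply: is_deriveB; apply: dM; rewrite (lt_le_trans s0 st)/=; exact: le_trans rhor.
have t0 : 0 < t := lt_le_trans s0 st.
rewrite [flux r * t]mulrC -mulrBr mulr_ge0 ?(ltW t0)// subr_ge0.
by apply: flux_noninc cO; rewrite t0 (le_trans trho).
Qed.

Lemma mean_small (r eps : R) : {for x0, continuous u} -> u x0 = 0 -> 0 < r ->
  cball x0 r `<=` Omega -> 0 < eps -> exists2 s0, 0 < s0 & forall s, 0 < s < s0 -> `|mean s| <= eps.
Proof.
move=> cu ux0 r0 cO eps0.
have [M M0 HM] := scaled_bounds (n := n) (smooth1_dkernel (smooth1_dkernel (smooth1_bowl 0)))
  (vanishes_dkernel (vanishes_dkernel (vanishes_bowl 0))).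
(* On the ball of radius s the kernel is at most M s^(-n) and the volume at most (2 s)^n; the powers
   of s cancel and leave M 2^n. *)
have p0 : 0 < M * 2 ^+ n by rewrite mulr_gt0 ?exprn_gt0.
have e1 : 0 < eps / (M * 2 ^+ n) by rewrite divr_gt0.
have : nbhs x0 [set x | `|u x0 - u x| <= eps / (M * 2 ^+ n)].
  by move: cu => /(cvgrPdist_le (FF := nbhs_filter x0))/(_ _ e1).
move/nbhs_ballP => [d /= d0 dU].
exists (Num.min r d); first by rewrite lt_min r0.
move=> s /andP[s0]; rewrite lt_min => /andP[sr sd].
have small x : cball x0 s x -> `|u x| <= eps / (M * 2 ^+ n).
  move=> xs; have := dU x; rewrite /= ux0 sub0r normrN; apply.
  split => // k i; rewrite ord1 -ball_normE /=; apply: le_lt_trans sd.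
  rewrite distrC -ler_sqr ?nnegrE ?(ltW s0)// real_normK ?num_real//.
  apply: le_trans xs; rewrite /dist2 (bigD1 i)//= lerDl.
  by apply: sumr_ge0 => j _; exact: sqr_ge0.
have sO : cball x0 s `<=` Omega by apply: subset_trans cO; apply: cballS; rewrite !ltW.
have sS := smooth1_dkernel (smooth1_dkernel (smooth1_bowl 0)).
have vS := vanishes_dkernel (vanishes_dkernel (vanishes_bowl 0)).
have [msu _] := W22_sq uW.
rewrite /mean (@Rintegral_subset_support _ _ _ _ (cball x0 s))//; last first.
  move=> x _ /negP; rewrite -ltNge => xs; rewrite scaled_out ?mulr0//.
  by apply: le_lt_trans xs; rewrite ler_pdivrMr// ler_peMr ?sqr_ge0// ler1n.
have mc := measurable_cball x0 s.
have cB (c : R) : leb.-integrable (cball x0 s) (EFin \o cst c).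
  apply: measurable_bounded_integrable => //; last exact: bounded_cst.
  by rewrite -ge0_fin_numE//; exact: lebesgue_cball_fin.
have bd x : cball x0 s x -> `|u x * scaled (dkernel (dkernel (bowl 0))) x0 s x| <=
    eps / (M * 2 ^+ n) * (M * s^-1 ^+ n).
  by move=> xs; rewrite normrM ler_pM// ?small//; have [] := HM x0 s x s0.
have fi : leb.-integrable (cball x0 s) (EFin \o (fun x => u x * scaled (dkernel (dkernel (bowl 0))) x0 s x)).
  apply: (integrable_le mc _ bd (cB _)); apply: measurable_funM.
    exact: measurable_funS msu.
  apply: (@measurable_funS _ _ _ _ setT) => //.
  by apply: smooth_measurable; exact: smooth_scaled.
apply: le_trans (le_normr_Rintegral mc fi) _.
apply: (@le_trans _ _ (\int[leb]_(x in cball x0 s) (eps / (M * 2 ^+ n) * (M * s^-1 ^+ n)))).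
  by apply: le_Rintegral => //; [exact: integrable_norm|exact: cB].
rewrite Rintegral_cst// -/(volume _).
apply: (@le_trans _ _ (eps / (M * 2 ^+ n) * (M * s^-1 ^+ n) * (2 * s) ^+ n)).
  rewrite ler_wpM2l ?volume_cball_le ?(ltW s0)//.
  by rewrite !mulr_ge0 ?exprn_ge0 ?invr_ge0 ?mulr_ge0 ?exprn_ge0// ?ltW.
have sn : s ^+ n != 0 by rewrite expf_neq0// gt_eqF.
have tn : 2 ^+ n != 0 :> R by rewrite expf_neq0.
rewrite exprMn exprVn le_eqVlt; apply/orP; left; apply/eqP.
by move: (s ^+ n) (2 ^+ n) sn tn => a b a0 b0; field; rewrite a0 b0 gt_eqF.
Qed.

(** [mean_growth] in the limit s to 0, where the mean tends to u(x0) = 0. *)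
Lemma mean_ge (rho r : R) : {for x0, continuous u} -> u x0 = 0 -> 0 < rho <= r ->
  cball x0 r `<=` Omega -> flux r * (rho ^+ 2 / 2) <= mean rho.
Proof.
move=> cu ux0 /andP[rho0 rhor] cO; apply/ler_addgt0Pr => eps eps0.
have r0 := lt_le_trans rho0 rhor.
have e2 : 0 < eps / 2 by rewrite divr_gt0.
have [s0 s0_gt0 hs] := mean_small cu ux0 r0 cO e2.
have f0 : 0 < `|flux r| + 1 by rewrite ltr_wpDl.
(* The last two bounds give |[flux r]| s^2 / 2 <= eps / 2; the first two are for [mean_small] and
   [mean_growth]. *)
pose s := Num.min (s0 / 2) (Num.min rho (Num.min 1 (eps / 2 / (`|flux r| + 1)))).
have sgt0 : 0 < s by rewrite !lt_min !divr_gt0// rho0 ltr01.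
have ss0 : s < s0.
  by apply: (@le_lt_trans _ _ (s0 / 2)); rewrite ?ge_min ?lexx// ltr_pdivrMr// ltr_pMr// ltr1n.
have srho : s <= rho by rewrite /s !ge_min lexx !orbT.
have s1 : s <= 1 by rewrite /s !ge_min lexx !orbT.
have se : s <= eps / 2 / (`|flux r| + 1) by rewrite /s !ge_min lexx !orbT.
have hm : `|mean s| <= eps / 2 by apply: hs; rewrite sgt0.
have := @mean_growth s rho r _ rhor cO; rewrite sgt0 srho => /(_ isT).
have hf : flux r * (s ^+ 2 / 2) <= eps / 2.
  apply: le_trans (ler_norm _) _; rewrite normrM (ger0_norm (_ : 0 <= s ^+ 2 / 2)); last first.
    by rewrite divr_ge0 ?sqr_ge0.
  apply: (@le_trans _ _ (`|flux r| * s)).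
    rewrite ler_wpM2l// ler_pdivrMr// expr2 mulrC ler_pM2l// (le_trans s1)// ler1n//.
  apply: (@le_trans _ _ ((`|flux r| + 1) * s)); first by rewrite ler_wpM2r ?lerDl// ltW.
  by rewrite mulrC -ler_pdivlMr.
by move: hm; rewrite ler_norml => /andP[hm _]; exact: squeeze.
Qed.

End estimates.

End mean_value.

(** * The bound on the mean of |u| *)

Section mean_inequality.
Context {R : realType} {n : nat}.
Local Notation V := 'rV[R]_n.
Local Notation leb := (@lebesgue_row R n).
Implicit Types (x : V) (rho : R).

Lemma energy_ge0 (u : V -> R) x0 rho : 0 <= energy u x0 rho.
Proof. by apply: Rintegral_ge0 => x _; exact: sqr_ge0. Qed.

Let quarter_scale (K M E F vol X rho p : R) : 0 < rho -> 0 <= E -> 0 <= M -> 0 <= vol ->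
  p = rho ^+ n -> vol <= 2 ^+ n * p ->
  rho ^+ 4 * F <= K * E -> X ^+ 2 <= F * ((M * rho^-1 ^+ n) ^+ 2 * vol) -> 0 <= F ->
  rho ^+ (n + 4) * X ^+ 2 <= K * M ^+ 2 * 2 ^+ n * E.
Proof.
move=> r0 E0 M0 v0 pE vp FE XF F0; have p0 : 0 < p by rewrite pE exprn_gt0.
rewrite exprD -pE exprVn -pE in XF *.
apply: (@le_trans _ _ (p * rho ^+ 4 * (F * ((M * p^-1) ^+ 2 * (2 ^+ n * p))))).
  apply: ler_wpM2l; first by rewrite mulr_ge0 ?exprn_ge0// ltW.
  by apply: le_trans XF _; rewrite !ler_wpM2l// sqr_ge0.
rewrite [leLHS](_ : _ = (rho ^+ 4 * F) * (M ^+ 2 * 2 ^+ n)); last by field; rewrite gt_eqF.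
rewrite [leRHS](_ : _ = K * E * (M ^+ 2 * 2 ^+ n)); last by ring.
by rewrite ler_wpM2r// mulr_ge0 ?sqr_ge0// exprn_ge0.
Qed.

(** Cauchy-Schwarz between D zeta^2, bounded by Caccioppoli, and the kernel. In terms of [density]
    it says that the square of the flux is at most C times the density. *)
Lemma flux_bound : exists2 C : R, 0 < C &
  forall Omega (u0 u : V -> R) (u1 : 'I_n -> V -> R) (u2 : 'I_n -> 'I_n -> V -> R) (x0 : V) (rho : R),
    minimizer_data Omega u0 u u1 u2 -> 0 < rho -> cball x0 rho `<=` Omega ->
  rho ^+ (n + 4) * flux Omega u2 x0 rho ^+ 2 <= C * energy u x0 rho.
Proof.
have [K K0 HK] := @energy_estimates R n.
have sS := smooth1_dkernel (smooth1_bowl (R := R) 0); have vS := vanishes_dkernel (vanishes_bowl (R := R) 0).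
have [M M0 HM] := scaled_bounds (n := n) sS vS.
exists (K * M ^+ 2 * 2 ^+ n); first by rewrite !mulr_gt0 ?exprn_gt0.
move=> Omega u0 u u1 u2 x0 rho hu r0 cO.
have [hF _ _ _] := HK _ _ _ _ _ _ _ hu r0 cO.
have [oO bO umin uW] := hu; have mO := open_measurable_row oO.
set chi := scaled (dkernel (bowl 0)) x0 rho.
have schi : smooth chi by exact: smooth_scaled.
have out x : ~ cball x0 rho x -> chi x = 0.
  move=> /negP; rewrite -ltNge => xr; apply: scaled_out => //.
  by apply: le_lt_trans xr; rewrite ler_pdivrMr// ler_peMr ?sqr_ge0// ler1n.
have mchi : measurable_fun Omega chi.
  by apply: (@measurable_funS _ _ _ _ setT) => //; exact: smooth_measurable.
have [hchi chi2] := sq_integral_le_volume mO (measurable_cball x0 rho) cO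
  (lebesgue_cball_fin x0 rho) mchi (fun x _ => out x) (fun x _ => proj1 (HM x0 rho x r0)).
pose zeta := cutoff x0 rho.
have hDz : sq_integrable leb Omega (fun x => lap u2 x * zeta x ^+ 2).
  apply: (sq_integrable_bounded (M := 1)) => //; last exact: lap_sq uW.
    apply: measurable_funX; apply: (@measurable_funS _ _ _ _ setT) => //.
    by apply: smooth_measurable; exact: smooth_cutoff.
  move=> x _; have /andP[z0 z1] := cutoff_itv x0 rho x.
  by rewrite ger0_norm ?exprn_ge0// exprn_ile1.
(* The factor zeta^2 can be inserted because the kernel vanishes where zeta differs from 1. *)
have E : flux Omega u2 x0 rho = \int[leb]_(x in Omega) (lap u2 x * zeta x ^+ 2 * chi x).
  apply: eq_Rintegral => x _.
  have [xr|xr] := leP (dist2 x0 x) (rho ^+ 2 / 2).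
    by rewrite /zeta cutoff_eq1// expr1n mulr1.
  by rewrite /chi scaled_out// !mulr0.
have CS := cauchy_schwarz mO hDz hchi.
rewrite -E in CS.
apply: (@quarter_scale K M _ _ (volume (cball x0 rho)) _ rho _ r0 (energy_ge0 u x0 rho)
  (ltW M0) _ (erefl _) _ hF).
- by rewrite /volume fine_ge0.
- by rewrite -exprMn; exact: volume_cball_le (ltW r0).
- apply: le_trans CS _; apply: ler_wpM2l => //.
  by apply: Rintegral_ge0 => x _; exact: sqr_ge0.
- by apply: Rintegral_ge0 => x _; exact: sqr_ge0.
Qed.

(** The constant K + 1 replaces the square root of K. Squares are compared only when X > 0. *)
Let positive_scale (K M E vol X rho p : R) : 0 < rho -> 0 <= E -> 0 < M -> 0 < K ->
  p = rho ^+ n -> rho ^+ 4 * vol <= K * E -> 0 <= vol ->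
  X ^+ 2 <= E * ((M * rho^-1 ^+ n) ^+ 2 * vol) ->
  rho ^+ (n + 2) * X <= (M * (K + 1)) * E.
Proof.
move=> r0 E0 M0 K0 pE vE v0 XF; have p0 : 0 < p by rewrite pE exprn_gt0.
have K1 : 0 < K + 1 by rewrite ltr_wpDl// ltW.
rewrite exprVn -pE in XF; rewrite exprD -pE.
have [X0|X0] := leP X 0.
  apply: (@le_trans _ _ 0); first by rewrite pmulr_rle0// mulr_gt0 ?exprn_gt0.
  by rewrite !mulr_ge0// ltW.
rewrite -ler_sqr ?nnegrE ?mulr_ge0 ?exprn_ge0 ?(ltW X0) ?(ltW r0) ?(ltW p0) ?(ltW M0) ?(ltW K1)//.
apply: (@le_trans _ _ ((p * rho ^+ 2) ^+ 2 * (E * ((M / p) ^+ 2 * vol)))).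
  by rewrite exprMn ler_wpM2l// sqr_ge0.
rewrite [leLHS](_ : _ = (rho ^+ 4 * vol) * (E * M ^+ 2)); last by field; rewrite gt_eqF.
apply: (@le_trans _ _ (K * E * (E * M ^+ 2))).
  by rewrite ler_wpM2r// mulr_ge0 ?sqr_ge0.
rewrite -subr_ge0 (_ : _ - _ = E ^+ 2 * M ^+ 2 * (K ^+ 2 + K + 1)); last by ring.
apply: mulr_ge0; first by rewrite mulr_ge0 ?sqr_ge0.
by rewrite addr_ge0// addr_ge0 ?sqr_ge0// ltW.
Qed.

(** Cauchy-Schwarz between u and the kernel on {u > 0}: the second factor carries the square root of
    the measure of {u > 0}, itself bounded by the energy, so that the result is of first order in
    the energy. *)
Lemma positive_part_bound : exists2 C : R, 0 < C &
  forall Omega (u0 u : V -> R) (u1 : 'I_n -> V -> R) (u2 : 'I_n -> 'I_n -> V -> R) (x0 : V) (rho : R),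
    minimizer_data Omega u0 u u1 u2 -> 0 < rho -> cball x0 rho `<=` Omega ->
  rho ^+ (n + 2) * \int[leb]_(x in Omega) (u x * (\1_(positivity_set Omega u) x *
     scaled (dkernel (dkernel (bowl 0))) x0 rho x)) <= C * energy u x0 rho.
Proof.
have [K K0 HK] := @energy_estimates R n.
have sS := smooth1_dkernel (smooth1_dkernel (smooth1_bowl (R := R) 0)).
have vS := vanishes_dkernel (vanishes_dkernel (vanishes_bowl (R := R) 0)).
have [M M0 HM] := scaled_bounds (n := n) sS vS.
exists (M * (K + 1)); first by rewrite mulr_gt0// ltr_wpDl// ltW.
move=> Omega u0 u u1 u2 x0 rho hu r0 cO.
have [_ _ hV _] := HK _ _ _ _ _ _ _ hu r0 cO.
have [oO bO umin uW] := hu; have mO := open_measurable_row oO.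
have hu0 := W22_sq uW; have [mu _] := hu0.
set psi := scaled (dkernel (dkernel (bowl 0))) x0 rho.
set P := positivity_set Omega u in hV *.
have mP : measurable P by exact: measurable_positivity_set.
set H := [set x | _] in hV.
have mH : measurable H by apply: compact_measurable_row; exact: compact_dist2.
have HO : H `<=` cball x0 rho.
  by move=> x /= xr; apply: le_trans xr _; rewrite ler_pdivrMr// ler_peMr ?sqr_ge0// ler1n.
have spsi : smooth psi by exact: smooth_scaled.
have mpsi : measurable_fun Omega psi.
  by apply: (@measurable_funS _ _ _ _ setT) => //; exact: smooth_measurable.
have mg : measurable_fun Omega (fun x => (\1_P : V -> R) x * psi x).
  by apply: measurable_funM => //; exact: measurable_indic.
have PO : P `&` H `<=` Omega by move=> x [[]].
have gout x : Omega x -> ~ (P `&` H) x -> (\1_P : V -> R) x * psi x = 0.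
  move=> _ PH; rewrite indicE; case: (boolP (x \in P)) => [/set_mem Px|]; last by rewrite mul0r.
  have /negP : ~ H x by move=> Hx; apply: PH.
  by rewrite /H /= -ltNge => xr; rewrite /psi scaled_out// mulr0.
have gb x : Omega x -> `|(\1_P : V -> R) x * psi x| <= M * rho^-1 ^+ n.
  move=> _; have [h _] := HM x0 rho x r0; rewrite normrM; apply: le_trans h.
  by rewrite ler_piMl// indicE; case: (_ \in _); rewrite ?normr1 ?normr0.
have [hg g2] := sq_integral_le_volume mO (measurableI _ _ mP mH) PO
  (fin_measure oO bO (measurableI _ _ mP mH) PO) mg gout gb.
pose kap x : R := \1_(cball x0 rho) x.
have mk : measurable_fun Omega kap by apply: measurable_indic; exact: measurable_cball.
have huk : sq_integrable leb Omega (fun x => u x * kap x).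
  apply: (sq_integrable_bounded (M := 1)) => // x _.
  by rewrite /kap indicE; case: (_ \in _); rewrite ?normr1 ?normr0.
have E1 : \int[leb]_(x in Omega) ((u x * kap x) ^+ 2) = energy u x0 rho.
  rewrite (@Rintegral_subset_support _ _ _ _ (cball x0 rho))//.
    by apply: eq_Rintegral => x xr; rewrite /kap indicE xr mulr1.
  by move=> x _ xr; rewrite /kap indicE memNset// mulr0 expr0n.
have E2 : \int[leb]_(x in Omega) (u x * ((\1_P : V -> R) x * psi x)) =
   \int[leb]_(x in Omega) (u x * kap x * ((\1_P : V -> R) x * psi x)).
  apply: eq_Rintegral => x /set_mem xO.
  have -> : kap x = (x \in cball x0 rho)%:R by rewrite /kap indicE.
  case: (boolP (x \in cball x0 rho)) => xr; first by rewrite mulr1.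
  rewrite [X in _ * X]gout ?mulr0//; last first.
    by move=> [_ /HO /mem_set]; apply/negP.
  by rewrite gout ?mulr0// => -[_ /HO /mem_set]; apply/negP.
rewrite E2; apply: (@positive_scale K M (energy u x0 rho) (volume (P `&` H)) _ rho _ r0
  (energy_ge0 u x0 rho) M0 K0 (erefl _) hV).
  by rewrite /volume fine_ge0.
apply: le_trans (cauchy_schwarz mO huk hg) _; rewrite E1.
by apply: ler_wpM2l => //; exact: energy_ge0.
Qed.

(** This is e(rho)^2 of the overview. *)
Definition density u x0 rho : R := energy u x0 rho / rho ^+ (n + 4).

Lemma density_ge0 u x0 rho : 0 <= rho -> 0 <= density u x0 rho.
Proof. by move=> r0; rewrite divr_ge0 ?energy_ge0// exprn_ge0. Qed.

Let mean_scale (C1 C2 c w X Y I f E e rho s : R) : 0 < rho -> 0 < c -> 0 < C1 -> 0 < C2 ->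
  w = rho ^+ n -> c * w^-1 * I <= 2 * X - Y -> f * (rho ^+ 2 / 2) <= Y ->
  rho ^+ (n + 2) * X <= C2 * E -> E = e * rho ^+ (n + 4) -> 0 <= e -> 0 <= s ->
  f ^+ 2 <= C1 * s ^+ 2 ->
  I <= c^-1 * (C1 + 1 + 2 * C2) * rho ^+ (n + 2) * (s + e).
Proof.
move=> r0 c0 C10 C20 wE h1 h2 h3 eE e0 s0 fs.
have w0 : 0 < w by rewrite wE exprn_gt0.
have r2 : 0 < rho ^+ 2 by rewrite exprn_gt0.
rewrite !exprD -!wE in h3 eE *.
have hX : X <= C2 * e * rho ^+ 2.
  rewrite -(ler_pM2l (mulr_gt0 w0 r2)); apply: le_trans h3 _; rewrite eE.
  by rewrite le_eqVlt; apply/orP; left; apply/eqP; ring.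
have hf : - f <= (C1 + 1) * s.
  apply: le_trans (ler_norm _) _; rewrite normrN.
  rewrite -ler_sqr ?nnegrE ?mulr_ge0 ?addr_ge0 ?(ltW C10)// real_normK ?num_real//.
  apply: (le_trans fs); rewrite exprMn ler_wpM2r ?sqr_ge0//.
  rewrite -subr_ge0 (_ : _ - _ = C1 ^+ 2 + C1 + 1); last by ring.
  by rewrite addr_ge0// addr_ge0 ?sqr_ge0// ltW.
have hY : - Y <= (C1 + 1) * s * (rho ^+ 2 / 2).
  apply: (@le_trans _ _ (- f * (rho ^+ 2 / 2))); first by rewrite mulNr lerN2.
  by rewrite ler_wpM2r// divr_ge0// ltW.
have h4 : c * w^-1 * I <= (C1 + 1 + 2 * C2) * rho ^+ 2 * (s + e).
  apply: (le_trans h1); apply: (@le_trans _ _ (2 * (C2 * e * rho ^+ 2) + (C1 + 1) * s * (rho ^+ 2 / 2))).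
    by rewrite lerD// ler_pM2l.
  rewrite -subr_ge0 (_ : _ - _ = rho ^+ 2 * (2 * C2 * s + (C1 + 1) * e + (C1 + 1) * s / 2));
    last by field.
  rewrite mulr_ge0 ?(ltW r2)// addr_ge0 ?addr_ge0 ?divr_ge0 ?mulr_ge0 ?addr_ge0 ?(ltW C10) ?(ltW C20)//.
rewrite -(ler_pM2l (mulr_gt0 c0 (_ : 0 < w^-1))) ?invr_gt0//.
apply: (le_trans h4); rewrite le_eqVlt; apply/orP; left; apply/eqP.
by field; rewrite !gt_eqF.
Qed.

(** The mean of |u| is 2 times that of u^+ minus that of u. The former is bounded by [density] at
    rho; the latter is bounded below through the flux at the top radius r, whence the square root at
    r. *)
Lemma mean_inequality : exists2 C : R, 0 < C &
  forall Omega (u0 u : V -> R) (u1 : 'I_n -> V -> R) (u2 : 'I_n -> 'I_n -> V -> R)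
      (x0 : V) (rho r : R),
    minimizer_data Omega u0 u u1 u2 -> {for x0, continuous u} -> u x0 = 0 ->
    0 < rho <= r -> cball x0 r `<=` Omega ->
  \int[leb]_(x in cball x0 (rho / 4)) `|u x| <=
    C * rho ^+ (n + 2) * (Num.sqrt (density u x0 r) + density u x0 rho).
Proof.
have [C1 C10 HC1] := flux_bound; have [C2 C20 HC2] := positive_part_bound.
pose c : R := expR (- 8); have c0 : 0 < c := expR_gt0 _.
exists (c^-1 * (C1 + 1 + 2 * C2)).
  by rewrite mulr_gt0 ?invr_gt0// addr_gt0 ?mulr_gt0// addr_gt0.
move=> Omega u0 u u1 u2 x0 rho r hu cu ux0 /andP[rho0 rhor] cO.
have r0 := lt_le_trans rho0 rhor.
have cO' : cball x0 rho `<=` Omega by apply: subset_trans cO; apply: cballS; rewrite rhor ltW.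
have cO4 : cball x0 (rho / 4) `<=` Omega.
  apply: subset_trans cO'; apply: cballS; rewrite divr_ge0 ?(ltW rho0)//=.
  by rewrite ler_pdivrMr// ler_peMr ?ler1n// ltW.
have hf := HC1 _ _ _ _ _ x0 r hu r0 cO.
have hX := HC2 _ _ _ _ _ x0 rho hu rho0 cO'.
have hY := mean_ge hu cu ux0 (_ : 0 < rho <= r) cO; rewrite rho0 rhor in hY; have {}hY := hY isT.
have [oO bO umin uW] := hu; have mO := open_measurable_row oO.
have ui := sq_integrable_domain hu (W22_sq uW); have mu := integrable_measurable ui.
set psi := scaled (dkernel (dkernel (bowl 0))) x0 rho in hX *.
set P := positivity_set Omega u in hX.
have psi_ge0 x : 0 <= psi x.
  rewrite mulr_ge0 ?exprn_ge0 ?invr_ge0 ?(ltW rho0)// dkernel2_bowl_ge0//.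
  by rewrite mulr_ge0 ?dist2_ge0// exprn_ge0// invr_ge0 ltW.
have psi_ge x : cball x0 (rho / 4) x -> c * (rho ^+ n)^-1 <= psi x.
  move=> xr; rewrite /psi /scaled mulrC exprVn ler_pM2l ?invr_gt0 ?exprn_gt0//.
  apply: dkernel2_bowl_ge; rewrite mulr_ge0 ?dist2_ge0 ?exprn_ge0 ?invr_ge0 ?(ltW rho0)//=.
  rewrite exprVn ler_pdivrMl ?exprn_gt0//; apply: le_trans xr _.
  by rewrite expr_div_n -natrX.
have sS := smooth1_dkernel (smooth1_dkernel (smooth1_bowl (R := R) 0)).
have vS := vanishes_dkernel (vanishes_dkernel (vanishes_bowl (R := R) 0)).
have [M M0 HM] := scaled_bounds (n := n) sS vS.
have mpsi : measurable_fun Omega psi.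
  by apply: (@measurable_funS _ _ _ _ setT) => //; apply: smooth_measurable; exact: smooth_scaled.
have psib x : Omega x -> `|psi x| <= M * rho^-1 ^+ n by move=> _; have [] := HM x0 rho x rho0.
have i1 : leb.-integrable Omega (EFin \o (fun x => u x * psi x)).
  exact: integrable_bounded_mul psib ui.
have i2 : leb.-integrable Omega (EFin \o (fun x => `|u x| * psi x)).
  exact: integrable_bounded_mul psib (integrable_norm ui).
have i3 : leb.-integrable Omega (EFin \o (fun x => u x * ((\1_P : V -> R) x * psi x))).
  apply: (integrable_bounded_mul (M := M * rho^-1 ^+ n)) => //.
    apply: measurable_funM => //; apply: measurable_indic; exact: measurable_positivity_set.
  move=> x Ox; rewrite normrM; apply: le_trans (psib x Ox).
  by rewrite ler_piMl// indicE; case: (_ \in _); rewrite ?normr1 ?normr0.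
apply: (mean_scale rho0 c0 C10 C20 (erefl _) _ hY hX _ (density_ge0 _ _ (ltW rho0)) (sqrtr_ge0 _)).
(* The pointwise identity |u| = 2 u^+ - u, with u^+ written as u times the indicator of {u > 0}. *)
- have -> : 2 * \int[leb]_(x in Omega) (u x * ((\1_P : V -> R) x * psi x)) - mean Omega u x0 rho =
      \int[leb]_(x in Omega) (`|u x| * psi x).
    rewrite -RintegralZl// -RintegralB//; last exact: integrable_scale.
    apply: eq_Rintegral => x /set_mem Ox; rewrite -/psi.
    have [ux|ux] := ltP 0 (u x).
      have -> : (\1_P : V -> R) x = 1 by rewrite indicE mem_set.
      by rewrite gtr0_norm//; move: (psi x) => q; ring.
    have -> : (\1_P : V -> R) x = 0.
      by rewrite indicE memNset// => -[_]; rewrite ltNge ux.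
    by rewrite ler0_norm//; move: (psi x) => q; ring.
  apply: (@le_trans _ _ (\int[leb]_(x in cball x0 (rho / 4)) (`|u x| * psi x))); last first.
    apply: ge0_subset_Rintegral => //; first exact: measurable_cball.
    by move=> x _; rewrite mulr_ge0.
  have m4 := measurable_cball x0 (rho / 4).
  rewrite -RintegralZl//; last by apply: integrableS (integrable_norm ui).
  apply: le_Rintegral => //.
  - apply: integrable_scale => //; exact: integrableS (integrable_norm ui).
  - exact: integrableS i2.
  - by move=> x xr; rewrite mulrC ler_wpM2l// psi_ge.
- by rewrite /density mulfVK// gt_eqF// exprn_gt0.
- rewrite sqr_sqrtr ?density_ge0 ?(ltW r0)// /density mulrA ler_pdivlMr ?exprn_gt0//.
  by rewrite mulrC.
Qed.

End mean_inequality.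

(** * Decay of the density *)

Section decay.
Context {R : realType} {n : nat}.
Local Notation V := 'rV[R]_n.
Local Notation leb := (@lebesgue_row R n).
Implicit Types (x : V) (rho : R).

Lemma energy_le (Omega : set V) (u : V -> R) x0 (s rho : R) : measurable Omega ->
  sq_integrable leb Omega u -> 0 <= s <= rho -> cball x0 rho `<=` Omega ->
  energy u x0 s <= energy u x0 rho.
Proof.
move=> mO hu sr cO; apply: ge0_subset_Rintegral.
- exact: measurable_cball.
- exact: measurable_cball.
- exact: cballS.
- by move=> x _; exact: sqr_ge0.
- by apply: integrableS cO (proj2 hu) => //; exact: measurable_cball.
Qed.

Let nash_scale (K C2 E E8 S J e sg w rho delta : R) : 0 < rho -> 0 < delta -> 0 < K -> 0 < C2 ->
  0 <= E -> 0 <= J -> 0 <= e -> 0 <= sg -> w = rho ^+ n ->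
  E8 <= 2 ^+ n.+1 * (delta * rho) ^+ 2 * S + 2 * (delta * rho)^-1 ^+ n * J ^+ 2 ->
  rho ^+ 2 * S <= 64 * K * E -> J <= C2 * rho ^+ (n + 2) * (sg + e) ->
  E = e * rho ^+ (n + 4) ->
  E8 / (rho / 8) ^+ (n + 4) <= 8 ^+ (n + 4) * (2 ^+ n.+1 * 64 * K + 2 * C2 ^+ 2) *
    (delta ^+ 2 * e + delta^-1 ^+ n * (sg + e) ^+ 2).
Proof.
move=> r0 d0 K0 C20 E0 J0 e0 sg0 wE h1 h2 h3 eE.
have w0 : 0 < w by rewrite wE exprn_gt0.
have q0 : 0 < delta^-1 ^+ n by rewrite exprn_gt0// invr_gt0.
have r8 : 0 < rho / 8 by rewrite divr_gt0.
rewrite ler_pdivrMr ?exprn_gt0// (_ : 8 ^+ (n + 4) * _ * _ * (rho / 8) ^+ (n + 4) =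
  (2 ^+ n.+1 * 64 * K + 2 * C2 ^+ 2) * (delta ^+ 2 * e + delta^-1 ^+ n * (sg + e) ^+ 2) *
  rho ^+ (n + 4)); last first.
  rewrite expr_div_n; have : 8 ^+ (n + 4) != 0 :> R by rewrite expf_neq0.
  by move: (8 ^+ (n + 4)) => z z0; field.
apply: (le_trans h1).
have hS : 2 ^+ n.+1 * (delta * rho) ^+ 2 * S <= 2 ^+ n.+1 * 64 * K * (delta ^+ 2 * e) * rho ^+ (n + 4).
  have : 2 ^+ n.+1 * delta ^+ 2 * (rho ^+ 2 * S) <= 2 ^+ n.+1 * delta ^+ 2 * (64 * K * E).
    by rewrite ler_wpM2l// mulr_ge0 ?exprn_ge0// ltW.
  by rewrite eE; congr (_ <= _); ring.
have hJ : 2 * (delta * rho)^-1 ^+ n * J ^+ 2 <=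
    2 * C2 ^+ 2 * (delta^-1 ^+ n * (sg + e) ^+ 2) * rho ^+ (n + 4).
  have hJ2 : J ^+ 2 <= (C2 * rho ^+ (n + 2) * (sg + e)) ^+ 2.
    by rewrite ler_sqr ?nnegrE// !mulr_ge0 ?exprn_ge0 ?addr_ge0// ltW.
  rewrite invfM exprMn; move: hJ2; rewrite !exprD -!wE => hJ2.
  have -> : rho^-1 ^+ n = w^-1 by rewrite exprVn wE.
  apply: (@le_trans _ _ (2 * (delta^-1 ^+ n * w^-1) * (C2 * (w * rho ^+ 2) * (sg + e)) ^+ 2)).
    by apply: ler_wpM2l => //; rewrite !mulr_ge0 ?invr_ge0// ltW.
  move: (delta^-1 ^+ n) => q; rewrite le_eqVlt; apply/orP; left; apply/eqP.
  by field; rewrite gt_eqF.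
have t1 : 0 <= 2 ^+ n.+1 * 64 * K * (delta^-1 ^+ n * (sg + e) ^+ 2) * rho ^+ (n + 4).
  apply: mulr_ge0; last by rewrite exprn_ge0// ltW.
  apply: mulr_ge0; first by rewrite !mulr_ge0 ?exprn_ge0// ltW.
  by rewrite mulr_ge0 ?sqr_ge0// ltW.
have t2 : 0 <= 2 * C2 ^+ 2 * (delta ^+ 2 * e) * rho ^+ (n + 4).
  by rewrite !mulr_ge0 ?exprn_ge0 ?sqr_ge0// ltW.
apply: (le_trans (lerD hS hJ)); rewrite -subr_ge0.
rewrite [X in 0 <= X](_ : _ = 2 ^+ n.+1 * 64 * K * (delta^-1 ^+ n * (sg + e) ^+ 2) * rho ^+ (n + 4) +
  2 * C2 ^+ 2 * (delta ^+ 2 * e) * rho ^+ (n + 4)); last by ring.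
by rewrite addr_ge0.
Qed.

(** The factor 64 is 2 * 16 for the gradient of u and 2 * 16 for that of the cutoff, as (rho / 4)^2
    = rho^2 / 16. *)
Let gradient_scale (K rho S G E4 E : R) : 0 < rho -> 0 < K -> (rho / 4) ^+ 2 * G <= K * E4 ->
  E4 <= E -> S <= 2 * G + 2 * (K / (rho / 4) ^+ 2) * E4 -> rho ^+ 2 * S <= 64 * K * E.
Proof.
move=> r0 K0 hG hE hS; have r2 : 0 < rho ^+ 2 by rewrite exprn_gt0.
apply: (@le_trans _ _ (64 * K * E4)); last by rewrite ler_wpM2l// mulr_ge0// ltW.
apply: (@le_trans _ _ (rho ^+ 2 * (2 * G + 2 * (K / (rho / 4) ^+ 2) * E4))).
  by rewrite ler_wpM2l// ltW.
rewrite [leLHS](_ : _ = 32 * ((rho / 4) ^+ 2 * G) + 32 * (K * E4)); last first.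
  by field; rewrite gt_eqF.
rewrite [leRHS](_ : _ = 32 * (K * E4) + 32 * (K * E4)); last by ring.
by rewrite lerD2r ler_wpM2l.
Qed.

(** Nash's inequality for u times a cutoff on the ball of radius rho / 4: Caccioppoli bounds its
    gradient by the energy, [mean_inequality] its L^1 norm. *)
Lemma nash_step : exists2 C : R, 0 < C &
  forall Omega (u0 u : V -> R) (u1 : 'I_n -> V -> R) (u2 : 'I_n -> 'I_n -> V -> R)
      (x0 : V) (rho r delta : R),
    minimizer_data Omega u0 u u1 u2 -> {for x0, continuous u} -> u x0 = 0 ->
    0 < rho <= r -> cball x0 r `<=` Omega -> 0 < delta ->
  density u x0 (rho / 8) <= C * (delta ^+ 2 * density u x0 rho +
    delta^-1 ^+ n * (Num.sqrt (density u x0 r) + density u x0 rho) ^+ 2).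
Proof.
have [K K0 HK] := @energy_estimates R n.
have [C2 C20 HC2] := @mean_inequality R n.
exists (8 ^+ (n + 4) * (2 ^+ n.+1 * 64 * K + 2 * C2 ^+ 2)).
  apply: mulr_gt0; first by rewrite exprn_gt0.
  by apply: addr_gt0; rewrite !mulr_gt0 ?exprn_gt0.
move=> Omega u0 u u1 u2 x0 rho r delta hu cu ux0 rhor cO d0.
have hJ := HC2 _ _ _ _ _ x0 rho r hu cu ux0 rhor cO.
have /andP[rho0 rhor'] := rhor; have r0 := lt_le_trans rho0 rhor'.
have cO' : cball x0 rho `<=` Omega by apply: subset_trans cO; apply: cballS; rewrite rhor' ltW.
have s0 : 0 < rho / 4 by rewrite divr_gt0.
have srho : rho / 4 <= rho by rewrite ler_pdivrMr// ler_peMr ?ler1n// ltW.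
have cO4 : cball x0 (rho / 4) `<=` Omega.
  by apply: subset_trans cO'; apply: cballS; rewrite srho ltW.
have [_ hG _ hz] := HK _ _ _ _ _ _ _ hu s0 cO4.
have [oO bO umin uW] := hu; have mO := open_measurable_row oO.
have [U _] := (W22_W12 _ _ _ _).1 uW.
pose zeta := cutoff x0 (rho / 4); have szeta : smooth zeta := smooth_cutoff _ _.
have z0 x : ~ cball x0 (rho / 4) x -> zeta x = 0 by exact: cutoff_eq0.
have cK : compact (cball x0 (rho / 4)) by exact: compact_cball.
have hw := W1_mul oO cK cO4 szeta z0 U.
have [fi hfi] := W1_integrable cK hw.
have [fsq f0 hf1] := hw.
(* The averaging length is delta rho; delta weighs the gradient term, linear in the density, against
   the L^1 term. *)
have hn := nash (mulr_gt0 d0 rho0) fi fsq hfi.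
set f := fun x => u x * zeta x in fi fsq f0 hn.
pose f1 i x := u1 i x * zeta x + u x * partial i zeta x.
have mc s := measurable_cball x0 s.
apply: (@nash_scale K C2 _ _ (\sum_i sqn (f1 i)) _ _ _ _ rho delta rho0 d0 K0 C20 (energy_ge0 u x0 rho) _ (density_ge0 _ _ (ltW rho0))
   (sqrtr_ge0 _) (erefl _) _ _ hJ).
- by apply: Rintegral_ge0.
- apply: (@le_trans _ _ (sqn f)).
    have -> : energy u x0 (rho / 8) = \int[leb]_(x in cball x0 (rho / 8)) (f x ^+ 2).
      apply: eq_Rintegral => x /set_mem xr; rewrite /f /zeta cutoff_eq1 ?mulr1//.
      apply: (le_trans xr); rewrite -subr_ge0.
      rewrite [X in 0 <= X](_ : _ = rho ^+ 2 * 64^-1); last by field.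
      by rewrite mulr_ge0 ?sqr_ge0.
    by apply: ge0_subset_Rintegral => // [x _|]; [exact: sqr_ge0|case: fsq].
  apply: (le_trans hn); rewrite lerD2l exprVn ler_wpM2l//.
    by rewrite mulr_ge0 ?invr_ge0 ?exprn_ge0 ?mulr_ge0// ltW.
  rewrite ler_sqr ?nnegrE; [|by apply: Rintegral_ge0|by apply: Rintegral_ge0].
  have nfi : leb.-integrable setT (EFin \o (fun x => `|f x|)) by exact: integrable_norm.
  rewrite (Rintegral_support _ (mc (rho / 4))); last by move=> x /f0 ->; rewrite normr0.
  apply: le_Rintegral => //.
  - exact: integrableS nfi.
  - by apply: integrableS cO4 (integrable_norm (sq_integrable_domain hu (W22_sq uW))).
  - move=> x _; rewrite /f normrM ler_piMr//.
    by have /andP[z1 z2] := cutoff_itv x0 (rho / 4) x; rewrite ger0_norm.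
- have hE : energy u x0 (rho / 4) <= energy u x0 rho.
    by apply: (energy_le mO (W22_sq uW) _ cO'); rewrite srho ltW.
  pose kap x : R := \1_(cball x0 (rho / 4)) x.
  have mk : measurable_fun Omega kap by exact: measurable_indic.
  have huk : sq_integrable leb Omega (fun x => u x * kap x).
    apply: (sq_integrable_bounded (M := 1)) => //; last exact: W22_sq uW.
    by move=> x _; rewrite /kap indicE; case: (_ \in _); rewrite ?normr1 ?normr0.
  have EI : \int[leb]_(x in Omega) ((u x * kap x) ^+ 2) = energy u x0 (rho / 4).
    rewrite (@Rintegral_subset_support _ _ _ _ (cball x0 (rho / 4)))//.
      by apply: eq_Rintegral => x xr; rewrite /kap indicE xr mulr1.
    by move=> x _ xr; rewrite /kap indicE memNset// mulr0 expr0n.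
  have mz : measurable_fun Omega zeta.
    by apply: (@measurable_funS _ _ _ _ setT) => //; exact: smooth_measurable.
  have huz i : sq_integrable leb Omega (fun x => u1 i x * zeta x).
    apply: (sq_integrable_bounded (M := 1)) => //; last exact: W22_sq1 uW i.
    move=> x _; have /andP[z1 z2] := cutoff_itv x0 (rho / 4) x.
    by rewrite ger0_norm.
  have hf1O i : sq_integrable leb Omega (f1 i).
    by have [h _ _] := hf1 i; exact: sq_integrableS h.
  have [Gi _] := Rintegral_sum (index_enum 'I_n) mO (fun i => proj2 (huz i)).
  have [Fi FE] := Rintegral_sum (index_enum 'I_n) mO (fun i => proj2 (hf1O i)).
  have SE : \sum_i sqn (f1 i) = \int[leb]_(x in Omega) (\sum_i f1 i x ^+ 2).
    rewrite FE; apply: eq_bigr => i _; apply: Rintegral_support => // x Ox.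
    have [_ h _] := hf1 i; rewrite -/(f1 i) in h.
    by rewrite [f1 i x]h ?expr0n// => /cO4.
  pose c := K / (rho / 4) ^+ 2; have c0 : 0 < c by rewrite divr_gt0 ?exprn_gt0.
  (* The gradient of u zeta is split by (a + b)^2 <= 2 a^2 + 2 b^2, and that of zeta is at most c on
     the ball and 0 outside. *)
  have pw x : \sum_i f1 i x ^+ 2 <= 2 * (\sum_i (u1 i x * zeta x) ^+ 2) + 2 * c * (u x * kap x) ^+ 2.
    have tz : \sum_i partial i zeta x ^+ 2 <= c * kap x ^+ 2.
      have [xr|xr] := pselect (cball x0 (rho / 4) x).
        have -> : kap x = 1 by rewrite /kap indicE mem_set.
        by rewrite expr1n mulr1 ler_pdivlMr ?exprn_gt0// mulrC.
      rewrite big1; first by apply: mulr_ge0; [exact: ltW c0|exact: sqr_ge0].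
      move=> i _.
      by rewrite (partial_eq0 i (compact_closed_row cK) z0)// expr0n.
    apply: (@le_trans _ _ (2 * (\sum_i (u1 i x * zeta x) ^+ 2) + 2 * u x ^+ 2 * (\sum_i partial i zeta x ^+ 2))).
      rewrite !mulr_sumr -big_split; apply: ler_sum => i _ /=; rewrite -subr_ge0 /f1.
      by rewrite (_ : _ - _ = (u1 i x * zeta x - u x * partial i zeta x) ^+ 2) ?sqr_ge0//; ring.
    rewrite lerD2l; apply: (@le_trans _ _ (2 * u x ^+ 2 * (c * kap x ^+ 2))).
      by rewrite ler_wpM2l// mulr_ge0 ?sqr_ge0.
    by rewrite le_eqVlt; apply/orP; left; apply/eqP; ring.
  have hS : \sum_i sqn (f1 i) <= 2 * \int[leb]_(x in Omega) (\sum_i (u1 i x * zeta x) ^+ 2) +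
      2 * c * energy u x0 (rho / 4).
    rewrite SE -EI -!RintegralZl//; [|by case: huk].
    rewrite -RintegralD//; [|exact: integrable_scale|by apply: integrable_scale => //; case: huk].
    apply: le_Rintegral => //.
    apply: integrable_add => //; first exact: integrable_scale.
    by apply: integrable_scale => //; case: huk.
  exact: (gradient_scale rho0 K0 hG hE hS).
- by rewrite /density mulfVK// gt_eqF// exprn_gt0.
Qed.

(** Here sg is e(r), and y and y' are the densities before and after the step. As L sg <= 1, y <=
    sg, so the quadratic term is at most 4 B sg^2; half of L sg^2 is left for it, hence L = 8 B +
    1. *)
Let iterate_bound (C delta L B sg y y' : R) : 0 <= B -> C * delta ^+ 2 <= 2^-1 ->
  L = 8 * B + 1 -> 0 <= sg -> L * sg <= 1 -> 0 <= y -> y <= L * sg ^+ 2 ->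
  y' <= C * delta ^+ 2 * y + B * (sg + y) ^+ 2 -> y' <= L * sg ^+ 2.
Proof.
move=> B0 Cd LE sg0 Ls y0 yL h.
have ysg : y <= sg.
  by apply: (le_trans yL); rewrite expr2 mulrA ler_piMl.
have h1 : C * delta ^+ 2 * y <= 2^-1 * (L * sg ^+ 2).
  by apply: (le_trans (ler_wpM2r y0 Cd)); rewrite ler_wpM2l.
have h2 : B * (sg + y) ^+ 2 <= B * (4 * sg ^+ 2).
  rewrite ler_wpM2l// (_ : 4 * sg ^+ 2 = (sg + sg) ^+ 2); last by ring.
  by rewrite ler_sqr ?nnegrE ?addr_ge0// lerD2l.
apply: (le_trans h); apply: (le_trans (lerD h1 h2)).
rewrite -subr_ge0 LE (_ : _ - _ = 2^-1 * sg ^+ 2); last by field.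
by rewrite mulr_ge0 ?sqr_ge0.
Qed.

(** The bound is a multiple of the density at r and not of the preceding scale, so the constant does
    not grow with k. *)
Lemma density_decay : exists L eps : R, [/\ 0 < L, 0 < eps &
  forall Omega (u0 u : V -> R) (u1 : 'I_n -> V -> R) (u2 : 'I_n -> 'I_n -> V -> R)
      (x0 : V) (r : R),
    minimizer_data Omega u0 u u1 u2 -> {for x0, continuous u} -> u x0 = 0 ->
    0 < r -> cball x0 r `<=` Omega -> Num.sqrt (density u x0 r) <= eps ->
  forall k, density u x0 (r / 8 ^+ k) <= L * density u x0 r].
Proof.
have [C C0 HC] := nash_step; have C1 : 0 < C + 1 by rewrite ltr_wpDl// ltW.
(* Makes C delta^2 <= 1/2, so that the linear term uses at most half of the bound to be kept. *)
pose delta := (2 * (C + 1))^-1; have d0 : 0 < delta by rewrite invr_gt0 mulr_gt0.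
pose B := C * delta^-1 ^+ n; have B0 : 0 < B by rewrite mulr_gt0// exprn_gt0// invr_gt0.
have L0 : 0 < 8 * B + 1 by rewrite addr_gt0// mulr_gt0.
have Cd : C * delta ^+ 2 <= 2^-1.
  rewrite /delta exprVn ler_pdivrMr ?exprn_gt0 ?mulr_gt0//.
  rewrite -subr_ge0 (_ : _ - _ = 2 * C ^+ 2 + 3 * C + 2); last by field.
  by rewrite addr_ge0// addr_ge0// mulr_ge0// ?sqr_ge0// ltW.
(* The threshold 1 / L is the condition L sg <= 1 of [iterate_bound]. *)
exists (8 * B + 1), (8 * B + 1)^-1; split; rewrite ?invr_gt0//.
move=> Omega u0 u u1 u2 x0 r hu cu ux0 r0 cO hs.
set sg := Num.sqrt (density u x0 r) in hs *.
have sgE : density u x0 r = sg ^+ 2 by rewrite sqr_sqrtr// density_ge0// ltW.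
have Ls : (8 * B + 1) * sg <= 1 by rewrite -ler_pdivlMl// mulr1.
elim=> [|k IH]; first by rewrite expr0 divr1 sgE ler_peMl ?sqr_ge0// lerDr mulr_ge0// ltW.
have p0 : 0 < r / 8 ^+ k by rewrite divr_gt0 ?exprn_gt0.
have pr : 0 < r / 8 ^+ k <= r.
  by rewrite p0 ler_pdivrMr ?exprn_gt0// ler_peMr ?(ltW r0)// exprn_ege1// ler1n.
have := HC _ _ _ _ _ x0 (r / 8 ^+ k) r delta hu cu ux0 pr cO d0.
rewrite (_ : r / 8 ^+ k / 8 = r / 8 ^+ k.+1); last first.
  by rewrite exprS invfM; ring.
rewrite -/sg mulrDr [C * (delta ^+ 2 * _)]mulrA [C * (delta^-1 ^+ n * _)]mulrA -/B => h; rewrite sgE in IH *.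
exact: (iterate_bound (ltW B0) Cd (erefl _) (sqrtr_ge0 _) Ls (density_ge0 _ _ (ltW p0)) IH h).
Qed.

End decay.

(** * Nondegeneracy *)

Section free_boundary_geometry.
Context {R : realType} {n : nat}.
Local Notation V := 'rV[R]_n.
Implicit Types (x y z : V).
Context (Omega : set V) (u : V -> R) (oO : open Omega).
Context (cu : forall x, Omega x -> {for x, continuous u}).

Let pos := positivity_set Omega u.

Lemma positivity_interior x : pos x -> pos° x.
Proof.
move=> [Ox ux]; have h1 : nbhs x Omega by apply: open_nbhs_nbhs.
have h2 : nbhs x [set y | `|u x - u y| <= u x / 2].
  have e0 : 0 < u x / 2 by rewrite divr_gt0.
  by move: (cu Ox) => /(cvgrPdist_le (FF := nbhs_filter x))/(_ _ e0).
have : nbhs x (Omega `&` [set y | `|u x - u y| <= u x / 2]).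
  exact: (@filterI _ (nbhs x) (nbhs_filter x) _ _ h1 h2).
apply: filterS => y [Oy] /=; rewrite ler_norml => /andP[_ h]; split => //; lra.
Qed.

Lemma free_boundary_le0 x : free_boundary Omega u x -> u x <= 0.
Proof.
move=> [Ox [_ nx]]; rewrite leNgt; apply/negP => ux; apply: nx.
exact: positivity_interior.
Qed.

Lemma free_boundary_eq0 x : free_boundary Omega u x -> u x = 0.
Proof.
move=> fx; have ux := free_boundary_le0 fx; have [Ox [cx _]] := fx.
apply/eqP; rewrite eq_le ux /= leNgt; apply/negP => u0.
have e0 : 0 < - u x / 2 by rewrite divr_gt0// oppr_gt0.
have : nbhs x [set y | `|u x - u y| <= - u x / 2].
  by move: (cu Ox) => /(cvgrPdist_le (FF := nbhs_filter x))/(_ _ e0).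
move=> /cx [y [[_ uy] /=]]; rewrite ler_norml => /andP[h _]; lra.
Qed.

(** On the segment from x0 to a point with u <= 0, the first parameter with u <= 0 would give a free
    boundary point inside the ball. *)
Lemma segment_positive (x0 : V) (r : R) : pos x0 -> 0 < r -> eball x0 r `<=` Omega ->
  (forall z, free_boundary Omega u z -> ~ eball x0 r z) -> eball x0 r `<=` [set y | 0 < u y].
Proof.
move=> [Ox0 ux0] r0 BO noFB y yr /=; rewrite ltNge; apply/negP => uy.
pose gam (t : R) : V := x0 + t *: (y - x0).
have gamB t : 0 <= t <= 1 -> eball x0 r (gam t).
  move=> /andP[t0 t1]; apply/(eballE _ _ r0).
  have /(eballE _ _ r0) := yr; apply: le_lt_trans.
  have -> : dist2 x0 (gam t) = t ^+ 2 * dist2 x0 y.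
    by rewrite /dist2 mulr_sumr; apply: eq_bigr => i _; rewrite /gam !mxE; ring.
  by rewrite ler_piMl ?dist2_ge0// exprn_ile1.
pose A := [set t : R | 0 <= t <= 1 /\ u (gam t) <= 0].
have A1 : A 1.
  by split; [rewrite ler01 lexx|rewrite /gam scale1r addrC subrK].
have Alb : lbound A 0 by move=> t [/andP[]].
have infA : has_inf A by split; [exists 1|exists 0].
pose s := inf A.
have s0 : 0 <= s by apply: lb_le_inf => //; exists 1.
have s1 : s <= 1 by apply: ge_inf => //; exists 0.
have s01 : 0 <= s <= 1 by rewrite s0.
have Og : Omega (gam s) by apply: BO; exact: gamB.
have cgam : continuous gam.
  move=> t; apply: (@cvgD _ _ _ _ _ (fun=> x0) (fun t : R => t *: (y - x0))).
    by apply: cvg_cst; exact: nbhs_filter.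
  by apply: cvgZl => //; exact: cvg_id.
have cg : {for s, continuous (u \o gam)}.
  by apply: continuous_comp; [exact: cgam|exact: cu].
have near_s (e : R) : 0 < e -> exists2 d, 0 < d & forall t, `|s - t| < d -> `|u (gam s) - u (gam t)| <= e.
  move=> e0; have /cvgrPdist_le/(_ _ e0) := cg.
  by move=> /nbhs_ballP[d /= d0 H]; exists d => // t st; exact: H.
have us : u (gam s) <= 0.
  rewrite leNgt; apply/negP => us.
  have e0 : 0 < u (gam s) / 2 by rewrite divr_gt0.
  have [d d0 H] := near_s _ e0.
  have : s + d <= s.
    apply: lb_le_inf; first by exists 1.
    move=> t [t01 ut]; rewrite leNgt; apply/negP => tsd.
    have st : s <= t by apply: ge_inf => //; exists 0.
    have /H : `|s - t| < d by rewrite distrC ger0_norm ?subr_ge0// ltrBlDl.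
    rewrite ler_norml => /andP[_ h]; lra.
  by rewrite gerDl leNgt d0.
apply: (noFB (gam s)); last exact: gamB.
split => //; split; last by move=> /nbhs_singleton[_]; rewrite ltNge us.
have s_gt0 : 0 < s.
  rewrite lt_neqAle s0 andbT; apply/eqP => s00; move: us.
  by rewrite -s00 /gam scale0r addr0 leNgt ux0.
move=> U nU.
have /nbhs_ballP[d /= d0 H] : nbhs s (gam @^-1` U) by exact: cgam.
(* A parameter before s and close to it: by minimality u > 0 there, and the point lies in U, so the
   point at s is in the closure of {u > 0}. *)
pose t := s - Num.min d s / 2.
have m0 : 0 < Num.min d s by rewrite lt_min d0 s_gt0.
have ts : t < s by rewrite /t ltrBlDr ltrDl divr_gt0.
have t0 : 0 <= t.
  rewrite /t subr_ge0 ler_pdivrMr// (@le_trans _ _ s)//; first by rewrite ge_min lexx orbT.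
  by rewrite ler_peMr// ler1n.
have t01 : 0 <= t <= 1 by rewrite t0 (le_trans (ltW ts)).
exists (gam t); split; last first.
  apply: H; rewrite /t /ball /= opprB addrC subrK gtr0_norm ?divr_gt0//.
  apply: (@lt_le_trans _ _ (Num.min d s)); last by rewrite ge_min lexx.
  by rewrite ltr_pdivrMr// ltr_pMr// ltr1n.
split; first by apply: BO; exact: gamB.
rewrite ltNge; apply/negP => ut; have : s <= t by apply: ge_inf; [exists 0|split].
by rewrite leNgt ts.
Qed.

End free_boundary_geometry.

Section nondegeneracy.
Context {R : realType} {n : nat} (n_gt0 : (0 < n)%N).
Local Notation V := 'rV[R]_n.
Local Notation leb := (@lebesgue_row R n).
Implicit Types (x : V) (rho : R).

Lemma volume_le (A B : set V) : measurable A -> measurable B -> A `<=` B ->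
  leb B \is a fin_num -> volume A <= volume B.
Proof.
move=> mA mB AB fB; have AB' : (leb A <= leb B)%E by apply: le_measure; rewrite ?inE.
apply: fine_le => //; rewrite ge0_fin_numE//; apply: le_lt_trans AB' _.
by rewrite -ge0_fin_numE.
Qed.

(** The cube inscribed in the closed ball of radius rho / 4 has side rho / (2 n). *)
Lemma volume_half_ball_ge (x0 : V) rho : 0 < rho ->
  (2 * n%:R)^-1 ^+ n * rho ^+ n <= volume (eball x0 (rho / 2)).
Proof.
move=> r0; have r2 : 0 < rho / 2 by rewrite divr_gt0.
apply: (@le_trans _ _ (volume (cball x0 (rho / 4)))).
  have r4 : 0 <= rho / 4 by rewrite divr_ge0// ltW.
  apply: le_trans (volume_cball_ge x0 n_gt0 r4); rewrite -exprMn le_eqVlt; apply/orP; left.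
  by apply/eqP; congr (_ ^+ n); field; rewrite pnatr_eq0 -lt0n.
apply: volume_le; [exact: measurable_cball|exact: measurable_eball| |].
  apply: cball_eball; first by rewrite divr_ge0// ltW.
  by rewrite ltr_pM2l// ltf_pV2 ?posrE// ltr_nat.
rewrite ge0_fin_numE//; apply: (@le_lt_trans _ _ (leb (cball x0 (rho / 2)))).
  by apply: le_measure; rewrite ?inE; [exact: measurable_eball|exact: measurable_cball|exact: eball_cball].
by rewrite -ge0_fin_numE//; exact: lebesgue_cball_fin.
Qed.

Lemma energy_upper Omega (u : V -> R) (x0 : V) (rho S : R) : measurable Omega ->
  sq_integrable leb Omega u -> 0 < rho -> cball x0 rho `<=` Omega ->
  (forall x, cball x0 rho x -> `|u x| <= S) -> energy u x0 rho <= S ^+ 2 * (2 * rho) ^+ n.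
Proof.
move=> mO hu r0 cO uS; have mc := measurable_cball x0 rho.
have [mu _] := sq_integrableS mO mc cO hu.
have [_ h] := @sq_integral_le_volume R n (cball x0 rho) (cball x0 rho) u S mc mc (@subset_refl _ _)
  (lebesgue_cball_fin x0 rho) mu (fun x xc nc => False_ind _ (nc xc)) uS.
apply: (le_trans h); rewrite ler_wpM2l ?sqr_ge0//.
by apply: volume_cball_le; exact: ltW.
Qed.

Let density_contra (K L theta X d p a : R) : 0 < K -> 0 < L -> 0 < theta -> 0 < p -> 0 < a ->
  d < theta / (4 * K * L) * a -> X <= K * (L * d) * p -> theta / 2 * (a * p) < X -> False.
Proof.
move=> K0 L0 t0 p0 a0 hd hX; rewrite ltNge => /negP; apply; apply: (le_trans hX).
apply: (@le_trans _ _ (K * (L * (theta / (4 * K * L) * a)) * p)).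
  by rewrite ler_pM2r// ler_pM2l// ler_pM2l// ltW.
rewrite -subr_ge0 (_ : _ - _ = theta / 4 * (a * p)); last by field; rewrite !gt_eqF.
by rewrite !mulr_ge0 ?divr_ge0// ltW.
Qed.

(** Otherwise the density at all scales r / 8^k is small by [density_decay], so {u > 0} fills too
    small a part of small balls. This contradicts the lower density assumed at x0. *)
Lemma density_lower_bound : exists c : R -> R, (forall theta, 0 < c theta) /\
  forall Omega (u0 u : V -> R) (u1 : 'I_n -> V -> R) (u2 : 'I_n -> 'I_n -> V -> R)
      (x0 : V) (r theta : R),
    minimizer_data Omega u0 u u1 u2 -> {for x0, continuous u} -> u x0 = 0 ->
    0 < r -> cball x0 r `<=` Omega -> 0 < theta ->
    (exists2 s, 0 < s & forall rho, 0 < rho < s -> theta / 2 * volume (eball x0 rho) <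
       volume (eball x0 rho `&` positivity_set Omega u)) ->
  c theta <= density u x0 r.
Proof.
have [K K0 HK] := @energy_estimates R n.
have [L [eps [L0 eps0 HL]]] := @density_decay R n.
have nR : 0 < n%:R :> R by rewrite ltr0n.
pose a : R := (2 * n%:R)^-1 ^+ n; have a0 : 0 < a by rewrite exprn_gt0// invr_gt0 mulr_gt0.
(* The default 1 makes c positive for every theta. For theta > 0 the first bound allows
   [density_decay]; the second leaves {u > 0} at most theta / 4 of the volume a rho^n, against the
   theta / 2 assumed. *)
pose c (theta : R) := if 0 < theta then Num.min (eps ^+ 2) (theta / (4 * K * L) * a) else 1.
have KL : 0 < 4 * K * L by rewrite !mulr_gt0.
exists c; split.
  move=> theta; rewrite /c; case: ifP => // t0.
  by rewrite lt_min exprn_gt0// mulr_gt0// divr_gt0.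
move=> Omega u0 u u1 u2 x0 r theta hu cu ux0 r0 cO t0 [s s0 hs].
rewrite leNgt; apply/negP; rewrite /c t0 lt_min => /andP[d1 d2].
have hd : Num.sqrt (density u x0 r) <= eps.
  by rewrite -(ger0_norm (ltW eps0)) -sqrtr_sqr ler_sqrt ?sqr_ge0// ltW.
have dec := HL _ _ _ _ _ x0 r hu cu ux0 r0 cO hd.
(* Since 8^k > k > r / s, the radius r / 8^k is below s. *)
pose k := (Num.truncn (r / s)).+1.
have rk : r / 8 ^+ k < s.
  rewrite ltr_pdivrMr ?exprn_gt0// mulrC -ltr_pdivrMr//.
  apply: (lt_trans (Num.Theory.truncnS_gt _)); rewrite -/k -natrX ltr_nat.
  exact: ltn_expl.
set rho := r / 8 ^+ k in rk.
have rho0 : 0 < rho by rewrite divr_gt0// exprn_gt0.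
have rhor : rho <= r by rewrite ler_pdivrMr ?exprn_gt0// ler_peMr ?(ltW r0)// exprn_ege1// ler1n.
have cO' : cball x0 rho `<=` Omega by apply: subset_trans cO; apply: cballS; rewrite rhor ltW.
have [_ _ hV _] := HK _ _ _ _ _ x0 rho hu rho0 cO'.
have [oO bO umin uW] := hu; have [mu _] := W22_sq uW.
have mP := measurable_positivity_set oO mu.
have h2 : 0 < rho / 2 by rewrite divr_gt0.
have h2s : 0 < rho / 2 < s.
  by rewrite h2 (le_lt_trans _ rk)// ler_pdivrMr// ler_peMr ?ler1n// ltW.
have mH : measurable [set x | dist2 x0 x <= rho ^+ 2 / 2].
  by apply: compact_measurable_row; exact: compact_dist2.
set X := volume (positivity_set Omega u `&` _) in hV.
apply: (@density_contra K L theta X (density u x0 r) (rho ^+ n) a) => //.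
- exact: exprn_gt0.
- have dE : energy u x0 rho = density u x0 rho * (rho ^+ n * rho ^+ 4).
    by rewrite -exprD /density mulfVK// gt_eqF// exprn_gt0.
  rewrite -(ler_pM2l (exprn_gt0 4 rho0)); apply: (le_trans hV); rewrite dE.
  rewrite [leRHS](_ : _ = K * ((L * density u x0 r) * (rho ^+ n * rho ^+ 4))); last by ring.
  rewrite ler_pM2l// ler_pM2r ?mulr_gt0 ?exprn_gt0//; exact: dec.
(* The density hypothesis is used at radius rho / 2, whose ball lies in the set dist2 <= rho^2 / 2
   of the volume estimate. *)
- apply: (@le_lt_trans _ _ (theta / 2 * volume (eball x0 (rho / 2)))).
    rewrite ler_pM2l ?divr_gt0//; exact: volume_half_ball_ge.
  apply: (lt_le_trans (hs _ h2s)); apply: volume_le.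
  + by apply: measurableI => //; exact: measurable_eball.
  + exact: measurableI.
  + move=> x [/(eballE _ _ h2) xr Px]; split => //=; apply: (le_trans (ltW xr)).
    rewrite expr_div_n ler_pM2l ?exprn_gt0// lef_pV2 ?posrE ?exprn_gt0//.
    by rewrite expr2 ler_peMr// ler1n.
  + by apply: (fin_measure oO bO); [exact: measurableI|move=> x [[]]].
Qed.

(** The density is taken at radius r / 2, so that the closed ball lies in the open one where |u| <=
    S. It is at most 2^(n+4) S^2 / r^4, which explains the constant. *)
Lemma nondegeneracy_free_boundary : exists c : R -> R, (forall theta, 0 < c theta) /\
  forall Omega (u0 u : V -> R) (u1 : 'I_n -> V -> R) (u2 : 'I_n -> 'I_n -> V -> R)
      (x0 : V) (r theta S : R),
    minimizer_data Omega u0 u u1 u2 -> {for x0, continuous u} -> u x0 = 0 ->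
    0 < r -> eball x0 r `<=` Omega -> 0 < theta ->
    (exists2 s, 0 < s & forall rho, 0 < rho < s -> theta / 2 * volume (eball x0 rho) <
       volume (eball x0 rho `&` positivity_set Omega u)) ->
    (forall x, eball x0 r x -> `|u x| <= S) -> 0 <= S -> c theta * r ^+ 2 <= S.
Proof.
have [c [c0 Hc]] := density_lower_bound.
exists (fun theta => Num.sqrt (c theta / 2 ^+ (n + 4))); split.
  by move=> theta; rewrite sqrtr_gt0 divr_gt0// exprn_gt0.
move=> Omega u0 u u1 u2 x0 r theta S hu cu ux0 r0 rO t0 H uS S0.
have r2 : 0 < r / 2 by rewrite divr_gt0.
have r2r : r / 2 < r by rewrite ltr_pdivrMr// ltr_pMr// ltr1n.
have cr : cball x0 (r / 2) `<=` eball x0 r by apply: cball_eball => //; exact: ltW.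
have cO := subset_trans cr rO.
have hc := Hc _ _ _ _ _ x0 (r / 2) theta hu cu ux0 r2 cO t0 H.
have [oO bO umin uW] := hu.
have hE := energy_upper (open_measurable_row oO) (W22_sq uW) r2 cO (fun x xc => uS x (cr x xc)).
have r4 : 0 < r ^+ 4 by exact: exprn_gt0.
have hd : c theta / 2 ^+ (n + 4) * r ^+ 4 <= S ^+ 2.
  have : c theta <= S ^+ 2 * (2 * (r / 2)) ^+ n / (r / 2) ^+ (n + 4).
    by apply: (le_trans hc); rewrite /density ler_pM2r// invr_gt0 exprn_gt0.
  have -> : 2 * (r / 2) = r by field.
  rewrite expr_div_n [r ^+ (n + 4)]exprD.
  have rn : 0 < r ^+ n by exact: exprn_gt0.
  have pn : 0 < 2 ^+ (n + 4) :> R by exact: exprn_gt0.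
  move: (r ^+ n) (2 ^+ (n + 4)) rn pn => p q p0 q0 h.
  rewrite mulrAC ler_pdivrMr// -ler_pdivlMr//; apply: (le_trans h).
  by rewrite le_eqVlt; apply/orP; left; apply/eqP; field; rewrite !gt_eqF.
rewrite -ler_sqr ?nnegrE ?mulr_ge0 ?sqrtr_ge0 ?(ltW r0)//.
rewrite exprMn sqr_sqrtr; last by rewrite divr_ge0 ?exprn_ge0// ltW.
by rewrite -exprM.
Qed.

Lemma nondegeneracy_positive : exists2 c : R, 0 < c &
  forall Omega (u0 u : V -> R) (u1 : 'I_n -> V -> R) (u2 : 'I_n -> 'I_n -> V -> R)
      (x0 : V) (r S : R),
    minimizer_data Omega u0 u u1 u2 -> 0 < r -> eball x0 r `<=` Omega ->
    (forall x, eball x0 r x -> 0 < u x <= S) -> c * r ^+ 2 <= S.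
Proof.
have [K K0 HK] := @energy_estimates R n.
have nR : 0 < n%:R :> R by rewrite ltr0n.
pose a : R := (2 * n%:R)^-1 ^+ n; have a0 : 0 < a by rewrite exprn_gt0// invr_gt0 mulr_gt0.
(* From (r/2)^4 a (r/2)^n <= K S^2 r^n: the ball of radius r / 4 lies in {u > 0}, and the volume
   estimate at radius r / 2 bounds its volume by the energy. *)
pose q : R := 16^-1 * (2^-1 ^+ n * a / K).
have q0 : 0 < q by rewrite mulr_gt0// divr_gt0// mulr_gt0// exprn_gt0// invr_gt0.
exists (Num.sqrt q); first by rewrite sqrtr_gt0.
move=> Omega u0 u u1 u2 x0 r S hu r0 rO uS.
have r2 : 0 < r / 2 by rewrite divr_gt0.
have r2r : r / 2 < r by rewrite ltr_pdivrMr// ltr_pMr// ltr1n.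
have cr : cball x0 (r / 2) `<=` eball x0 r by apply: cball_eball => //; exact: ltW.
have cO := subset_trans cr rO.
have x0r : eball x0 r x0.
  apply/eballE => //; rewrite /dist2 big1 ?exprn_gt0// => i _.
  by rewrite subrr expr0n.
have S0 : 0 < S by have /andP[] := uS _ x0r; exact: lt_le_trans.
have [oO bO umin uW] := hu.
have uS' x : cball x0 (r / 2) x -> `|u x| <= S.
  by move=> /cr/uS/andP[u_gt0 h]; rewrite gtr0_norm.
have hE := energy_upper (open_measurable_row oO) (W22_sq uW) r2 cO uS'.
have [_ _ hV _] := HK _ _ _ _ _ x0 (r / 2) hu r2 cO.
have r22 : 0 < r / 2 / 2 by rewrite divr_gt0.
have mP := measurable_positivity_set oO (proj1 (W22_sq uW)).
have mH : measurable [set x | dist2 x0 x <= (r / 2) ^+ 2 / 2].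
  by apply: compact_measurable_row; exact: compact_dist2.
have hv : a * (r / 2) ^+ n <= volume (positivity_set Omega u `&` [set x | dist2 x0 x <= (r / 2) ^+ 2 / 2]).
  apply: (le_trans (volume_half_ball_ge x0 r2)); apply: volume_le.
  + exact: measurable_eball.
  + exact: measurableI.
  + move=> x xr; have xc : cball x0 (r / 2) x.
      apply: (cballS (rho := r / 2 / 2)); last exact: eball_cball.
      by rewrite (ltW r22)/= ler_pdivrMr// ler_peMr ?ler1n// ltW.
    split; first by split; [exact: cO|have /andP[] := uS x (cr x xc)].
    move: xr => /(eballE _ _ r22) xr; apply: (le_trans (ltW xr)).
    rewrite expr_div_n ler_pM2l ?exprn_gt0// lef_pV2 ?posrE ?exprn_gt0//.
    by rewrite expr2 ler_peMr// ler1n.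
  + by apply: (fin_measure oO bO); [exact: measurableI|move=> x [[]]].
have rn : 0 < r ^+ n by exact: exprn_gt0.
have hq : q * r ^+ 4 <= S ^+ 2.
  have h1 : (r / 2) ^+ 4 * (a * (r / 2) ^+ n) <= K * (S ^+ 2 * (2 * (r / 2)) ^+ n).
    apply: (@le_trans _ _ (K * energy u x0 (r / 2))).
      apply: le_trans hV; rewrite ler_pM2l//; exact: exprn_gt0.
    by rewrite ler_pM2l.
  move: h1; have -> : 2 * (r / 2) = r by field.
  rewrite [(r / 2) ^+ n]exprMn /q; move: (r ^+ n) (2^-1 ^+ n) rn => p z p0 h1.
  rewrite -(ler_pM2l (mulr_gt0 K0 p0)); move: h1; congr (_ <= _); last by ring.
  by field; rewrite gt_eqF.
rewrite -ler_sqr ?nnegrE ?mulr_ge0 ?sqrtr_ge0 ?(ltW r0) ?(ltW S0)//.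
by rewrite exprMn sqr_sqrtr ?(ltW q0)// -exprM.
Qed.

End nondegeneracy.

(* c1 depends on theta, dist(B_r(x0), boundary of Omega) and the norm of u0;
   c2 on the last two. Both may depend on n, and on nothing else. The continuity
   hypothesis selects the continuous representative of the minimizer. *)
Theorem theorem1p8 (R : realType) (n : nat) (n_gt0 : (0 < n)%N) :
  exists (c1 : R -> R -> R -> R) (c2 : R -> R -> R),
    (forall theta d M, 0 < c1 theta d M) /\
    (forall d M, 0 < c2 d M) /\
    forall (Omega : set 'rV[R]_n) (u0 u : 'rV[R]_n -> R),
      smooth_bounded_domain Omega ->
      sobolev Omega 2 u0 ->
      minimizer Omega u0 u ->
      (forall x, Omega x -> {for x, continuous u}) ->
      (forall (x0 : 'rV[R]_n) (theta : R),
         0 < theta ->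
         free_boundary Omega u x0 ->
         (theta%:E <= limf_einf (fun rho : R =>
            (volume (eball x0 rho `&` positivity_set Omega u)
               / volume (eball x0 rho))%:E) 0^'+)%E ->
         forall r : R, 0 < r ->
           closure (eball x0 r) `<=` Omega ->
           ((c1 theta (fine (set_dist (eball x0 r) (boundary Omega)))
                (sobolev_norm Omega 2 u0) * r ^+ 2)%:E
              <= ereal_sup [set `|u x|%:E | x in eball x0 r])%E) /\
      (forall (x0 : 'rV[R]_n) (r : R),
         positivity_set Omega u x0 ->
         r%:E = set_dist [set x0] (free_boundary Omega u) ->
         closure (eball x0 r) `<=` Omega ->
         ((c2 (fine (set_dist (eball x0 r) (boundary Omega)))
              (sobolev_norm Omega 2 u0) * r ^+ 2)%:E
            <= ereal_sup [set (Num.max (u x) 0)%:E | x in eball x0 r])%E).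
Proof.
have [c [c_gt0 Hc]] := @nondegeneracy_free_boundary R n n_gt0.
have [c' c'_gt0 Hc'] := @nondegeneracy_positive R n n_gt0.
exists (fun theta _ _ => c theta), (fun _ _ => c'); do 2! split => //.
move=> Omega u0 u [_ oO _ bO _] _ umin cu.
have mO := open_measurable_row oO.
have [u1 [u2 uW]] := sobolev_W22 mO (proj1 (proj1 umin)).
have hu : minimizer_data Omega u0 u u1 u2 by [].
split.
  move=> x0 theta theta0 fx0 hliminf r r0 cr.
  have rO : eball x0 r `<=` Omega := subset_trans (@subset_closure _ _) cr.
  have [Ox0 _] := fx0; have ux0 := free_boundary_eq0 oO cu fx0.
  have x0r : eball x0 r x0.
    apply/eballE => //; rewrite /dist2 big1 ?exprn_gt0// => i _.
    by rewrite subrr expr0n.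
  set s := ereal_sup _.
  have ub x : eball x0 r x -> (`|u x|%:E <= s)%E.
    by move=> xr; apply: ereal_sup_ubound; exists x.
  (* An infinite supremum makes the claim trivial, and it is not -oo because the ball contains
     x0. *)
  case E : s => [S| |]; [|exact: leey|by have := ub _ x0r; rewrite E].
  rewrite lee_fin; apply: (Hc _ _ _ _ _ x0 r theta S hu (cu _ Ox0) ux0 r0 rO theta0).
  (* The lower limit is a supremum of infima over sets of the filter, so the strict bound by theta /
     2 holds on a whole punctured right neighbourhood of 0. *)
  - have h2 : ((theta / 2)%:E < theta%:E)%E.
      by rewrite lte_fin ltr_pdivrMr// ltr_pMr// ltr1n.
    have := lt_le_trans h2 hliminf; rewrite limf_einfE => /ereal_sup_gt[_ [W WF <-] hW].
    have /nbhs_ballP[d /= d0 hd] : nbhs (0 : R) [set rho | 0 < rho -> W rho] by exact: WF.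
    exists d => // rho /andP[rho0 rhod].
    have Wrho : W rho by apply: hd => //; rewrite /ball /= sub0r normrN gtr0_norm.
    have vol_gt0 : 0 < volume (eball x0 rho).
      have := volume_half_ball_ge n_gt0 x0 (_ : 0 < 2 * rho); rewrite mulr_gt0// => /(_ isT).
      rewrite (_ : 2 * rho / 2 = rho); last by field.
      apply: lt_le_trans; rewrite mulr_gt0 ?exprn_gt0 ?mulr_gt0// invr_gt0 mulr_gt0//.
      by rewrite ltr0n.
    rewrite -ltr_pdivlMr// -lte_fin; apply: (lt_le_trans hW).
    by apply: ereal_inf_lbound; exists rho.
  - by move=> x xr; have := ub _ xr; rewrite E lee_fin.
  - by have := ub _ x0r; rewrite E lee_fin; apply: le_trans.
move=> x0 r px0 rE cr.
have enormN x y : enorm (x - y) = enorm (y - x) :> R.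
  by rewrite /enorm; congr Num.sqrt; apply: eq_bigr => i _; rewrite !mxE -sqrrN opprB.
have le_r z : free_boundary Omega u z -> r <= enorm (x0 - z).
  move=> fz; rewrite -lee_fin rE; apply: ereal_inf_lbound.
  by exists x0 => //; exists z.
(* A sup-norm ball around x0 lies in {u > 0}, which no free boundary point meets, and the Euclidean
   norm dominates the sup norm. *)
have r0 : 0 < r.
  have /nbhs_ballP[d /= d0 hd] := positivity_interior oO cu px0.
  apply: (lt_le_trans d0); rewrite -lee_fin rE.
  apply: le_ereal_inf_tmp => _ [_ -> [z fz <-]]; rewrite lee_fin leNgt; apply/negP => zd.
  have : positivity_set Omega u z.
    apply: hd; split => // k i; rewrite ord1 -ball_normE /=; apply: le_lt_trans zd.
    rewrite /enorm -sqrtr_sqr ler_sqrt; last by apply: sumr_ge0 => j _; exact: sqr_ge0.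
    rewrite (bigD1 i)//= !mxE lerDl; apply: sumr_ge0 => j _; exact: sqr_ge0.
  by move=> [_]; rewrite ltNge (free_boundary_le0 oO cu fz).
have rO : eball x0 r `<=` Omega := subset_trans (@subset_closure _ _) cr.
have noFB z : free_boundary Omega u z -> ~ eball x0 r z.
  by move=> /le_r h zr; move: h; rewrite leNgt enormN => /negP; apply.
(* The ball of radius equal to the distance avoids the free boundary, so u > 0 on it and the maximum
   of u and 0 is u. *)
have upos := segment_positive cu px0 r0 rO noFB.
have x0r : eball x0 r x0.
  apply/eballE => //; rewrite /dist2 big1 ?exprn_gt0// => i _.
  by rewrite subrr expr0n.
set s := ereal_sup _.
have ub x : eball x0 r x -> ((Num.max (u x) 0)%:E <= s)%E.
  by move=> xr; apply: ereal_sup_ubound; exists x.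
case E : s => [S| |]; [|exact: leey|by have := ub _ x0r; rewrite E].
rewrite lee_fin; apply: (Hc' _ _ _ _ _ x0 r S hu r0 rO) => x xr.
rewrite upos//=; have := ub _ xr; rewrite E lee_fin; apply: le_trans.
by rewrite le_max lexx.
Qed.
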